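(* Let $u(y)=\tanh y$, $f\in H^1_{1/(u')^2}(\mathbb R)$, and let $\Phi(1,y,\mathbf c)$ be the unique $H^2(\mathbb R)$ solution (in $y$) of $$(u-\mathbf c)(\Phi''-\Phi)-u''\Phi=f,\qquad \mathbf c\in O_{\epsilon_0}.$$ Then for every $y\neq0$, $$\lim_{\pm\operatorname{Im}\mathbf c>0,\ |\mathbf c|\to0}\mathbf c\,\Phi(1,y,\mathbf c)=\frac{\mathcal T(f)(0)\pm i\pi f(0)}{\pm2\pi i}\,\operatorname{sech}y .$$ Moreover, for every $y\ne0$ there exists $\delta_1=\delta_1(y)>0$ such that for $\delta\in(0,\delta_1)$ one has $B_\delta(0)\setminus(-1,1)\subset O_{\epsilon_0}$ and $$|\mathbf c\,\Phi(1,y,\mathbf c)|\le C\qquad\text{for all }\mathbf c\in B_\delta(0)\setminus(-1,1),$$ where $C$ is independent of $\mathbf c$.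
   Context: For $c\in(-1,1)$, $y_c=u^{-1}(c)$. With $\alpha=1$, let $\phi_1(y,c)$, $(y,c)\in\mathbb R\times(-1,1)$, be the unique continuous solution of $$\phi_1(y,c)=1+\alpha^2\int_{y_c}^y\frac{\int_{y_c}^z(u(w)-c)^2\phi_1(w,c)\,dw}{(u(z)-c)^2}\,dz .$$ The operator $\mathcal T$ (with $\alpha=1$) is $$\mathcal T(f)(c)=\mathrm{p.v.}\int_{\mathbb R}\frac{\int_{y_c}^y\phi_1(z,c)f(z)\,dz}{(u(y)-c)^2\phi_1(y,c)^2}\,dy,\qquad c\in(-1,1),$$ the principal value being at $y=y_c$. $O_{\epsilon_0}=\{c+i\epsilon:\ c\in(-1,1),\ 0<|\epsilon|<\min\{C_o^{-1}(1-c^2),\epsilon_0\}\}$ for a fixed sufficiently large constant $C_o>1$ and sufficiently small $\epsilon_0\in(0,\frac12)$; for $\mathbf c\in O_{\epsilon_0}$ the displayed equation has a unique solution in $H^2(\mathbb R)$. $B_\delta(0)=\{\mathbf c\in\mathbb C:|\mathbf c|<\delta\}$. The norm of $H^1_{1/(u')^2}(\mathbb R)$ is $\big(\int_{\mathbb R}(|f|^2+|f'|^2)(u')^{-2}dy\big)^{1/2}$, with $u'=\operatorname{sech}^2 y$. *)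

(* Defs.v *)
From HB Require Import structures.
From mathcomp Require Export all_boot all_order all_algebra.
From mathcomp Require Export complex.
From mathcomp Require Export all_classical all_reals all_analysis.
Export Order.TTheory GRing.Theory Num.Theory.
Export numFieldNormedType.Exports.

Set Implicit Arguments.
Unset Strict Implicit.
Unset Printing Implicit Defensive.

Global Open Scope classical_set_scope.
Global Open Scope complex_scope.
Global Open Scope ring_scope.

(* The topology of the norm of R[i], which is not registered in complex.v. *)
#[warnings="-redundant-canonical-projection"]
HB.instance Definition _ (R : realType) :=
  NormedModule.copy R[i] (R[i] : numFieldType)^o.

Notation cnorm := ComplexField.Normc.normc.

Section background.
Context {R : realType}.
Implicit Types (f g : R -> R[i]) (y c : R).

Notation mu := (@lebesgue_measure R).

Definition cosh y : R := (expR y + expR (- y)) / 2.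
Definition sinh y : R := (expR y - expR (- y)) / 2.
Definition sech y : R := (cosh y)^-1.
Definition tanh y : R := sinh y / cosh y.

Definition oriented_integral (a b : R) (h : R -> R) : R :=
  if a <= b then \int[mu]_(x in `[a, b]) h x
  else - \int[mu]_(x in `[b, a]) h x.

Definition Cintegral (D : set R) f : R[i] :=
  (\int[mu]_(x in D) complex.Re (f x)) +i* (\int[mu]_(x in D) complex.Im (f x)).

Definition oriented_Cintegral (a b : R) f : R[i] :=
  if a <= b then Cintegral `[a, b] f else - Cintegral `[b, a] f.

Definition principal_value (a : R) f : R[i] :=
  lim (Cintegral [set y | eta < `|y - a|] f @[eta --> (0 : R)^'+]).

(* f belongs to L^2 for the measure w(y) dy. *)
Definition L2_weighted (w : R -> R) f : Prop :=
  [/\ measurable_fun [set: R] (fun y => complex.Re (f y)),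
      measurable_fun [set: R] (fun y => complex.Im (f y)) &
      (\int[mu]_y ((cnorm (f y) ^+ 2 * w y)%:E) < +oo)%E].

(* Testing against C^1 rather than C^infinity functions of compact support is a
   usual convention for weak derivatives on the line and gives the same notion. *)
Definition test_function (psi : R -> R) : Prop :=
  [/\ forall x, derivable psi x 1, continuous (derive1 psi) &
      exists M : R, forall x, M < `|x| -> psi x = 0].

Definition weak_derivative f g : Prop :=
  forall psi, test_function psi ->
    Cintegral [set: R] (fun y => f y * (derive1 psi y)%:C) =
    - Cintegral [set: R] (fun y => g y * (psi y)%:C).

(* Elements of H^1 and H^2 are identified with their continuous
   representatives, so that their values at points make sense. *)
Definition H1_weighted (w : R -> R) f : Prop :=
  [/\ continuous f, L2_weighted w f &
      exists2 g, weak_derivative f g & L2_weighted w g].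

Definition H2_with_derivatives f f1 f2 : Prop :=
  [/\ continuous f, weak_derivative f f1, weak_derivative f1 f2 &
      [/\ L2_weighted (cst 1) f, L2_weighted (cst 1) f1 &
          L2_weighted (cst 1) f2]].

(* y_c = u^{-1}(c) for u = tanh; meaningful for -1 < c < 1. *)
Definition crit c : R := get [set y | tanh y = c].

(* phi1 y c stands for phi_1(y, c), with alpha = 1.  The outer integrand takes
   the junk value 0 at the single point z = y_c, which is Lebesgue-null. *)
Definition is_phi1 (phi1 : R -> R -> R) : Prop :=
  {within [set p : R * R | -1 < p.2 < 1], continuous (fun p => phi1 p.1 p.2)} /\
  forall y c, -1 < c < 1 ->
    phi1 y c = 1 + oriented_integral (crit c) y (fun z =>
      oriented_integral (crit c) z (fun w => (tanh w - c) ^+ 2 * phi1 w c)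
        / (tanh z - c) ^+ 2).

Definition calT (phi1 : R -> R -> R) f c : R[i] :=
  principal_value (crit c) (fun y =>
    oriented_Cintegral (crit c) y (fun z => (phi1 z c)%:C * f z)
      / ((tanh y - c) ^+ 2 * phi1 y c ^+ 2)%:C).

Definition O_domain (Co eps0 : R) : set R[i] :=
  [set c | -1 < complex.Re c < 1 /\
           0 < `|complex.Im c| < Num.min (Co^-1 * (1 - complex.Re c ^+ 2)) eps0].

Definition Cball (delta : R) : set R[i] :=
  [set c | cnorm c < delta].

Definition real_segment : set R[i] := [set x%:C | x in `]-1, 1[ : set R].

(* F is an H^2 solution of (u - c)(F'' - F) - u'' F = f with u = tanh. *)
Definition is_H2_solution f (c : R[i]) (F : R -> R[i]) : Prop :=
  exists F1 F2, H2_with_derivatives F F1 F2 /\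
    {ae mu, forall y,
      ((tanh y)%:C - c) * (F2 y - F y) - (derive1n 2 tanh y)%:C * F y = f y}.

End background.

(* Main.v *)
Require Import Defs.
From mathcomp Require Import ring lra measurable_realfun.

(** Write u = tanh and q y = cosh y * c Phi(1, y, c). At c = 0 the homogeneous
    equation is solved by sech, so one expects q to become constant as c tends
    to 0, and the point is to find the constant. With W the Wronskian of sech and
    c Phi, the equation is equivalent to
      q' = cosh^2 W,   W' = c (sech f - 2 sech^4 q) / (u - c),
    and W vanishes at both ends because Phi is in H^2. These equations hold
    classically, since off the real axis a weak solution is twice continuously
    differentiable ([H2_solution_classical],
    [wronskian_system_of_H2_solution]).

    First, q is almost constant ([oscillation_small]). In the variable u, the
    source of W has the density cosh f - 2 sech^2 q, which is Hoelder continuous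
    of exponent 1/2: for f this is the embedding of H^1, for q it is part of what
    is to be shown. Hence near the critical point W is c times the value of that
    density there times a logarithm, up to a remainder whose derivative in u is of
    size |c| |u - Re c|^(-1/2), uniformly in Im c ([near_wronskian]). All in all
    W is O(|c| |u - Re c|^(-1/2)), and integrating once more bounds the increments
    of q by |c| |du|^(1/2) times a constant that involves the Hoelder constant of
    q itself; as the latter is finite and comes with a factor |c|, it can be
    absorbed.

    Second, q 0 is determined by the vanishing of W at both ends
    ([solvability]). For small e, integrate W' / c over the line. Over |y| > e one
    may put c = 0 and q = q 0: the two contributions of q 0 cancel by symmetry,
    and the one of f is the integral of sech f / tanh, which equals the truncated
    principal value T e up to O(sqrt e), by an integration by parts that uses
    tanh * phi_1 = sech (y + sinh y cosh y) / 2 ([phi1_formula],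
    [outer_integrals]). Over |y| < e, the density with respect to du is nearly
    f 0 - 2 q 0, and the integral of du / (u - c) is an increment of a logarithm
    that tends to i pi s as c tends to 0, where s is the sign of Im c
    ([clog_jump]). Thus
      (f 0 - 2 q 0) i pi s + T e
    is small compared with 1 + |q 0|. Consequently q 0 stays bounded, T e
    converges to the principal value L as e tends to 0, and q 0 tends to
    (L + i pi s f 0) / (2 i pi s) ([solvability_limit], [half_plane_limit]).

    The bound follows from the two limits: a function with a limit is bounded near
    the limit point, and a small disc without the real segment is covered by the
    two half-planes. *)

Set Implicit Arguments.
Unset Strict Implicit.
Unset Printing Implicit Defensive.

(** * Derivatives and comparison on the real line *)

Section RealCalculus.
Context {R : realType}.
Implicit Types (F G B f g : R -> R) (x y a b k p : R).

Lemma drv_eq f x a b : is_derive x 1 f a -> a = b -> is_derive x 1 f b.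
Proof. by move=> ? <-. Qed.

Lemma drvD f g x a b : is_derive x 1 f a -> is_derive x 1 g b ->
  is_derive x 1 (fun y => f y + g y) (a + b).
Proof. by move=> ? ?; exact: is_deriveD. Qed.

Lemma drvB f g x a b : is_derive x 1 f a -> is_derive x 1 g b ->
  is_derive x 1 (fun y => f y - g y) (a - b).
Proof. by move=> ? ?; exact: is_deriveB. Qed.

Lemma drvN f x a : is_derive x 1 f a -> is_derive x 1 (fun y => - f y) (- a).
Proof. by move=> ?; exact: is_deriveN. Qed.

Lemma drvM f g x a b : is_derive x 1 f a -> is_derive x 1 g b ->
  is_derive x 1 (fun y => f y * g y) (a * g x + f x * b).
Proof.
move=> fa gb; have h := is_deriveM fa gb.
by apply: (is_derive_eq h); rewrite /GRing.scale /=; ring.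
Qed.

Lemma drvZ k f x a : is_derive x 1 f a -> is_derive x 1 (fun y => k * f y) (k * a).
Proof.
move=> fa; apply: (drv_eq (drvM (is_derive_cst k x (1 : R)) fa)).
by rewrite mul0r add0r.
Qed.

Lemma drv_linear k x : is_derive x 1 (fun y => k * y) k.
Proof. by apply: (drv_eq (drvZ k (is_derive_id x (1 : R)))); rewrite mulr1. Qed.

Lemma drvV f x a : f x != 0 -> is_derive x 1 f a ->
  is_derive x 1 (fun y => (f y)^-1) (- a / f x ^+ 2).
Proof.
move=> fx0 fa; have h := is_deriveV fx0 fa.
by apply: (is_derive_eq h); rewrite /GRing.scale /=; ring.
Qed.

Lemma drv_comp f g x a b : is_derive (g x) 1 f a -> is_derive x 1 g b ->
  is_derive x 1 (fun y => f (g y)) (a * b).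
Proof. by move=> ? ?; exact: is_derive1_comp. Qed.

Lemma drv_opp f x a : is_derive (- x) 1 f a ->
  is_derive x 1 (fun y => f (- y)) (- a).
Proof.
move=> fa; rewrite -mulrN1.
exact: (@drv_comp f (fun y => - y) x _ _ fa (drvN (is_derive_id x 1))).
Qed.

Lemma drv_cont f x a : is_derive x 1 f a -> {for x, continuous f}.
Proof. by move=> fa; apply/differentiable_continuous/derivable1_diffP. Qed.

Lemma drv_ext f g x a : f =1 g -> is_derive x 1 f a -> is_derive x 1 g a.
Proof. by move=> /funext ->. Qed.

Lemma contD f g x : {for x, continuous f} -> {for x, continuous g} ->
  {for x, continuous (fun y => f y + g y)}.
Proof. by move=> ? ?; exact: continuousD. Qed.

Lemma contB f g x : {for x, continuous f} -> {for x, continuous g} ->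
  {for x, continuous (fun y => f y - g y)}.
Proof. by move=> ? ?; exact: continuousB. Qed.

Lemma contM f g x : {for x, continuous f} -> {for x, continuous g} ->
  {for x, continuous (fun y => f y * g y)}.
Proof. by move=> ? ?; exact: continuousM. Qed.

Lemma cont_norm f x : {for x, continuous f} -> {for x, continuous (fun y => `|f y|)}.
Proof.
move=> cf; apply: (@continuous_comp _ _ _ f (fun z : R => `|z|)) => //.
exact: norm_continuous.
Qed.

Lemma cont_cst a x : {for x, continuous (fun=> a)}.
Proof. exact: cst_continuous. Qed.

Lemma nondecreasing_of_drv F F' a b : a <= b ->
  (forall x, a <= x <= b -> {for x, continuous F}) ->
  (forall x, a < x < b -> is_derive x 1 F (F' x)) ->
  (forall x, a < x < b -> 0 <= F' x) -> F a <= F b.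
Proof.
move=> ab cF dF F0; apply: (@ger0_derive1_le_cc _ F a b) => //.
- by move=> x; rewrite in_itv /= => /dF [].
- move=> x; rewrite in_itv /= => xab; have [_ e] := dF _ xab.
  by rewrite derive1E e F0.
- apply: continuous_in_subspaceT => x; rewrite inE /= in_itv /=; exact: cF.
- by rewrite in_itv /= lexx.
- by rewrite in_itv /= lexx ab.
Qed.

Lemma nondecreasing_of_drv_except F F' a b p : a <= b ->
  (forall x, a <= x <= b -> {for x, continuous F}) ->
  (forall x, a <= x <= b -> x != p -> is_derive x 1 F (F' x)) ->
  (forall x, a <= x <= b -> x != p -> 0 <= F' x) -> F a <= F b.
Proof.
move=> ab cF dF F0.
have sub x y : a <= x -> y <= b -> x <= y -> ~~ (x < p < y) -> F x <= F y.
  move=> ax yb xy nxpy; apply: (@nondecreasing_of_drv F F') => //.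
  - by move=> z /andP[xz zy]; apply: cF; rewrite (le_trans ax) ?(le_trans zy).
  - move=> z /andP[xz zy]; apply: dF.
      by rewrite (le_trans ax) ?ltW// (lt_le_trans zy).
    by apply: contraNneq nxpy => <-; rewrite xz zy.
  - move=> z /andP[xz zy]; apply: F0.
      by rewrite (le_trans ax) ?ltW// (lt_le_trans zy).
    by apply: contraNneq nxpy => <-; rewrite xz zy.
have [/andP[ap pb]|] := boolP (a < p < b); last by apply: sub.
apply: (@le_trans _ _ (F p)).
  by apply: sub; rewrite ?(ltW ap) ?(ltW pb)// ltxx andbF.
by apply: sub; rewrite ?(ltW ap) ?(ltW pb)// ltxx.
Qed.

(** A primitive B of a bound for F' controls the increments of F without
    integrating F'. The exceptional point lets B be the primitive of a function
    with an integrable singularity, such as an inverse square root. *)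
Lemma increment_le_except F F' B B' a b p : a <= b ->
  (forall x, a <= x <= b -> is_derive x 1 F (F' x)) ->
  (forall x, a <= x <= b -> {for x, continuous B}) ->
  (forall x, a <= x <= b -> x != p -> is_derive x 1 B (B' x)) ->
  (forall x, a <= x <= b -> x != p -> `|F' x| <= B' x) ->
  `|F b - F a| <= B b - B a.
Proof.
move=> ab dF cB dB FB; rewrite ler_norml; apply/andP; split.
  suff : (B a + F a) <= (B b + F b) by lra.
  apply: (@nondecreasing_of_drv_except (fun x => B x + F x)
    (fun x => B' x + F' x) _ _ p) => // x xab.
  - by apply: continuousD; [exact: cB|exact: (drv_cont (dF _ xab))].
  - by move=> xp; apply: drvD; [exact: dB|exact: dF].
  - by move=> xp; have := FB _ xab xp; rewrite ler_norml; lra.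
suff : (B a - F a) <= (B b - F b) by lra.
apply: (@nondecreasing_of_drv_except (fun x => B x - F x)
  (fun x => B' x - F' x) _ _ p) => // x xab.
- by apply: continuousB; [exact: cB|exact: (drv_cont (dF _ xab))].
- by move=> xp; apply: drvB; [exact: dB|exact: dF].
- by move=> xp; have := FB _ xab xp; rewrite ler_norml; lra.
Qed.

Lemma increment_le F F' B B' a b : a <= b ->
  (forall x, a <= x <= b -> is_derive x 1 F (F' x)) ->
  (forall x, a <= x <= b -> is_derive x 1 B (B' x)) ->
  (forall x, a <= x <= b -> `|F' x| <= B' x) ->
  `|F b - F a| <= B b - B a.
Proof.
move=> ab dF dB FB.
apply: (@increment_le_except F F' B B' a b (a - 1)) => // x xab *.
- exact: (drv_cont (dB _ xab)).
- exact: dB.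
- exact: FB.
Qed.

Lemma constant_of_drv0 F : (forall x, is_derive x 1 F 0) -> forall x y, F x = F y.
Proof. by move=> dF x y; exact: is_derive_0_is_cst. Qed.

End RealCalculus.

(** * Complex-valued functions of a real variable *)

Section ComplexCalculus.
Context {R : realType}.
Implicit Types (F G : R -> R[i]) (z w : R[i]) (x y a b p : R).

Lemma ReD z w : complex.Re (z + w) = complex.Re z + complex.Re w.
Proof. by case: z w => [? ?] [? ?]. Qed.
Lemma ImD z w : complex.Im (z + w) = complex.Im z + complex.Im w.
Proof. by case: z w => [? ?] [? ?]. Qed.
Lemma ReN z : complex.Re (- z) = - complex.Re z.
Proof. by case: z. Qed.
Lemma ImN z : complex.Im (- z) = - complex.Im z.
Proof. by case: z. Qed.
Lemma ReB z w : complex.Re (z - w) = complex.Re z - complex.Re w.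
Proof. by rewrite ReD ReN. Qed.
Lemma ImB z w : complex.Im (z - w) = complex.Im z - complex.Im w.
Proof. by rewrite ImD ImN. Qed.
Lemma ReM z w : complex.Re (z * w) =
  complex.Re z * complex.Re w - complex.Im z * complex.Im w.
Proof. by case: z w => [? ?] [? ?]. Qed.
Lemma ImM z w : complex.Im (z * w) =
  complex.Re z * complex.Im w + complex.Im z * complex.Re w.
Proof. by case: z w => [? ?] [? ?]. Qed.
Lemma ReR (r : R) : complex.Re r%:C = r. Proof. by []. Qed.
Lemma ImR (r : R) : complex.Im r%:C = 0. Proof. by []. Qed.
Lemma ReV z : complex.Re z^-1 =
  complex.Re z / (complex.Re z ^+ 2 + complex.Im z ^+ 2).
Proof. by case: z. Qed.
Lemma ImV z : complex.Im z^-1 =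
  - complex.Im z / (complex.Re z ^+ 2 + complex.Im z ^+ 2).
Proof. by case: z => ? ? /=; rewrite mulNr. Qed.

Definition ReIm := (ReD, ImD, ReN, ImN, ReM, ImM, ReR, ImR).

Lemma eq_ReIm z w :
  complex.Re z = complex.Re w -> complex.Im z = complex.Im w -> z = w.
Proof. by case: z w => [? ?] [? ?] /= -> ->. Qed.

Lemma cnorm_ge0 z : 0 <= cnorm z.
Proof. by case: z => a b /=; exact: sqrtr_ge0. Qed.

Lemma cnorm_ge_Re z : `|complex.Re z| <= cnorm z.
Proof.
case: z => a b /=; rewrite -sqrtr_sqr ler_wsqrtr// lerDl sqr_ge0 //.
Qed.

Lemma cnorm_ge_Im z : `|complex.Im z| <= cnorm z.
Proof.
case: z => a b /=; rewrite -sqrtr_sqr ler_wsqrtr// lerDr sqr_ge0 //.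
Qed.

Lemma sqr_cnorm z : cnorm z ^+ 2 = complex.Re z ^+ 2 + complex.Im z ^+ 2.
Proof. by case: z => a b /=; rewrite sqr_sqrtr// addr_ge0 ?sqr_ge0. Qed.

Lemma cnorm_le_ReIm z : cnorm z <= `|complex.Re z| + `|complex.Im z|.
Proof.
rewrite -(@ler_pXn2r _ 2)// ?nnegrE ?addr_ge0 ?cnorm_ge0// sqr_cnorm.
rewrite -(real_normK (num_real (complex.Re z))).
rewrite -(real_normK (num_real (complex.Im z))).
have := normr_ge0 (complex.Re z); have := normr_ge0 (complex.Im z).
by nra.
Qed.

Lemma cnorm0 : cnorm (0 : R[i]) = 0. Proof. exact: ComplexField.Normc.normc0. Qed.
Lemma cnormM z w : cnorm (z * w) = cnorm z * cnorm w.
Proof. exact: ComplexField.Normc.normcM. Qed.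
Lemma cnormV z : cnorm z^-1 = (cnorm z)^-1.
Proof. exact: ComplexField.Normc.normcV. Qed.
Lemma cnormN z : cnorm (- z) = cnorm z.
Proof. exact: normcN. Qed.
Lemma cnormD z w : cnorm (z + w) <= cnorm z + cnorm w.
Proof. exact: le_normcD. Qed.
Lemma cnormB z w : cnorm (z - w) <= cnorm z + cnorm w.
Proof. by rewrite -(cnormN w) cnormD. Qed.
Lemma cnorm_distC z w : cnorm (z - w) = cnorm (w - z).
Proof. by rewrite -cnormN opprB. Qed.
Lemma cnormR (r : R) : cnorm r%:C = `|r|.
Proof. by rewrite /= expr0n /= addr0 sqrtr_sqr. Qed.
Lemma cnorm_eq0 z : cnorm z = 0 -> z = 0.
Proof. exact: ComplexField.Normc.eq0_normc. Qed.
Lemma cnorm_gt0 z : z != 0 -> 0 < cnorm z.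
Proof.
by move=> z0; rewrite lt_def cnorm_ge0 andbT; apply: contraNneq z0 => /cnorm_eq0 ->.
Qed.

Lemma normE z : `|z| = (cnorm z)%:C.
Proof. by []. Qed.

(** Differentiating the real and imaginary parts keeps every derivative
    real-valued, so that the mean value inequalities of the real line apply. *)
Definition has_cderiv F y z :=
  is_derive y 1 (fun x => complex.Re (F x)) (complex.Re z) /\
  is_derive y 1 (fun x => complex.Im (F x)) (complex.Im z).

Lemma cdrv_eq F y z w : has_cderiv F y z -> z = w -> has_cderiv F y w.
Proof. by move=> ? <-. Qed.

Lemma cdrv_ext F G y z : F =1 G -> has_cderiv F y z -> has_cderiv G y z.
Proof. by move=> /funext ->. Qed.

Lemma cdrv_cst y z : has_cderiv (fun=> z) y 0.
Proof. by split; exact: is_derive_cst. Qed.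

Lemma cdrvD F G y z w : has_cderiv F y z -> has_cderiv G y w ->
  has_cderiv (fun x => F x + G x) y (z + w).
Proof.
move=> [F1 F2] [G1 G2]; split.
  by rewrite ReD; apply: drv_ext (drvD F1 G1) => x; rewrite ReD.
by rewrite ImD; apply: drv_ext (drvD F2 G2) => x; rewrite ImD.
Qed.

Lemma cdrvN F y z : has_cderiv F y z -> has_cderiv (fun x => - F x) y (- z).
Proof.
move=> [F1 F2]; split.
  by rewrite ReN; apply: drv_ext (drvN F1) => x; rewrite ReN.
by rewrite ImN; apply: drv_ext (drvN F2) => x; rewrite ImN.
Qed.

Lemma cdrvB F G y z w : has_cderiv F y z -> has_cderiv G y w ->
  has_cderiv (fun x => F x - G x) y (z - w).
Proof. by move=> ? ?; apply: cdrvD => //; exact: cdrvN. Qed.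

Lemma cdrvM F G y z w : has_cderiv F y z -> has_cderiv G y w ->
  has_cderiv (fun x => F x * G x) y (z * G y + F y * w).
Proof.
move=> [F1 F2] [G1 G2]; split.
  apply: drv_eq; first apply: drv_ext (drvB (drvM F1 G1) (drvM F2 G2)).
    by move=> x; rewrite ReM.
  by rewrite !ReIm; ring.
apply: drv_eq; first apply: drv_ext (drvD (drvM F1 G2) (drvM F2 G1)).
  by move=> x; rewrite ImM.
by rewrite !ReIm; ring.
Qed.

Lemma cdrvR (f : R -> R) y a : is_derive y 1 f a ->
  has_cderiv (fun x => (f x)%:C) y a%:C.
Proof. by move=> fa; split => //=; exact: is_derive_cst. Qed.

Lemma cdrv_opp F y z : has_cderiv F (- y) z ->
  has_cderiv (fun x => F (- x)) y (- z).
Proof.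
by move=> [F1 F2]; split; rewrite ?ReN ?ImN;
  [exact: (drv_opp F1)|exact: (drv_opp F2)].
Qed.

(** The factor 2 is the price of treating the real and imaginary parts
    separately. *)
Lemma cincrement_le_except F F' (B B' : R -> R) a b p : a <= b ->
  (forall x, a <= x <= b -> has_cderiv F x (F' x)) ->
  (forall x, a <= x <= b -> {for x, continuous B}) ->
  (forall x, a <= x <= b -> x != p -> is_derive x 1 B (B' x)) ->
  (forall x, a <= x <= b -> x != p -> cnorm (F' x) <= B' x) ->
  cnorm (F b - F a) <= 2 * (B b - B a).
Proof.
move=> ab dF cB dB FB.
have H1 := @increment_le_except _ (fun x => complex.Re (F x))
  (fun x => complex.Re (F' x)) B B' a b p ab
  (fun x xab => proj1 (dF x xab)) cB dB
  (fun x xab xp => le_trans (cnorm_ge_Re _) (FB x xab xp)).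
have H2 := @increment_le_except _ (fun x => complex.Im (F x))
  (fun x => complex.Im (F' x)) B B' a b p ab
  (fun x xab => proj2 (dF x xab)) cB dB
  (fun x xab xp => le_trans (cnorm_ge_Im _) (FB x xab xp)).
by apply: le_trans (cnorm_le_ReIm _) _; rewrite !ReIm; lra.
Qed.

Lemma cincrement_le F F' (B B' : R -> R) a b : a <= b ->
  (forall x, a <= x <= b -> has_cderiv F x (F' x)) ->
  (forall x, a <= x <= b -> is_derive x 1 B (B' x)) ->
  (forall x, a <= x <= b -> cnorm (F' x) <= B' x) ->
  cnorm (F b - F a) <= 2 * (B b - B a).
Proof.
move=> ab dF dB FB.
apply: (@cincrement_le_except F F' B B' a b (a - 1)) => // x xab *.
- exact: (drv_cont (dB _ xab)).
- exact: dB.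
- exact: FB.
Qed.

End ComplexCalculus.

(** * Hyperbolic functions *)

Section Hyperbolic.
Context {R : realType}.
Implicit Types (x y a : R).

Lemma cosh_gt0 y : 0 < cosh y.
Proof. by rewrite divr_gt0// addr_gt0 ?expR_gt0. Qed.
Lemma sech_gt0 y : 0 < sech y.
Proof. by rewrite invr_gt0 cosh_gt0. Qed.
Lemma cosh_neq0 y : cosh y != 0. Proof. exact: lt0r_neq0 (cosh_gt0 y). Qed.
Lemma cosh_sech y : cosh y * sech y = 1.
Proof. by rewrite mulfV// cosh_neq0. Qed.
Lemma expRNK y : expR y * expR (- y) = 1 :> R.
Proof. by rewrite -expRD subrr expR0. Qed.
Lemma cosh2Bsinh2 y : cosh y ^+ 2 - sinh y ^+ 2 = 1.
Proof. by rewrite /cosh /sinh; have := expRNK y; nra. Qed.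
Lemma sech2E y : sech y ^+ 2 = 1 - tanh y ^+ 2.
Proof.
rewrite /tanh /sech; apply: (mulIf (expf_neq0 2 (cosh_neq0 y))).
rewrite -exprMn mulVf ?cosh_neq0// expr1n mulrBl mul1r -exprMn.
by rewrite divfK ?cosh_neq0// cosh2Bsinh2.
Qed.
Lemma coshN y : cosh (- y) = cosh y.
Proof. by rewrite /cosh opprK addrC. Qed.
Lemma sinhN y : sinh (- y) = - sinh y.
Proof. by rewrite /sinh opprK -mulNr opprB. Qed.
Lemma sechN y : sech (- y) = sech y. Proof. by rewrite /sech coshN. Qed.
Lemma tanhN y : tanh (- y) = - tanh y.
Proof. by rewrite /tanh coshN sinhN mulNr. Qed.
Lemma sinh0 : sinh (0 : R) = 0. Proof. by rewrite /sinh oppr0 subrr mul0r. Qed.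
Lemma cosh0 : cosh (0 : R) = 1.
Proof. by rewrite /cosh oppr0 expR0 -mulr2n divff// pnatr_eq0. Qed.
Lemma tanh0 : tanh (0 : R) = 0. Proof. by rewrite /tanh sinh0 mul0r. Qed.
Lemma sech0 : sech (0 : R) = 1. Proof. by rewrite /sech cosh0 invr1. Qed.
Lemma sinhE y : sinh y = tanh y * cosh y.
Proof. by rewrite divfK// cosh_neq0. Qed.
Lemma cosh_ge1 y : 1 <= cosh y.
Proof.
have := cosh2Bsinh2 y; have := sqr_ge0 (sinh y); have := cosh_gt0 y.
by nra.
Qed.
Lemma sech_le1 y : sech y <= 1.
Proof. by rewrite invf_le1 ?cosh_gt0// cosh_ge1. Qed.

Lemma tanh_lt1 y : `|tanh y| < 1.
Proof.
rewrite -(@ltr_pXn2r _ 2)// ?nnegrE// expr1n real_normK ?num_real//.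
by have := sech2E y; have := exprn_gt0 2 (sech_gt0 y); lra.
Qed.

Lemma drv_expRN y : is_derive y 1 (fun x : R => expR (- x)) (- expR (- y)).
Proof. by apply: drv_opp; exact: is_derive_expR. Qed.

Lemma drv_sinh y : is_derive y 1 (@sinh R) (cosh y).
Proof.
have h := drvM (drvB (is_derive_expR y) (drv_expRN y))
  (is_derive_cst (2^-1 : R) y (1 : R)).
apply: (drv_eq h).
by rewrite /cosh /=; ring.
Qed.

Lemma drv_cosh y : is_derive y 1 (@cosh R) (sinh y).
Proof.
have h := drvM (drvD (is_derive_expR y) (drv_expRN y))
  (is_derive_cst (2^-1 : R) y (1 : R)).
apply: (drv_eq h).
by rewrite /sinh /=; ring.
Qed.

Lemma drv_sech y : is_derive y 1 (@sech R) (- tanh y * sech y).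
Proof.
apply: (drv_eq (drvV (cosh_neq0 y) (drv_cosh y))).
by rewrite /tanh /sech; field; exact: cosh_neq0.
Qed.

Lemma drv_tanh y : is_derive y 1 (@tanh R) (sech y ^+ 2).
Proof.
apply: (drv_eq (drvM (drv_sinh y) (drvV (cosh_neq0 y) (drv_cosh y)))).
rewrite sech2E /tanh; field; exact: cosh_neq0.
Qed.

Lemma derive1_tanh : derive1 (@tanh R) = fun y => sech y ^+ 2.
Proof. by apply/funext => y; rewrite derive1E; case: (drv_tanh y). Qed.

Lemma drv_sech2 y :
  is_derive y 1 (fun x : R => sech x ^+ 2) (- 2 * tanh y * sech y ^+ 2).
Proof.
apply: (drv_eq (drvM (drv_sech y) (drv_sech y))).
by ring.
Qed.

Lemma derive2_tanh y : derive1n 2 (@tanh R) y = - 2 * tanh y * sech y ^+ 2.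
Proof.
by rewrite derive1nS /derive1n /= derive1_tanh derive1E; case: (drv_sech2 y).
Qed.

Lemma sech_le_expN y : sech y <= 2 * expR (- `|y|).
Proof.
have h (x : R) : 0 <= x -> sech x <= 2 * expR (- x).
  move=> x0; rewrite /sech /cosh invf_div ler_pdivrMr ?addr_gt0 ?expR_gt0//.
  by have := expRNK x; have := expR_gt0 (- x); nra.
have [y0|y0] := leP 0 y; first by rewrite ger0_norm// h.
by rewrite ltr0_norm// opprK -[leLHS]sechN -{2}(opprK y) h// oppr_ge0 ltW.
Qed.

Lemma cosh_le_exp y : cosh y <= expR `|y|.
Proof.
have h (x : R) : 0 <= x -> cosh x <= expR x.
  move=> x0; rewrite /cosh ler_pdivrMr//.
  suff : expR (- x) <= expR x by lra.
  by rewrite ler_expR; lra.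
have [y0|y0] := leP 0 y; first by rewrite ger0_norm// h.
by rewrite ltr0_norm// -coshN h// oppr_ge0 ltW.
Qed.

Lemma tanh_incr : {homo (@tanh R) : x y / x <= y}.
Proof.
move=> x y xy.
apply: (nondecreasing_of_drv xy _ (fun x _ => drv_tanh x)) => z _.
  exact: (drv_cont (drv_tanh z)).
by rewrite sqr_ge0.
Qed.

Lemma tanh_gt0 y : 0 < y -> 0 < tanh y.
Proof.
move=> y0; rewrite divr_gt0 ?cosh_gt0// divr_gt0// subr_gt0 ltr_expR; lra.
Qed.

Lemma tanh_neq0 y : y != 0 -> tanh y != 0.
Proof.
have [/tanh_gt0/lt0r_neq0//|y0 _|//] := ltgtP 0 y.
by rewrite -[y]opprK tanhN oppr_eq0 lt0r_neq0// tanh_gt0// oppr_gt0.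
Qed.

Lemma tanh1_ge : 3 / 5 <= tanh (1 : R).
Proof.
rewrite /tanh /sinh /cosh.
rewrite ler_pdivlMr ?divr_gt0 ?addr_gt0 ?expR_gt0//.
have := expRNK 1; have := expR_ge1Dx (1 : R); have := expR_gt0 (- 1 : R).
by nra.
Qed.

Lemma tanh_surj a : `|a| <= 3 / 5 -> exists2 y, `|y| <= 1 & tanh y = a.
Proof.
move=> a35; have := tanh1_ge; have := tanhN 1 => tN t1.
have [|||y] := @IVT _ (@tanh R) (-1) 1 a.
- lra.
- by apply: derivable_within_continuous => x _; case: (drv_tanh x).
- move: a35; rewrite tN ler_norml => /andP[? ?].
  by rewrite min_l ?max_r; lra.
by rewrite in_itv /= => yI ya; exists y => //; rewrite ler_norml.
Qed.

Lemma tanh_inj : injective (@tanh R).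
Proof.
move=> x y; wlog xy : x y / x <= y => [h|].
  by case: (leP x y) => [|/ltW] /h h1 //= /esym/h1.
rewrite le_eqVlt in xy; case/orP: xy => [/eqP//|xy] e.
have := @MVT _ tanh (fun x => sech x ^+ 2) x y xy (fun z _ => drv_tanh z).
case.
  by apply: derivable_within_continuous => z _; case: (drv_tanh z).
move=> z _; rewrite e subrr => /esym/eqP; rewrite mulf_eq0 subr_eq0.
by rewrite expf_eq0 /= !gt_eqF// sech_gt0.
Qed.

Lemma crit0 : crit (0 : R) = 0.
Proof.
rewrite /crit; apply: tanh_inj; rewrite tanh0.
by have : [set y : R | tanh y = 0] (get [set y | tanh y = 0]) by apply: (getI (x := 0)); rewrite /= tanh0.
Qed.

End Hyperbolic.

(** * Integrals over segments *)

Section Integrals.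
Context {R : realType}.
Notation mu := (@lebesgue_measure R).
Implicit Types (f g h p F : R -> R) (a b c x y : R).

Definition segment_integrable g := forall a b, mu.-integrable `[a, b] (EFin \o g).

Lemma continuous_integrable h a b :
  continuous h -> mu.-integrable `[a, b] (EFin \o h).
Proof.
move=> ch; apply: continuous_compact_integrable; first exact: segment_compact.
exact: continuous_subspaceT.
Qed.

Lemma continuous_segment_integrable h : continuous h -> segment_integrable h.
Proof. by move=> ch a b; exact: continuous_integrable. Qed.

Lemma Rintegral_point g a : \int[mu]_(x in `[a, a]) g x = 0.
Proof. by rewrite set_itv1 Rintegral_set1. Qed.

Lemma Rintegral_cat g a b c : segment_integrable g -> a <= b -> b <= c ->
  \int[mu]_(x in `[a, c]) g x =
  \int[mu]_(x in `[a, b]) g x + \int[mu]_(x in `[b, c]) g x.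
Proof.
move=> ig ab bc.
have := @Rintegral_itvB _ g (BLeft a) (BRight c) b (ig a c).
rewrite !bnd_simp => /(_ ab bc).
rewrite Rintegral_itv_obnd_cbnd; first by move=> <-; rewrite addrC subrK.
apply: integrableS (ig b c) => //; exact: subset_itv_oc_cc.
Qed.

Lemma Rintegral_FTC F f a b : continuous f ->
  (forall x, is_derive x 1 F (f x)) -> a <= b ->
  \int[mu]_(x in `[a, b]) f x = F b - F a.
Proof.
move=> cf dF; rewrite le_eqVlt => /predU1P[->|ab].
  by rewrite Rintegral_point subrr.
rewrite /Rintegral (@continuous_FTC2 _ f F a b ab)//.
- exact: continuous_subspaceT.
- have cF x : {for x, continuous F} by exact: (drv_cont (dF x)).
  split; [by move=> x _; case: (dF x)| |].
  + exact: cvg_at_right_filter (cF a).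
  + exact: cvg_at_left_filter (cF b).
- by move=> x _; rewrite derive1E; case: (dF x).
Qed.

Lemma oriented_integral_cat g a b c : segment_integrable g ->
  oriented_integral a c g = oriented_integral a b g + oriented_integral b c g.
Proof.
move=> ig; rewrite /oriented_integral.
case: (leP a b) => ab; case: (leP b c) => bc; case: (leP a c) => ac.
- exact: Rintegral_cat.
- lra.
- rewrite (Rintegral_cat ig ac (ltW bc)); lra.
- rewrite (Rintegral_cat ig (ltW ac) ab); lra.
- rewrite (Rintegral_cat ig (ltW ab) ac); lra.
- rewrite (Rintegral_cat ig bc (ltW ac)); lra.
- lra.
- rewrite (Rintegral_cat ig (ltW bc) (ltW ab)); lra.
Qed.

Lemma oriented_integral_point g a : oriented_integral a a g = 0.
Proof. by rewrite /oriented_integral lexx Rintegral_point. Qed.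

Lemma drv_oriented_integral h a y : continuous h ->
  is_derive y 1 (fun z => oriented_integral a z h) (h y).
Proof.
move=> ch; have ih := continuous_segment_integrable ch.
pose M := y - 1.
have [d e] : derivable (fun z => \int[mu]_(t in `[M, z]) h t) y 1 /\
    derive1 (fun z => \int[mu]_(t in `[M, z]) h t) y = h y.
  apply: (@continuous_FTC1_closed _ h M y (y + 1)) => //.
  - by rewrite ltrDl.
  - by rewrite /M; lra.
  - exact: ch.
apply: (@near_eq_is_derive _ _ _ (fun z => oriented_integral a M h +
    \int[mu]_(t in `[M, z]) h t)).
  have My : M < y by rewrite /M; lra.
  apply: filterS (lt_nbhsr My) => z /ltW Mz.
  by rewrite (oriented_integral_cat a M z ih) /oriented_integral Mz.
have hd : is_derive y 1 (fun z => \int[mu]_(t in `[M, z]) h t) (h y).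
  by apply: (DeriveDef d); rewrite -derive1E.
have := drvD (is_derive_cst (oriented_integral a M h) y (1 : R)) hd.
by rewrite add0r.
Qed.

Definition sq_integrable g :=
  measurable_fun [set: R] g /\ (\int[mu]_x ((g x) ^+ 2)%:E < +oo)%E.

Lemma sq_integrable_sq g : sq_integrable g ->
  mu.-integrable [set: R] (EFin \o (fun x => g x ^+ 2)).
Proof.
move=> [mg ig]; apply/integrableP; split.
  by apply/measurable_EFinP; exact: measurable_funX.
under eq_integral do rewrite /= ger0_norm ?sqr_ge0//.
exact: ig.
Qed.

Lemma sq_integrable_segment g : sq_integrable g -> segment_integrable g.
Proof.
move=> sg a b; have ig := sq_integrable_sq sg; have [mg _] := sg.
apply: (@le_integrable _ _ _ mu `[a, b] _ (EFin \o g)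
  (fun x => (1 + g x ^+ 2)%:E)) => //.
- by apply/measurable_EFinP; exact: measurable_funTS.
- move=> x _; rewrite /= lee_fin (ger0_norm (addr_ge0 _ (sqr_ge0 _)))//.
  rewrite -(real_normK (num_real (g x))).
  by have := normr_ge0 (g x); have := sqr_ge0 (`|g x| - 1); nra.
- apply: (@integrableD _ _ _ mu `[a, b] _ (cst 1%:E) (fun x => (g x ^+ 2)%:E)) => //.
    by apply: (@continuous_integrable (cst 1)) => x; exact: cst_continuous.
  by apply: integrableS ig.
Qed.

(** The Cauchy-Schwarz inequality on [a, b], in the form of Young's inequality
    with the weight t = sqrt (b - a); it makes the primitive of a square-integrable
    function Hoelder continuous of exponent 1/2. *)
Lemma sq_integrable_increment g : sq_integrable g ->
  exists2 K, 0 <= K & forall a b, a <= b ->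
  `|\int[mu]_(x in `[a, b]) g x| <= K * Num.sqrt (b - a).
Proof.
move=> sg; have ig2 := sq_integrable_sq sg; have ig := sq_integrable_segment sg.
pose G := \int[mu]_x (g x ^+ 2).
have G0 : 0 <= G by apply: Rintegral_ge0 => x _; exact: sqr_ge0.
exists ((G + 1) / 2); first by lra.
move=> a b; rewrite le_eqVlt => /predU1P[->|ab].
  by rewrite Rintegral_point normr0 subrr sqrtr0 mulr0.
set t := Num.sqrt (b - a); have t0 : 0 < t by rewrite sqrtr_gt0 subr_gt0.
have t2 : t ^+ 2 = b - a by rewrite sqr_sqrtr// subr_ge0 ltW.
have ig2ab : mu.-integrable `[a, b] (EFin \o (fun x => g x ^+ 2)).
  by apply: integrableS ig2.
have icst (k : R) : mu.-integrable `[a, b] (EFin \o (cst k)).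
  by apply: continuous_integrable => x; exact: cst_continuous.
apply: le_trans (le_normr_Rintegral _ (ig a b)) _ => //.
have isum : mu.-integrable `[a, b]
    (EFin \o (fun x => t / 2 * g x ^+ 2 + (2 * t)^-1)).
  apply: (@integrableD _ _ _ mu `[a, b] _ (fun x => (t / 2 * g x ^+ 2)%:E)
    (cst (2 * t)^-1%:E)) => //.
    exact: (integrableZl _ (t/2) ig2ab).
  exact: (icst (2 * t)^-1).
apply: (@le_trans _ _ (\int[mu]_(x in `[a, b]) (t / 2 * g x ^+ 2 + (2 * t)^-1))).
  apply: le_Rintegral => //.
    exact: (integrable_norm (ig a b)).
  move=> x _; rewrite -(real_normK (num_real (g x))).
  have := sqr_ge0 (t * `|g x| - 1); have : t * t^-1 = 1 by rewrite mulfV// gt_eqF.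
  rewrite invfM; have : 0 < t^-1 by rewrite invr_gt0.
  move: (t^-1) => s s0 ts.
  set n := `|g x| => h.
  suff : 0 <= (t * n - 1) ^+ 2 * s.
    have -> : (t * n - 1) ^+ 2 * s = (t * s) * (t * n ^+ 2) - 2 * n * (t * s) + s by ring.
    by rewrite ts; lra.
  by rewrite mulr_ge0// ltW.
rewrite RintegralD//; last 2 first.
- exact: (integrableZl _ (t/2) ig2ab).
- exact: (icst (2 * t)^-1).
rewrite RintegralZl// Rintegral_cst//.
have -> : fine (mu `[a, b]) = t ^+ 2.
  by rewrite lebesgue_measure_itv /= lte_fin ab t2.
have -> : (2 * t)^-1 * t ^+ 2 = t / 2 by field; rewrite gt_eqF.
suff : \int[mu]_(x in `[a, b]) (g x ^+ 2) <= G by nra.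
apply: fine_le.
- exact: integrable_fin_num ig2ab.
- exact: integrable_fin_num ig2.
- apply: ge0_subset_integral => //.
    by have /integrableP[] := ig2.
  by move=> x _; rewrite lee_fin sqr_ge0.
Qed.

End Integrals.

(** * Smooth approximations of steps *)

Section Splines.
Context {R : realType}.
Notation mu := (@lebesgue_measure R).
Implicit Types (f g p : R -> R) (a b h x y : R) (n : nat).

Definition truncated_power n x : R := Num.max 0 x ^+ n.

Lemma continuous_truncated_power n : continuous (truncated_power n).
Proof.
move=> x.
apply: (@continuous_comp R R R (fun z : R => Num.max 0 z) (fun z : R => z ^+ n) x).
  by apply: continuous_max; [exact: cst_continuous|exact: cvg_id].
exact: exprn_continuous.
Qed.

Lemma drv_truncated_power n x :
  is_derive x 1 (truncated_power n.+2) (n.+2%:R * truncated_power n.+1 x).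
Proof.
have [x0|x0|x0] := ltgtP x 0.
- rewrite {2}/truncated_power max_l ?ltW// expr0n /= mulr0.
  apply: (@near_eq_is_derive _ _ _ (cst 0)).
  apply: filterS (lt_nbhsl x0) => z z0.
  by rewrite /truncated_power max_l ?ltW// expr0n.
- rewrite {2}/truncated_power max_r ?ltW//.
  have d : is_derive x 1 (fun z : R => z ^+ n.+2) (n.+2%:R * x ^+ n.+1).
    by split; [exact: exprn_derivable|rewrite exp_derive scaler1].
  apply: near_eq_is_derive d.
  apply: filterS (lt_nbhsr x0) => z z0.
  by rewrite /truncated_power max_r ?ltW.
- rewrite x0 {2}/truncated_power maxxx expr0n /= mulr0.
  apply/is_derive1_caratheodory.
  exists (truncated_power n.+1); split.
  + move=> z; rewrite subr0 {2}/truncated_power maxxx expr0n /= subr0.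
    rewrite /truncated_power [LHS]exprS mulrC.
    by case: (leP 0 z) => z0 //; rewrite !expr0n /= !mul0r.
  + exact: continuous_truncated_power.
  + by rewrite /truncated_power maxxx expr0n.
Qed.

Lemma drv_truncated_power_shift n a x :
  is_derive x 1 (fun z => truncated_power n.+2 (z - a))
    (n.+2%:R * truncated_power n.+1 (x - a)).
Proof.
rewrite -[X in is_derive _ _ _ X]mulr1.
apply: (@drv_comp _ _ (fun z => z - a)); first exact: drv_truncated_power.
have := drvB (is_derive_id x (1 : R)) (is_derive_cst a x (1 : R)).
by rewrite subr0.
Qed.

Lemma continuous_truncated_power_shift n a :
  continuous (fun z => truncated_power n (z - a)).
Proof.
move=> x.
apply: (@continuous_comp R R R (fun z => z - a) (truncated_power n) x); last first.
  exact: continuous_truncated_power.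
by apply: continuousB; [exact: cvg_id|exact: cst_continuous].
Qed.

(** Second difference with step h/2 at a; applied to truncated powers of
    degree 1, 2, 3 and normalised it gives a hat function on [a, a + h], its
    primitive (a C^1 step from 0 to 1) and the primitive of that step. *)
Definition spline n a h x :=
  truncated_power n (x - a) - 2 * truncated_power n (x - (a + h / 2)) +
  truncated_power n (x - (a + h)).

Definition hat a h x := 4 / h ^+ 2 * spline 1 a h x.
Definition step a h x := 2 / h ^+ 2 * spline 2 a h x.
Definition istep a h x := 2 / (3 * h ^+ 2) * spline 3 a h x.

Lemma drv_spline n a h x :
  is_derive x 1 (spline n.+2 a h) (n.+2%:R * spline n.+1 a h x).
Proof.
apply: (drv_eq (drvD (drvB (drv_truncated_power_shift n a x)
  (drvZ 2 (drv_truncated_power_shift n (a + h / 2) x)))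
  (drv_truncated_power_shift n (a + h) x))).
by rewrite /spline; ring.
Qed.

Lemma continuous_spline n a h : continuous (spline n a h).
Proof.
have c := @continuous_truncated_power_shift n.
by move=> x; apply: (contD (contB (c a x) (contM (@cont_cst _ 2 x)
  (c (a + h / 2) x))) (c (a + h) x)).
Qed.

Lemma drv_step a h x : is_derive x 1 (step a h) (hat a h x).
Proof.
apply: (drv_eq (drvZ (2 / h ^+ 2) (drv_spline 0 a h x))).
by rewrite /hat; ring.
Qed.

Lemma drv_istep a h x : is_derive x 1 (istep a h) (step a h x).
Proof.
apply: (drv_eq (drvZ (2 / (3 * h ^+ 2)) (drv_spline 1 a h x))).
rewrite /step mulrA; congr (_ * _).
have [->|h0] := eqVneq h 0; first by rewrite expr0n /= mulr0 invr0 !mulr0 mul0r.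
by field.
Qed.

Lemma continuous_hat a h : continuous (hat a h).
Proof.
by move=> x; exact: (contM (@cont_cst _ _ x) (@continuous_spline 1 a h x)).
Qed.

Lemma continuous_step a h : continuous (step a h).
Proof. by move=> x; exact: (drv_cont (drv_step a h x)). Qed.

Lemma spline_left n a h x : 0 < h -> x <= a -> spline n.+1 a h x = 0.
Proof.
by move=> h0 xa; rewrite /spline /truncated_power !max_l ?expr0n /=; lra.
Qed.

Lemma hat_left a h x : 0 < h -> x <= a -> hat a h x = 0.
Proof. by move=> h0 xa; rewrite /hat spline_left// mulr0. Qed.
Lemma step_left a h x : 0 < h -> x <= a -> step a h x = 0.
Proof. by move=> h0 xa; rewrite /step spline_left// mulr0. Qed.
Lemma istep_left a h x : 0 < h -> x <= a -> istep a h x = 0.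
Proof. by move=> h0 xa; rewrite /istep spline_left// mulr0. Qed.

Lemma spline_right n a h x : 0 < h -> a + h <= x -> spline n a h x =
  (x - a) ^+ n - 2 * (x - (a + h / 2)) ^+ n + (x - (a + h)) ^+ n.
Proof. by move=> h0 xa; rewrite /spline /truncated_power !max_r//; lra. Qed.

Lemma hat_right a h x : 0 < h -> a + h <= x -> hat a h x = 0.
Proof. by move=> h0 xa; rewrite /hat spline_right//; field; rewrite gt_eqF. Qed.
Lemma step_right a h x : 0 < h -> a + h <= x -> step a h x = 1.
Proof.
by move=> h0 xa; rewrite /step spline_right//; field; rewrite gt_eqF.
Qed.
Lemma istep_right a h x : 0 < h -> a + h <= x -> istep a h x = x - a - h / 2.
Proof.
by move=> h0 xa; rewrite /istep spline_right//; field; rewrite gt_eqF.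
Qed.

Lemma hat_ge0 a h x : 0 < h -> 0 <= hat a h x.
Proof.
move=> h0; rewrite /hat mulr_ge0 ?divr_ge0 ?sqr_ge0//.
rewrite /spline /truncated_power !expr1.
by case: (leP 0 (x - a)); case: (leP 0 (x - (a + h / 2)));
  case: (leP 0 (x - (a + h))); lra.
Qed.

Lemma step_bound a h x : 0 < h -> `|step a h x| <= 1.
Proof.
move=> h0.
have mono y z : y <= z -> step a h y <= step a h z.
  move=> yz; apply: (nondecreasing_of_drv yz _ (fun t _ => drv_step a h t)) => t _.
    exact: continuous_step.
  exact: hat_ge0.
have := mono (Num.min x a) x; rewrite ge_min lexx => /(_ isT).
rewrite step_left ?ge_min ?lexx ?orbT// => s0.
have := mono x (Num.max x (a + h)); rewrite le_max lexx => /(_ isT).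
rewrite (@step_right a h (Num.max x (a + h))) ?le_max ?lexx ?orbT// => s1.
by rewrite ger0_norm.
Qed.

End Splines.

(** * Weak derivatives *)

Section WeakDerivatives.
Context {R : realType}.
Notation mu := (@lebesgue_measure R).
Implicit Types (f g p k psi D : R -> R) (a b h x y A B : R) (n : nat).

Lemma Rintegral_support k A B :
  (forall x, ~~ (A <= x <= B) -> k x = 0) ->
  \int[mu]_x k x = \int[mu]_(x in `[A, B]) k x.
Proof.
move=> k0; rewrite [RHS]Rintegral_mkcond; apply: eq_Rintegral => x _.
rewrite patchE; case: ifPn => //.
by rewrite notin_setE /= in_itv /= => /negP/k0.
Qed.

(** The hat function is nonnegative of mass one, and supported in [a, a + h]. *)
Lemma hat_mean p a A B e : continuous p -> A <= a -> a < B -> 0 < e ->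
  \forall h \near 0^'+, `|\int[mu]_(x in `[A, B]) (p x * hat a h x) - p a| <= e.
Proof.
move=> cp Aa aB e0.
have /cvgrPdist_le /(_ e e0) [d /= d0 dP] := cp a.
near=> h.
have h0 : 0 < h by near: h; exact: nbhs_right_gt.
have hd : h < d by near: h; exact: nbhs_right_lt.
have hB : a + h <= B.
  by rewrite -lerBrDl; near: h; apply: nbhs_right_le; rewrite subr_gt0.
have AB : A <= B by rewrite (le_trans Aa)// ltW.
have chat := @continuous_hat _ a h.
have cph : continuous (fun x => p x * hat a h x).
  by move=> x; exact: contM (cp x) (chat x).
have ih : mu.-integrable `[A, B] (EFin \o hat a h) by exact: continuous_integrable.
have one : \int[mu]_(x in `[A, B]) (hat a h x) = 1.
  rewrite (Rintegral_FTC chat (fun x => drv_step a h x) AB).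
  by rewrite step_right// step_left// subr0.
have cst_int (c : R) : \int[mu]_(x in `[A, B]) (c * hat a h x) = c.
  by rewrite RintegralZl// one mulr1.
have ci (c : R) : mu.-integrable `[A, B] (EFin \o (fun x => c * hat a h x)).
  by apply: continuous_integrable => x; exact: contM (@cont_cst _ c x) (chat x).
have pi : mu.-integrable `[A, B] (EFin \o (fun x => p x * hat a h x)).
  exact: continuous_integrable.
have key x : `|p x * hat a h x - p a * hat a h x| <= e * hat a h x.
  rewrite -mulrBl normrM (ger0_norm (hat_ge0 _ _ h0)).
  have [xa|ax] := leP x a; first by rewrite hat_left// !mulr0.
  have [xh|hx] := leP (a + h) x; first by rewrite hat_right// !mulr0.
  rewrite ler_wpM2r ?hat_ge0// distrC; apply: dP => /=.
  by rewrite ltr0_norm; lra.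
rewrite ler_norml; apply/andP; split.
  suff : (p a - e) <= \int[mu]_(x in `[A, B]) (p x * hat a h x) by lra.
  rewrite -[leLHS]cst_int; apply: le_Rintegral => // x _.
  by have := key x; rewrite ler_norml; lra.
suff : \int[mu]_(x in `[A, B]) (p x * hat a h x) <= p a + e by lra.
rewrite -[leRHS]cst_int; apply: le_Rintegral => // x _.
by have := key x; rewrite ler_norml; lra.
Unshelve. all: by end_near. Qed.

Let hs n : R := n.+1%:R^-1.

Lemma hs_gt0 n : 0 < hs n. Proof. by rewrite invr_gt0 ltr0n. Qed.
Lemma hs_le1 n : hs n <= 1. Proof. by rewrite invf_le1 ?ltr0n// ler1n. Qed.
Lemma hs_cvg0 : hs n @[n --> \oo] --> (0 : R)^'+.
Proof.
move=> A [e /= e0 eA].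
have /cvgrPdist_lt/(_ e e0) := @cvg_harmonic R.
apply: filterS => n /= H; apply: eA => /=; last exact: hs_gt0.
exact: H.
Qed.

Lemma hat_mean_cvg p a A B : continuous p -> A <= a -> a < B ->
  \int[mu]_(x in `[A, B]) (p x * hat a (hs n) x) @[n --> \oo] --> p a.
Proof.
move=> cp Aa aB; apply/cvgrPdist_le => e e0.
have H : \forall n \near \oo,
    `|\int[mu]_(x in `[A, B]) (p x * hat a (hs n) x) - p a| <= e.
  exact: hs_cvg0 (hat_mean cp Aa aB e0).
by apply: filterS H => n; rewrite distrC.
Qed.

(** The difference of two steps is bounded by 2 and tends pointwise to the
    indicator function of ]a, b]. *)
Lemma step_integral_cvg g a b : segment_integrable g -> a < b ->
  \int[mu]_x (g x * (step a (hs n) x - step b (hs n) x)) @[n --> \oo] -->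
  \int[mu]_(x in `[a, b]) g x.
Proof.
move=> ig ab.
pose k n x := g x * (step a (hs n) x - step b (hs n) x).
have kE n : \int[mu]_x k n x = \int[mu]_(x in `[a, b + 1]) k n x.
  apply: Rintegral_support => x; rewrite negb_and -!ltNge => /orP[xa|bx].
    by rewrite /k !step_left ?hs_gt0//; lra.
  by rewrite /k !step_right ?hs_gt0//; have := hs_le1 n; lra.
rewrite (_ : (fun n => _) = (fun n => \int[mu]_(x in `[a, b + 1]) k n x)); last first.
  by apply/funext => n; rewrite -kE.
have mg : measurable_fun `[a, b + 1] g.
  by have /measurable_int/measurable_EFinP := ig a (b + 1).
have mk n : measurable_fun `[a, b + 1] (EFin \o k n).
  apply/measurable_EFinP; apply: measurable_funM => //.
  apply: measurable_funTS; apply: continuous_measurable_fun => x.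
  exact: contB (@continuous_step _ _ _ x) (@continuous_step _ _ _ x).
pose l := (EFin \o g) \_ `]a, b].
have lE : (\int[mu]_(x in `[a, (b + 1)%R]) l x = \int[mu]_(x in `[a, b]) (g x)%:E)%E.
  rewrite -integral_mkcondr.
  rewrite (_ : _ `&` _ = `]a, b]%classic); last first.
    apply/seteqP; split => x /=; rewrite !in_itv /= ?andbT; first by case.
    by move=> /andP[ax xb]; rewrite ax xb (ltW ax) /=; split => //; lra.
  rewrite integral_itv_obnd_cbnd//.
  by apply/measurable_EFinP; apply: measurable_funS mg => // x /=; rewrite !in_itv /=; lra.
have abs n x : (`|(k n x)%:E| <= (2 * `|g x|)%:E)%E.
  rewrite /= lee_fin /k normrM mulrC ler_wpM2r//.
  apply: le_trans (ler_normB _ _) _.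
  by have := step_bound a x (hs_gt0 n); have := step_bound b x (hs_gt0 n); lra.
have ptw x : (k n x)%:E @[n --> \oo] --> l x.
  rewrite /l patchE.
  have tail (c : R) : c < x -> \forall n \near \oo, c + hs n <= x.
    move=> cx; have H : \forall h \near 0^'+, c + h <= x.
      near=> h; rewrite -lerBrDl; near: h; apply: nbhs_right_le.
      by rewrite subr_gt0.
    exact: hs_cvg0 H.
  case: ifPn; rewrite ?notin_setE ?inE /= in_itv /=.
    move=> /andP[ax' xb]; apply: cvg_near_cst.
    apply: filterS (tail a ax') => n h; rewrite /k step_right ?hs_gt0//.
    by rewrite step_left ?hs_gt0// subr0 mulr1.
  move=> H; apply: cvg_near_cst.
  have [bx|xb] := ltP b x.
    apply: filterS2 (tail a (lt_trans ab bx)) (tail b bx) => n h1 h2.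
    by rewrite /k !step_right ?hs_gt0// subrr mulr0.
  have xa : x <= a by move: H; rewrite xb andbT; case: leP.
  apply: nearW => n; rewrite /k (step_left (hs_gt0 n) xa) (step_left (hs_gt0 n) xb).
  by rewrite subrr mulr0.
have ig2 : mu.-integrable `[a, b + 1] (fun x => (2 * `|g x|)%:E).
  exact: (integrableZl _ 2 (integrable_norm (ig a (b + 1)))).
have ml : measurable_fun `[a, b + 1] l.
  apply/measurable_restrict => //; apply/measurable_EFinP.
  by apply: measurable_funS mg => //; exact: subIsetl.
have [i1 _] := @dominated_convergence _ _ _ mu `[a, b + 1] (measurable_itv _)
  (fun n => EFin \o k n) l (fun x => (2 * `|g x|)%:E) mk ml
  ltac:(apply: aeW => x _; exact: ptw) ig2 ltac:(apply: aeW => x n _; exact: abs).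
rewrite /= lE => H.
rewrite /Rintegral; apply: fine_cvg; rewrite fineK//.
exact: integrable_fin_num.
Unshelve. all: by end_near. Qed.

Lemma test_function_of_drv psi psi' M :
  (forall x, is_derive x 1 psi (psi' x)) -> continuous psi' ->
  (forall x, M < `|x| -> psi x = 0) ->
  test_function psi /\ derive1 psi = psi'.
Proof.
move=> d c z; have e : derive1 psi = psi'.
  by apply/funext => x; rewrite derive1E; case: (d x).
split=> //; split; [by move=> x; case: (d x)|by rewrite e|by exists M].
Qed.

Lemma step_test_function a b h : 0 < h -> h <= 1 ->
  test_function (fun x => step a h x - step b h x) /\
  derive1 (fun x => step a h x - step b h x) = fun x => hat a h x - hat b h x.
Proof.
move=> h0 h1.
apply: (test_function_of_drv (M := `|a| + `|b| + 1)).
- by move=> x; exact: drvB (drv_step a h x) (drv_step b h x).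
- by move=> x; exact: contB (@continuous_hat _ a h x) (@continuous_hat _ b h x).
- move=> x; rewrite ltr_normr => /orP[H|H].
    by rewrite !step_right// ?subrr//; have := ler_norm a; have := ler_norm b;
      have := normr_ge0 a; have := normr_ge0 b; lra.
  have := ler_norm (- a); have := ler_norm (- b); rewrite !normrN => H1 H2.
  by rewrite !step_left// ?subrr//; have := normr_ge0 a; have := normr_ge0 b; lra.
Qed.

Lemma istep_test_function a b h : 0 < h -> h <= 1 ->
  test_function (fun x => istep a h x - istep b h x - (b - a) * step 0 1 x) /\
  derive1 (fun x => istep a h x - istep b h x - (b - a) * step 0 1 x) =
    fun x => step a h x - step b h x - (b - a) * hat 0 1 x.
Proof.
move=> h0 h1.
apply: (test_function_of_drv (M := `|a| + `|b| + 1)).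
- move=> x; apply: (drv_eq (drvB (drvB (drv_istep a h x) (drv_istep b h x))
    (drvM (is_derive_cst (b - a) x (1 : R)) (drv_step 0 1 x)))).
  by rewrite mul0r add0r.
- move=> x; apply: contB (contM (@cont_cst _ _ x) (@continuous_hat _ 0 1 x)).
  exact: contB (@continuous_step _ a h x) (@continuous_step _ b h x).
- move=> x; rewrite ltr_normr => /orP[H|H].
    rewrite !istep_right ?step_right//; have := ler_norm a; have := ler_norm b;
      have := normr_ge0 a; have := normr_ge0 b; try lra.
  have := ler_norm (- a); have := ler_norm (- b); rewrite !normrN => H1 H2.
  rewrite !istep_left ?step_left//; have := normr_ge0 a; have := normr_ge0 b; lra.
Qed.

Definition real_weak_derivative p g := forall psi, test_function psi ->
  \int[mu]_x (p x * derive1 psi x) = - \int[mu]_x (g x * psi x).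

(** The test function is the difference of steps at a and b: its derivative
    concentrates at a and b, while the function itself tends to the indicator
    function of ]a, b]. *)
Lemma weak_increment p g a b : continuous p -> segment_integrable g ->
  real_weak_derivative p g -> a < b ->
  p b - p a = \int[mu]_(x in `[a, b]) g x.
Proof.
move=> cp ig wd ab.
have lim1 := step_integral_cvg ig ab.
have ca := @hat_mean_cvg p a a (b + 1) cp (lexx _) ltac:(lra).
have cb := @hat_mean_cvg p b a (b + 1) cp (ltW ab) ltac:(lra).
have E n : \int[mu]_x (g x * (step a (hs n) x - step b (hs n) x)) =
    \int[mu]_(x in `[a, b + 1]) (p x * hat b (hs n) x) -
    \int[mu]_(x in `[a, b + 1]) (p x * hat a (hs n) x).
  have [tf dE] := step_test_function a b (hs_gt0 n) (hs_le1 n).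
  have := wd _ tf; rewrite dE.
  rewrite (@Rintegral_support _ a (b + 1)); last first.
    move=> x; rewrite negb_and -!ltNge => /orP[xa|bx].
      by rewrite !hat_left ?hs_gt0 ?subrr ?mulr0//; lra.
    rewrite !hat_right ?hs_gt0 ?subrr ?mulr0//; have := hs_le1 n; lra.
  under eq_Rintegral do rewrite mulrBr.
  have ih (c : R) : mu.-integrable `[a, b + 1] (EFin \o (fun x => p x * hat c (hs n) x)).
    by apply: continuous_integrable => x; exact: contM (cp x) (@continuous_hat _ _ _ x).
  rewrite RintegralB//; lra.
have lim2 : \int[mu]_x (g x * (step a (hs n) x - step b (hs n) x)) @[n --> \oo] -->
    p b - p a.
  rewrite (_ : (fun n => _) = (fun n => \int[mu]_(x in `[a, b + 1]) (p x * hat b (hs n) x) -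
    \int[mu]_(x in `[a, b + 1]) (p x * hat a (hs n) x))); last first.
    by apply/funext => n; rewrite E.
  exact: cvgB cb ca.
exact: (cvg_unique _ lim2 lim1).
Qed.

Lemma segment_integrable_mul D k : segment_integrable D -> continuous k ->
  segment_integrable (fun x => D x * k x).
Proof.
move=> iD ck a b.
have [ab|ba] := leP a b; last first.
  by rewrite set_itv_ge ?bnd_simp -?ltNge//; exact: integrable_set0.
have [K HK] : exists K : R, forall x, a <= x <= b -> `|k x| <= K.
  have cn : {within `[a, b], continuous (fun x => `|k x|)}.
    apply: continuous_subspaceT => x.
    exact: cont_norm (ck x).
  have [c _ cP] := EVT_max ab cn.
  by exists `|k c| => x xM; apply: cP; rewrite in_itv.
have iK : mu.-integrable `[a, b] (EFin \o (fun x => K * `|D x|)).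
  exact: (integrableZl _ K (integrable_norm (iD a b))).
apply: le_integrable iK => //.
  apply/measurable_EFinP; apply: measurable_funM.
    by have /measurable_int/measurable_EFinP := iD a b.
  by apply: measurable_funTS; exact: continuous_measurable_fun.
move=> x; rewrite /= in_itv /= => /HK H; rewrite lee_fin !normrM normr_id.
by rewrite mulrC ler_wpM2r// (le_trans H)// ler_norm.
Qed.

(** The test function is a primitive of the difference of steps at a and b, from
    which a multiple of a fixed step is subtracted to make the support compact;
    that multiple is the length of the segment. *)
Lemma du_bois_reymond D : segment_integrable D ->
  real_weak_derivative D (cst 0) ->
  exists k : R, forall a b, a < b -> \int[mu]_(x in `[a, b]) D x = k * (b - a).
Proof.
move=> iD wd; exists (\int[mu]_x (D x * hat 0 1 x)) => a b ab.
have lim1 := step_integral_cvg iD ab.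
suff E n : \int[mu]_x (D x * (step a (hs n) x - step b (hs n) x)) =
    \int[mu]_x (D x * hat 0 1 x) * (b - a).
  have lim2 : \int[mu]_x (D x * (step a (hs n) x - step b (hs n) x)) @[n --> \oo]
      --> \int[mu]_x (D x * hat 0 1 x) * (b - a).
    by apply: cvg_near_cst; exact: nearW.
  exact: (cvg_unique _ lim1 lim2).
(* The derivative of this test function is the difference of steps minus
   (b - a) times a fixed hat. *)
have [tf dE] := istep_test_function a b (hs_gt0 n) (hs_le1 n).
have := wd _ tf; rewrite dE.
under [in RHS]eq_Rintegral do rewrite mul0r.
rewrite [in RHS]/Rintegral integral0 /= oppr0.
pose M : R := `|a| + `|b| + 1.
have := ler_norm a; have := ler_norm b; have := ler_norm (- a).
have := ler_norm (- b); rewrite !normrN => na nb na' nb'.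
have n1 := hs_le1 n; have n0 := hs_gt0 n.
have out1 x : ~~ (- M <= x <= M) -> step a (hs n) x - step b (hs n) x = 0.
  rewrite negb_and -!ltNge /M => /orP[xa|bx].
    by rewrite !step_left ?subrr//; have := normr_ge0 a; have := normr_ge0 b; lra.
  by rewrite !step_right ?subrr//; have := normr_ge0 a; have := normr_ge0 b; lra.
have out2 x : ~~ (- M <= x <= M) -> hat 0 1 x = 0.
  rewrite negb_and -!ltNge /M => /orP[xa|bx].
    by rewrite hat_left//; have := normr_ge0 a; have := normr_ge0 b; lra.
  by rewrite hat_right//; have := normr_ge0 a; have := normr_ge0 b; lra.
have icont k := @segment_integrable_mul D k iD.
have i1 : mu.-integrable `[- M, M]
    (EFin \o (fun x => D x * (step a (hs n) x - step b (hs n) x))).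
  by apply: icont => // x; exact: contB (@continuous_step _ _ _ x) (@continuous_step _ _ _ x).
have i2 := icont _ (@continuous_hat _ 0 1) (- M) M.
have i3 : mu.-integrable `[- M, M] (EFin \o (fun x => (b - a) * (D x * hat 0 1 x))).
  exact: (integrableZl _ (b - a) i2).
rewrite (@Rintegral_support _ (- M) M); last first.
  by move=> x H; rewrite out1// out2// mulr0 subr0 mulr0.
rewrite (@Rintegral_support (fun x => D x * (step _ _ _ - _)) (- M) M); last first.
  by move=> x H; rewrite out1// mulr0.
rewrite (@Rintegral_support (fun x => D x * hat 0 1 x) (- M) M); last first.
  by move=> x H; rewrite out2// mulr0.
under eq_Rintegral do rewrite mulrBr mulrCA.
rewrite RintegralB// RintegralZl//.
lra.
Qed.

End WeakDerivatives.

(** * Regularity of weak solutions *)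

Section Regularity.
Context {R : realType}.
Notation mu := (@lebesgue_measure R).
Implicit Types (p g G psi : R -> R) (f F : R -> R[i]) (a b x y : R).

Lemma derive1_support psi M x :
  (forall y, M < `|y| -> psi y = 0) -> M < `|x| -> derive1 psi x = 0.
Proof.
move=> z Mx; rewrite derive1E (@near_eq_derive _ _ _ psi (cst 0)) ?derive_cst//.
have cn : {for x, continuous (fun y : R => `|y|)} by exact: norm_continuous.
have H : \forall y \near x, M < `|y| by exact: cn _ (lt_nbhsr Mx).
by apply: filterS H => y; exact: z.
Qed.

(** If E is a primitive of G, then p1 - E has weak derivative zero and hence is a
    constant k almost everywhere; the increments of p are therefore those of a
    primitive of the continuous function E + k. *)
Lemma weak_second_derivative p p1 p2 G :
  continuous p -> segment_integrable p1 -> segment_integrable p2 ->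
  continuous G -> {ae mu, forall x, p2 x = G x} ->
  real_weak_derivative p p1 -> real_weak_derivative p1 p2 ->
  exists2 p', (forall y, is_derive y 1 p (p' y)) &
    (forall y, is_derive y 1 p' (G y)) /\
    forall a b, a <= b -> p' b - p' a = \int[mu]_(x in `[a, b]) p2 x.
Proof.
move=> cp i1 i2 cG aeG wd1 wd2.
pose E y := oriented_integral 0 y G.
have dE y : is_derive y 1 E (G y) by exact: drv_oriented_integral.
have cE : continuous E by move=> y; exact: (drv_cont (dE y)).
have iE := continuous_segment_integrable cE.
pose D x := p1 x - E x.
have iD : segment_integrable D by move=> a b; exact: (integrableB _ (i1 a b) (iE a b)).
have p2G h a b : continuous h ->
    \int[mu]_(x in `[a, b]) (p2 x * h x) = \int[mu]_(x in `[a, b]) (G x * h x).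
  move=> ch; rewrite /Rintegral; congr fine; apply: ae_eq_integral => //.
  - by have /measurable_int := segment_integrable_mul i2 ch a b.
  - have cGh : continuous (fun x => G x * h x) by move=> x; exact: contM (cG x) (ch x).
    by have /measurable_int := continuous_integrable a b cGh.
  - move: aeG; apply: filterS; first exact: (ae_filter_ringOfSetsType mu).
    by move=> x e _; rewrite e.
have wdD : real_weak_derivative D (cst 0).
  move=> psi tf; have [dpsi cpsi' [M0 M0P]] := tf.
  under [in RHS]eq_Rintegral do rewrite mul0r.
  rewrite [in RHS]/Rintegral integral0 /= oppr0.
  pose M : R := `|M0| + 1; have M1 : 0 < M by rewrite ltr_wpDl.
  have M0M : M0 < M by rewrite (le_lt_trans (ler_norm _))// ltrDl.
  have out x : ~~ (- M <= x <= M) -> M0 < `|x|.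
    by rewrite -ler_norml -ltNge; exact: lt_trans.
  have drpsi x : is_derive x 1 psi (derive1 psi x).
    by rewrite derive1E; exact/derivableP/dpsi.
  have cpsi : continuous psi by move=> x; exact: (drv_cont (drpsi x)).
  rewrite (@Rintegral_support _ _ (- M) M); last first.
    by move=> x /out H; rewrite (derive1_support M0P H) mulr0.
  have := wd2 psi tf.
  rewrite (@Rintegral_support _ _ (- M) M); last first.
    by move=> x /out H; rewrite (derive1_support M0P H) mulr0.
  rewrite (@Rintegral_support _ (fun x => p2 x * psi x) (- M) M); last first.
    by move=> x /out H; rewrite M0P// mulr0.
  rewrite p2G//.
  have cGp : continuous (fun x => G x * psi x) by move=> x; exact: contM (cG x) (cpsi x).
  have cEp : continuous (fun x => E x * derive1 psi x).
    by move=> x; exact: contM (cE x) (cpsi' x).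
  have := @Rintegral_FTC _ (fun x => E x * psi x)
    (fun x => G x * psi x + E x * derive1 psi x) (- M) M
    (fun x => contD (cGp x) (cEp x))
    (fun x => drvM (dE x) (drpsi x)) ltac:(lra).
  rewrite !M0P ?normrN ?(gtr0_norm M1)// !mulr0 subr0.
  rewrite RintegralD//; [|exact: continuous_integrable..].
  under [\int[mu]_(x in _) (D x * _)]eq_Rintegral do rewrite mulrBl.
  rewrite RintegralB//; [lra|exact: segment_integrable_mul|].
  exact: continuous_integrable.
have [k kP] := du_bois_reymond iD wdD.
have cEk : continuous (fun y => E y + k) by move=> y; exact: contD (cE y) (@cont_cst _ k y).
have inc a b : a <= b -> p b - p a = \int[mu]_(x in `[a, b]) (E x + k).
  rewrite le_eqVlt => /predU1P[->|ab]; first by rewrite Rintegral_point subrr.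
  rewrite (weak_increment cp i1 wd1 ab).
  have eD : \int[mu]_(x in `[a, b]) D x =
      \int[mu]_(x in `[a, b]) p1 x - \int[mu]_(x in `[a, b]) E x.
    exact: RintegralB (i1 a b) (iE a b).
  have ik : mu.-integrable `[a, b] (EFin \o (cst k)).
    by apply: continuous_integrable => x; exact: cst_continuous.
  have eE : \int[mu]_(x in `[a, b]) (E x + k) =
      \int[mu]_(x in `[a, b]) E x + k * (b - a).
    apply: etrans (RintegralD _ (iE a b) ik) _ => //; congr (_ + _).
    apply: etrans (Rintegral_cst _ _ _) _ => //; congr (_ * _).
    have m : mu `[a, b] = (b - a)%:E by rewrite lebesgue_measure_itv /= lte_fin ab.
    exact: (congr1 fine m).
  by rewrite eE -(kP a b ab) eD addrC subrK.
exists (fun y => E y + k); last split.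
- move=> y; apply: (@drv_ext _ (fun y => p 0 + oriented_integral 0 y (fun x => E x + k))).
    move=> z; rewrite /oriented_integral; case: leP => [z0|/ltW z0].
      by rewrite -inc//; lra.
    by rewrite -inc//; lra.
  have := drvD (is_derive_cst (p 0) y (1 : R)) (drv_oriented_integral 0 y cEk).
  by rewrite add0r.
- move=> y; have := drvD (dE y) (is_derive_cst k y (1 : R)).
  by rewrite addr0.
- move=> a b ab; have := p2G (fun=> 1) a b (fun x => @cont_cst _ 1 x).
  under eq_Rintegral do rewrite mulr1.
  under [in X in _ = X -> _]eq_Rintegral do rewrite mulr1.
  move=> ->.
  by rewrite (Rintegral_FTC cG dE ab); lra.
Qed.

Lemma continuous_Re f : continuous f -> continuous (fun y => complex.Re (f y)).
Proof.
move=> cf y; apply/cvgrPdist_lt => e e0.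
have e0' : 0 < e%:C :> R[i] by rewrite ltcR.
have /cvgrPdist_lt/(_ _ e0') := cf y.
apply: filterS => z; rewrite normE ltcR => H.
by rewrite -ReN -ReD (le_lt_trans (cnorm_ge_Re _)).
Qed.

Lemma continuous_Im f : continuous f -> continuous (fun y => complex.Im (f y)).
Proof.
move=> cf y; apply/cvgrPdist_lt => e e0.
have e0' : 0 < e%:C :> R[i] by rewrite ltcR.
have /cvgrPdist_lt/(_ _ e0') := cf y.
apply: filterS => z; rewrite normE ltcR => H.
by rewrite -ImN -ImD (le_lt_trans (cnorm_ge_Im _)).
Qed.

Lemma weak_derivative_Re f F : weak_derivative f F ->
  real_weak_derivative (fun y => complex.Re (f y)) (fun y => complex.Re (F y)).
Proof.
move=> wd psi /wd /(congr1 (@complex.Re _)); rewrite ReN /Cintegral /=.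
under eq_Rintegral do rewrite ReM ReR ImR mulr0 subr0.
by under [in X in _ = X -> _]eq_Rintegral do rewrite ReM ReR ImR mulr0 subr0.
Qed.

Lemma weak_derivative_Im f F : weak_derivative f F ->
  real_weak_derivative (fun y => complex.Im (f y)) (fun y => complex.Im (F y)).
Proof.
move=> wd psi /wd /(congr1 (@complex.Im _)); rewrite ImN /Cintegral /=.
under eq_Rintegral do rewrite ImM ReR ImR mulr0 add0r.
by under [in X in _ = X -> _]eq_Rintegral do rewrite ImM ReR ImR mulr0 add0r.
Qed.

Lemma L2_weighted_sq_integrable (w : R -> R) f : measurable_fun setT w ->
  (forall y, 1 <= w y) -> L2_weighted w f ->
  sq_integrable (fun y => complex.Re (f y)) /\
  sq_integrable (fun y => complex.Im (f y)).
Proof.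
move=> mw w1 [mRe mIm fin].
have mN : measurable_fun setT (EFin \o (fun y => cnorm (f y) ^+ 2 * w y)).
  apply/measurable_EFinP; apply: measurable_funM => //.
  rewrite (_ : (fun y => _) = fun y => complex.Re (f y) ^+ 2 + complex.Im (f y) ^+ 2).
    by apply: measurable_funD; exact: measurable_funX.
  by apply/funext => y; exact: sqr_cnorm.
have cmp (h : R -> R) : measurable_fun setT h ->
    (forall y, h y ^+ 2 <= cnorm (f y) ^+ 2) -> sq_integrable h.
  move=> mh hle; split => //; apply: le_lt_trans fin.
  apply: ge0_le_integral => //.
  - by move=> x _; rewrite lee_fin sqr_ge0.
  - by apply/measurable_EFinP; exact: measurable_funX.
  - move=> x _; rewrite lee_fin (le_trans (hle x))// ler_peMr ?sqr_ge0//.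
split; apply: cmp => // y; rewrite sqr_cnorm.
  by rewrite lerDl sqr_ge0.
by rewrite lerDr sqr_ge0.
Qed.

End Regularity.

(** * The Wronskian system *)

Section Reduction.
Context {R : realType}.
Notation mu := (@lebesgue_measure R).
Implicit Types (f F q W : R -> R[i]) (c : R[i]) (a b x y K : R).

Definition has_ccont F y :=
  {for y, continuous (fun x => complex.Re (F x))} /\
  {for y, continuous (fun x => complex.Im (F x))}.

Lemma cont_ext (h k : R -> R) y : h =1 k ->
  {for y, continuous h} -> {for y, continuous k}.
Proof. by move=> /funext ->. Qed.

Lemma ccontD f F y : has_ccont f y -> has_ccont F y ->
  has_ccont (fun x => f x + F x) y.
Proof.
move=> [f1 f2] [F1 F2]; split.
  by apply: cont_ext (contD f1 F1) => x; rewrite ReD.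
by apply: cont_ext (contD f2 F2) => x; rewrite ImD.
Qed.

Lemma ccontM f F y : has_ccont f y -> has_ccont F y ->
  has_ccont (fun x => f x * F x) y.
Proof.
move=> [f1 f2] [F1 F2]; split.
  by apply: cont_ext (contB (contM f1 F1) (contM f2 F2)) => x; rewrite ReM.
by apply: cont_ext (contD (contM f1 F2) (contM f2 F1)) => x; rewrite ImM.
Qed.

Lemma ccontR (h : R -> R) y : {for y, continuous h} -> has_ccont (fun x => (h x)%:C) y.
Proof. by move=> ch; split => //=; exact: cont_cst. Qed.

Lemma contV (h : R -> R) y : h y != 0 -> {for y, continuous h} ->
  {for y, continuous (fun x => (h x)^-1)}.
Proof. by move=> ? ?; exact: continuousV. Qed.

Lemma ccontV F y : F y != 0 -> has_ccont F y -> has_ccont (fun x => (F x)^-1) y.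
Proof.
move=> F0 [F1 F2].
pose N x := complex.Re (F x) * complex.Re (F x) + complex.Im (F x) * complex.Im (F x).
have cN : {for y, continuous N} by exact: contD (contM F1 F1) (contM F2 F2).
have N0 : N y != 0.
  by have := cnorm_gt0 F0; rewrite /N -!expr2 -sqr_cnorm => H; rewrite expf_neq0// gt_eqF.
split.
  by apply: cont_ext (contM F1 (contV N0 cN)) => x; rewrite ReV !expr2.
apply: cont_ext (contB (@cont_cst _ 0 y) (contM F2 (contV N0 cN))) => x.
by rewrite sub0r ImV !expr2 mulNr.
Qed.

Definition half_holder K f :=
  forall a b, a <= b -> cnorm (f b - f a) <= K * Num.sqrt (b - a).

Lemma half_holder_of_increments f (g : R -> R[i]) :
  sq_integrable (fun y => complex.Re (g y)) ->
  sq_integrable (fun y => complex.Im (g y)) ->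
  (forall a b, a <= b -> complex.Re (f b) - complex.Re (f a) =
    \int[mu]_(x in `[a, b]) complex.Re (g x)) ->
  (forall a b, a <= b -> complex.Im (f b) - complex.Im (f a) =
    \int[mu]_(x in `[a, b]) complex.Im (g x)) ->
  exists2 K, 0 <= K & half_holder K f.
Proof.
move=> s1 s2 i1 i2.
have [K1 K10 K1P] := sq_integrable_increment s1.
have [K2 K20 K2P] := sq_integrable_increment s2.
exists (K1 + K2); first exact: addr_ge0.
move=> a b ab; apply: le_trans (cnorm_le_ReIm _) _.
by rewrite !ReIm i1// i2// mulrDl lerD ?K1P ?K2P.
Qed.

Lemma exp_half_ge y : 2 + `|y| <= 2 * expR (`|y| / 2).
Proof. by have := expR_ge1Dx (`|y| / 2); lra. Qed.

(** Growth slower than exp (|y| / 2) leaves a margin for the product with sech to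
    decay. *)
Lemma half_holder_growth f K y : 0 <= K -> half_holder K f ->
  cnorm (f y) <= 2 * (cnorm (f 0) + K) * expR (`|y| / 2).
Proof.
move=> K0 hf; have H : cnorm (f y - f 0) <= K * Num.sqrt `|y|.
  have [y0|y0] := leP 0 y.
    by rewrite ger0_norm// -{2}(subr0 y) hf.
  by rewrite ltr0_norm// cnorm_distC -(sub0r y) hf// ltW.
have s : Num.sqrt `|y| <= 2 + `|y|.
  have := sqr_sqrtr (normr_ge0 y); have := sqrtr_ge0 `|y|.
  by set s := Num.sqrt _ => s0 e; rewrite -e; have := sqr_ge0 (s - 1); nra.
have e := exp_half_ge y; have n0 := normr_ge0 y; have c0 := cnorm_ge0 (f 0).
have -> : f y = f 0 + (f y - f 0) by rewrite addrC subrK.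
apply: le_trans (cnormD _ _) _.
apply: (@le_trans _ _ ((cnorm (f 0) + K) * (2 + `|y|))); first by nra.
rewrite [leRHS]mulrAC [leRHS]mulrC; apply: ler_wpM2l => //; exact: addr_ge0.
Qed.

Lemma L2_weighted_cst1 f : L2_weighted (cst 1) f ->
  sq_integrable (fun y => complex.Re (f y)) /\
  sq_integrable (fun y => complex.Im (f y)).
Proof. by apply: L2_weighted_sq_integrable => //; exact: measurable_cst. Qed.

Lemma weak_derivative_half_holder f g : continuous f ->
  sq_integrable (fun y => complex.Re (g y)) ->
  sq_integrable (fun y => complex.Im (g y)) ->
  weak_derivative f g -> exists2 K, 0 <= K & half_holder K f.
Proof.
move=> cf s1 s2 wd; apply: (half_holder_of_increments s1 s2) => a b.
  rewrite le_eqVlt => /predU1P[->|ab]; first by rewrite Rintegral_point subrr.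
  exact: (weak_increment (continuous_Re cf) (sq_integrable_segment s1)
    (weak_derivative_Re wd) ab).
rewrite le_eqVlt => /predU1P[->|ab]; first by rewrite Rintegral_point subrr.
exact: (weak_increment (continuous_Im cf) (sq_integrable_segment s2)
  (weak_derivative_Im wd) ab).
Qed.

Lemma H1_weighted_half_holder f : H1_weighted (fun y => (derive1 tanh y) ^- 2) f ->
  exists2 K, 0 <= K & half_holder K f.
Proof.
move=> [cf _ [g wd gL2]].
have wE : (fun y : R => (derive1 tanh y) ^- 2) = fun y => cosh y ^+ 4.
  by apply/funext => y; rewrite derive1_tanh /sech -exprM -exprVn invrK.
have [||s1 s2] := L2_weighted_sq_integrable _ _ gL2.
- rewrite wE; apply: measurable_funX; apply: continuous_measurable_fun => y.
  exact: (drv_cont (drv_cosh y)).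
- by move=> y; rewrite [X in _ <= X](congr1 (@^~ y) wE) exprn_ege1// cosh_ge1.
exact: weak_derivative_half_holder wd.
Qed.

Lemma tanhBc_neq0 c y : complex.Im c != 0 -> (tanh y)%:C - c != 0.
Proof.
move=> c0; apply: contraNneq c0 => /(congr1 (@complex.Im _)).
by rewrite !ReIm /= sub0r => /eqP; rewrite oppr_eq0.
Qed.

(** For c off the real line the equation can be solved for the second derivative,
    which is therefore almost everywhere equal to a continuous function. *)
Lemma H2_solution_classical f c F : complex.Im c != 0 -> continuous f ->
  is_H2_solution f c F ->
  exists2 F', (forall y, has_cderiv F y (F' y)) & [/\
    (forall y, has_cderiv F' y (F y +
      (f y - (2 * tanh y * sech y ^+ 2)%:C * F y) / ((tanh y)%:C - c))),
    (exists2 K, 0 <= K & half_holder K F) &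
    (exists2 K, 0 <= K & half_holder K F')].
Proof.
move=> c0 cf [F1 [F2 [[cF wd1 wd2 [L0 L1 L2]] eqn]]].
pose G y := F y + (f y - (2 * tanh y * sech y ^+ 2)%:C * F y) / ((tanh y)%:C - c).
have [s1 s1'] := L2_weighted_cst1 L1; have [s2 s2'] := L2_weighted_cst1 L2.
have ccf (h : R -> R[i]) y : continuous h -> has_ccont h y.
  by move=> ch; split; [exact: continuous_Re|exact: continuous_Im].
have cct y : {for y, continuous (fun y : R => 2 * tanh y * sech y ^+ 2)}.
  apply: contM (drv_cont (drv_sech2 y)).
  exact: contM (@cont_cst _ 2 y) (drv_cont (drv_tanh y)).
have cG y : has_ccont G y.
  apply: ccontD (ccf _ _ cF) _; apply: ccontM.
    have -> : (fun x => f x - (2 * tanh x * sech x ^+ 2)%:C * F x) =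
        (fun x => f x + (- 1%:C) * ((2 * tanh x * sech x ^+ 2)%:C * F x)).
      by apply/funext => x; rewrite mulN1r.
    apply: ccontD (ccf _ _ cf) (ccontM _ (ccontM (ccontR (cct y)) (ccf _ _ cF))).
    by split; exact: cont_cst.
  apply: ccontV; first exact: tanhBc_neq0.
  apply: ccontD; first exact: ccontR (drv_cont (drv_tanh y)).
  by split; exact: cont_cst.
have aeG : {ae mu, forall y, F2 y = G y}.
  move: eqn; apply: filterS; first exact: (ae_filter_ringOfSetsType mu).
  move=> y; rewrite derive2_tanh /G => e.
  have e' : ((tanh y)%:C - c) * (F2 y - F y) =
      f y - (2 * tanh y * sech y ^+ 2)%:C * F y.
    by rewrite -e; apply: eq_ReIm; rewrite !ReIm; ring.
  by rewrite -e' mulrC mulKf ?tanhBc_neq0// addrC subrK.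
have [p1 dp1 [dp1' inc1]] := weak_second_derivative (continuous_Re cF)
  (sq_integrable_segment s1) (sq_integrable_segment s2) (fun y => proj1 (cG y))
  ltac:(by move: aeG; apply: filterS; [exact: (ae_filter_ringOfSetsType mu)|move=> y ->])
  (weak_derivative_Re wd1) (weak_derivative_Re wd2).
have [p2 dp2 [dp2' inc2]] := weak_second_derivative (continuous_Im cF)
  (sq_integrable_segment s1') (sq_integrable_segment s2') (fun y => proj2 (cG y))
  ltac:(by move: aeG; apply: filterS; [exact: (ae_filter_ringOfSetsType mu)|move=> y ->])
  (weak_derivative_Im wd1) (weak_derivative_Im wd2).
exists (fun y => p1 y +i* p2 y); first by move=> y; split.
split.
- by move=> y; split => /=.
- exact: weak_derivative_half_holder wd1.
- exact: (half_holder_of_increments s2 s2').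
Qed.

(** The equation for Psi = c Phi after variation of constants along sech, which
    solves the homogeneous equation at c = 0: q = Psi / sech, and W is the
    Wronskian of sech and Psi. *)
Definition wronskian_system f c q W := [/\
  forall y, has_cderiv q y ((cosh y ^+ 2)%:C * W y),
  forall y, has_cderiv W y (c * ((sech y)%:C * f y - (2 * sech y ^+ 4)%:C * q y) /
    ((tanh y)%:C - c)) &
  exists2 K, 0 <= K & forall y, cnorm (W y) <= K * expR (- `|y| / 2)].

(** This symmetry exchanges the two ends of the line, so that estimates are
    needed only on the positive side. *)
Lemma wronskian_system_opp f c q W : wronskian_system f c q W ->
  wronskian_system (fun y => f (- y)) (- c) (fun y => q (- y)) (fun y => - W (- y)).
Proof.
move=> [dq dW [K K0 KP]]; split.
- move=> y; apply: cdrv_eq (cdrv_opp (dq (- y))) _.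
  by rewrite coshN mulrN.
- move=> y; apply: cdrv_eq (cdrvN (cdrv_opp (dW (- y)))) _.
  rewrite tanhN sechN opprK opprK rmorphN /=.
  have -> : - (tanh y)%:C - c = - ((tanh y)%:C + c) by rewrite opprD.
  by rewrite invrN mulrN !mulNr.
- by exists K => // y; rewrite cnormN; apply: le_trans (KP _) _; rewrite normrN.
Qed.

Lemma wronskian_system_of_H2_solution f c F : complex.Im c != 0 -> continuous f ->
  is_H2_solution f c F ->
  exists W, wronskian_system f c (fun y => (cosh y)%:C * (c * F y)) W.
Proof.
move=> c0 cf /(H2_solution_classical c0 cf)[F' dF [dF' [K K0 hK] [K' K'0 hK']]].
exists (fun y => (sech y)%:C * (c * F' y) + (tanh y * sech y)%:C * (c * F y)).
have dcF (y : R) : has_cderiv (fun y => c * F y) y (c * F' y).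
  by apply: cdrv_eq (cdrvM (cdrv_cst y c) (dF y)) _; rewrite mul0r add0r.
have dcF' y := cdrv_eq (cdrvM (cdrv_cst y c) (dF' y)) (etrans (congr1 (+%R^~ _) (mul0r _)) (add0r _)).
split.
- move=> y; apply: cdrv_eq (cdrvM (cdrvR (drv_cosh y)) (dcF y)) _.
  rewrite sinhE; move: (cosh_sech y) => /(congr1 (fun x => x%:C)).
  move: (tanh y) (sech y) (cosh y) => u' s' ch'.
  rewrite !(rmorphM, rmorphXn, rmorph1) /=.
  move: u'%:C s'%:C ch'%:C => u s ch e.
  transitivity (ch * (ch * s) * (c * F' y + u * (c * F y))); last first.
    by ring.
  by rewrite e; ring.
- move=> y; apply: cdrv_eq.
    apply: cdrvD (cdrvM (cdrvR (drv_sech y)) (dcF' y)) _.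
    exact: cdrvM (cdrvR (drvM (drv_tanh y) (drv_sech y))) (dcF y).
  have uc := tanhBc_neq0 y c0.
  move: (cosh_sech y) (sech2E y) uc => /(congr1 (fun x => x%:C)) + /(congr1 (fun x => x%:C)).
  move: (tanh y) (sech y) (cosh y) => u' s' ch'.
  rewrite !(rmorphM, rmorphXn, rmorphN, rmorphB, rmorphD, rmorph1) /=.
  move: u'%:C s'%:C ch'%:C => u s ch e s2 uc.
  apply/eqP; rewrite -subr_eq0; apply/eqP.
  transitivity (- (c * F y * s) * (s * s - (1 - u * u)) +
     2 * c ^+ 2 * s ^+ 3 * F y / (u - c) * (ch * s - 1)); last first.
    by rewrite s2 e !subrr !mulr0 addr0.
  by field.
- pose A := cnorm c * (2 * (cnorm (F' 0) + K') + 2 * (cnorm (F 0) + K)).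
  exists (2 * A).
    rewrite /A; have := cnorm_ge0 (F 0); have := cnorm_ge0 (F' 0).
    have := cnorm_ge0 c; nra.
  move=> y.
  have b1 := half_holder_growth y K0 hK; have b2 := half_holder_growth y K'0 hK'.
  have se := sech_le_expN y; have s0 := sech_gt0 y.
  apply: le_trans (cnormD _ _) _; rewrite !cnormM !cnormR (gtr0_norm s0).
  rewrite normrM (gtr0_norm s0).
  have t1 := ltW (tanh_lt1 y); have t0 := normr_ge0 (tanh y).
  have c00 := cnorm_ge0 c.
  have -> : expR (- `|y| / 2) = expR (- `|y|) * expR (`|y| / 2).
    by rewrite -expRD; congr expR; lra.
  have E0 := expR_gt0 (`|y| / 2); set E := expR (`|y| / 2) in b1 b2 E0 *.
  have A0 : 0 <= A.
    by rewrite /A; have := cnorm_ge0 (F 0); have := cnorm_ge0 (F' 0); nra.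
  have b1' := ler_wpM2l c00 b1; have b2' := ler_wpM2l c00 b2.
  have AE : 0 <= A * E by rewrite mulr_ge0// ltW.
  apply: (@le_trans _ _ (sech y * (A * E))); last first.
    by have := ler_wpM2r AE se; lra.
  have AEE : A * E = cnorm c * (2 * (cnorm (F' 0) + K') * E) +
    cnorm c * (2 * (cnorm (F 0) + K) * E) by rewrite /A; ring.
  rewrite AEE mulrDr lerD ?ler_wpM2l ?(ltW s0)//.
  have X0 : 0 <= sech y * (cnorm c * cnorm (F y)).
    by rewrite mulr_ge0 ?(ltW s0)// mulr_ge0 ?cnorm_ge0.
  have := ler_wpM2l (ltW s0) b1'; have := ler_piMl X0 t1; lra.
Qed.

End Reduction.

(** * The signed square root *)

Section SignedSqrt.
Context {R : realType}.
Implicit Types (s t x y a : R).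

(** The continuous primitive of |s|^(-1/2) / 2. Taken at s = u - Re c it is the
    comparison function for derivatives that are singular at the critical point. *)
Definition signed_sqrt s : R := Num.sqrt s - Num.sqrt (- s).

Lemma signed_sqrt_pos s : 0 <= s -> signed_sqrt s = Num.sqrt s.
Proof. by move=> s0; rewrite /signed_sqrt (@ler0_sqrtr _ (- s)) ?subr0// oppr_le0. Qed.

Lemma signed_sqrt_neg s : s <= 0 -> signed_sqrt s = - Num.sqrt (- s).
Proof. by move=> s0; rewrite /signed_sqrt ler0_sqrtr// sub0r. Qed.

Lemma continuous_signed_sqrt : continuous signed_sqrt.
Proof.
move=> s; apply: contB; first exact: sqrt_continuous.
apply: (@continuous_comp R R R (fun z => - z) Num.sqrt s).
  exact: opp_continuous.
exact: sqrt_continuous.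
Qed.

Lemma drv_signed_sqrt s : s != 0 ->
  is_derive s 1 signed_sqrt (2 * Num.sqrt `|s|)^-1.
Proof.
move=> s0; have [sn|sp|/eqP] := ltgtP s 0; last by rewrite (negPf s0).
- rewrite ltr0_norm//.
  have H : is_derive s 1 (fun z => - Num.sqrt (- z)) (2 * Num.sqrt (- s))^-1.
    rewrite -[X in is_derive _ _ _ X]opprK; apply: drvN; apply: drv_opp.
    by apply: is_derive1_sqrt; rewrite oppr_gt0.
  apply: near_eq_is_derive H; apply: filterS (lt_nbhsl sn) => z /ltW z0.
  by rewrite signed_sqrt_neg.
- rewrite gtr0_norm//.
  apply: near_eq_is_derive (is_derive1_sqrt sp).
  by apply: filterS (lt_nbhsr sp) => z /ltW z0; rewrite signed_sqrt_pos.
Qed.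

Lemma sqrtD_le s t : 0 <= s -> 0 <= t ->
  Num.sqrt s + Num.sqrt t <= 2 * Num.sqrt (s + t).
Proof.
move=> s0 t0.
have : Num.sqrt s <= Num.sqrt (s + t) by rewrite ler_wsqrtr// lerDl.
have : Num.sqrt t <= Num.sqrt (s + t) by rewrite ler_wsqrtr// lerDr.
lra.
Qed.

Lemma sqrtB_le s t : 0 <= t -> t <= s ->
  Num.sqrt s - Num.sqrt t <= Num.sqrt (s - t).
Proof.
move=> t0 ts; rewrite lerBlDr.
rewrite -(@ler_pXn2r _ 2)// ?nnegrE ?addr_ge0 ?sqrtr_ge0//.
rewrite sqrrD !sqr_sqrtr ?subr_ge0//; last exact: le_trans ts.
have : 0 <= Num.sqrt (s - t) * Num.sqrt t by rewrite mulr_ge0 ?sqrtr_ge0.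
lra.
Qed.

Lemma signed_sqrt_increment s t : t <= s ->
  signed_sqrt s - signed_sqrt t <= 2 * Num.sqrt (s - t).
Proof.
move=> ts; have r0 := sqrtr_ge0 (s - t).
have [t0|t0] := leP 0 t.
  rewrite !signed_sqrt_pos//; last exact: le_trans ts.
  by have := sqrtB_le t0 ts; lra.
have [s0|s0] := leP 0 s.
  rewrite signed_sqrt_pos// signed_sqrt_neg ?(ltW t0)// opprK.
  by apply: sqrtD_le => //; lra.
rewrite !signed_sqrt_neg ?(ltW s0)// ?(ltW t0)// opprK.
have := @sqrtB_le (- t) (- s); rewrite opprK => /(_ ltac:(lra) ltac:(lra)).
rewrite [- t + s]addrC; lra.
Qed.

Lemma signed_sqrt_incr s t : t <= s -> signed_sqrt t <= signed_sqrt s.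
Proof.
move=> ts; have h : Num.sqrt (- s) <= Num.sqrt (- t) by rewrite ler_wsqrtr ?lerN2.
by rewrite lerD ?lerN2// ler_wsqrtr.
Qed.

Lemma sqrt_le_bound x k : 0 <= k -> x <= k ^+ 2 -> Num.sqrt x <= k.
Proof. by move=> k0 xk; rewrite -[leRHS]ger0_norm// -sqrtr_sqr ler_wsqrtr. Qed.

End SignedSqrt.

(** * The logarithm of s - c along the real line *)

Section Logarithm.
Context {R : realType}.
Implicit Types (s y t : R) (c : R[i]).

(** A primitive of 1 / (s - c) on the real line, for c not real; it is a
    branch of log (s - c) up to an additive constant on each half-plane. *)
Definition clog c s : R[i] :=
  (ln ((s - complex.Re c) ^+ 2 + complex.Im c ^+ 2) / 2) +i*
  (atan ((s - complex.Re c) / complex.Im c)).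

Lemma cdrv_clog c s : complex.Im c != 0 -> has_cderiv (clog c) s (s%:C - c)^-1.
Proof.
case: c => a e /= e0.
have dl : is_derive s 1 (fun s : R => s - a) 1.
  by have := drvB (is_derive_id s (1 : R)) (is_derive_cst a s (1 : R)); rewrite subr0.
have e2 : 0 < e ^+ 2 by rewrite lt_def sqr_ge0 expf_neq0.
have N0 : 0 < (s - a) ^+ 2 + e ^+ 2 by rewrite ltr_wpDl ?sqr_ge0.
have dN : is_derive s 1 (fun s : R => (s - a) ^+ 2 + e ^+ 2) (2 * (s - a)).
  have h := drvD (drvM dl dl) (is_derive_cst (e ^+ 2) s (1 : R)).
  by apply: (drv_eq h); ring.
split => /=.
  have h := drvM (@drv_comp _ _ (fun s : R => (s - a) ^+ 2 + e ^+ 2) s _ _ (is_derive1_ln N0) dN)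
    (is_derive_cst (2^-1 : R) s (1 : R)).
  by apply: (drv_eq h); rewrite sub0r sqrrN /cst; field; rewrite gt_eqF.
have h := @drv_comp _ _ (fun x => (x - a) / e) s _ _ (is_derive1_atan _)
  (drvM dl (is_derive_cst (e^-1 : R) s (1 : R))).
apply: (drv_eq h); rewrite sub0r sqrrN /cst; field.
by rewrite e0 gt_eqF.
Qed.

Lemma cdrv_clog_tanh c y : complex.Im c != 0 ->
  has_cderiv (fun y => clog c (tanh y)) y ((sech y ^+ 2)%:C / ((tanh y)%:C - c)).
Proof.
move=> c0; have [d1 d2] := cdrv_clog (tanh y) c0.
split; rewrite ?ReM ?ImM ReR ImR mul0r ?subr0 ?addr0 mulrC.
  exact: drv_comp d1 (drv_tanh y).
exact: drv_comp d2 (drv_tanh y).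
Qed.

(** A power instead of the logarithm is enough for what follows, and it is uniform
    as Im c tends to 0. *)
Lemma clog_bound c s : complex.Im c != 0 -> cnorm c <= 1 / 4 -> `|s| <= 1 ->
  s != complex.Re c -> cnorm (clog c s) <= 8 / Num.sqrt `|s - complex.Re c|.
Proof.
move=> c0 c4 s1 sa; have := le_trans (cnorm_ge_Re c) c4; have := le_trans (cnorm_ge_Im c) c4.
rewrite /clog; move: (complex.Re c) (complex.Im c) c0 sa => a e e0 sa ie' ia'.
set t := Num.sqrt `|s - a|.
have t0 : 0 < t by rewrite sqrtr_gt0 normr_gt0 subr_eq0.
have t2 : t ^+ 2 = `|s - a| by rewrite sqr_sqrtr.
have t4 : t ^+ 4 = (s - a) ^+ 2.
  by rewrite (exprM t 2 2) t2 real_normK// num_real.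
have tle : t <= 6 / 5.
  apply: sqrt_le_bound => //.
  by apply: le_trans (ler_normB _ _) _; lra.
set N := (s - a) ^+ 2 + e ^+ 2.
have e2 : 0 < e ^+ 2 by rewrite lt_def sqr_ge0 expf_neq0.
have N0 : 0 < N by rewrite ltr_wpDl ?sqr_ge0.
have Nle : N <= 2.
  have -> : N = t ^+ 2 ^+ 2 + `|e| ^+ 2.
    by rewrite t2 !real_normK// num_real.
  have : t ^+ 2 <= 5/4.
    by rewrite t2; apply: le_trans (ler_normB _ _) _; lra.
  have := sqr_ge0 t; have := normr_ge0 e; nra.
have u0 : 0 < t^-1 by rewrite invr_gt0.
have tu : t * t^-1 = 1 by rewrite mulfV// gt_eqF.
have lN1 : ln N <= 1.
  have := @le_ln1Dx R (N - 1); rewrite (_ : 1 + (N - 1) = N); last by ring.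
  by move=> H; apply: le_trans (H _) _; lra.
have lN2 : - (4 * t^-1) <= ln N.
  have : - ln N <= ln ((t^-1) ^+ 4).
    rewrite -lnV ?posrE// ler_ln ?posrE ?invr_gt0 ?exprn_gt0//.
    rewrite exprVn lef_pV2 ?posrE ?exprn_gt0// t4 /N lerDl sqr_ge0//.
  rewrite lnXn// => H.
  have := ltW (ln_sublinear u0); move: H; rewrite -mulr_natl; lra.
apply: le_trans (cnorm_le_ReIm _) _ => /=.
have A1 : `|ln N / 2| <= 2 * t^-1.
  rewrite ler_norml; apply/andP; split; last first.
    have : 5 / 6 <= t^-1 by nra.
    by lra.
  lra.
have A2 : `|atan ((s - a) / e)| <= 2.
  have := atan_gtNpi2 ((s - a) / e); have := atan_ltpi2 ((s - a) / e).
  by have := pihalf_lt2 R; rewrite ler_norml; lra.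
have : 5 / 6 <= t^-1 by nra.
lra.
Qed.

End Logarithm.

(** * Decay at infinity and admissible sources *)

Section Estimates.
Context {R : realType}.
Implicit Types (f F q W : R -> R[i]) (c : R[i]) (a b x y z K M N : R).

Definition vanishes_at_infinity F :=
  forall e : R, 0 < e -> exists y0, forall y, y0 <= y -> cnorm (F y) <= e.

Lemma drv_exp_half y :
  is_derive y 1 (fun x : R => expR (- x / 2)) (- 2^-1 * expR (- y / 2)).
Proof.
have h : is_derive y 1 (fun x : R => - x / 2) (- 2^-1).
  have h := drvM (drvN (is_derive_id y (1 : R))) (is_derive_cst (2^-1 : R) y (1 : R)).
  by apply: (drv_eq h); rewrite mulr0 addr0 mulN1r.
have k := @drv_comp _ _ (fun x : R => - x / 2) y _ _ (is_derive_expR _) h.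
by apply: (drv_eq k); rewrite mulrC.
Qed.

(** F y0 is minus the integral of F' from y0 to infinity. *)
Lemma decay_bound F F' (A : R) y0 : 0 <= A ->
  (forall y, y0 <= y -> has_cderiv F y (F' y)) ->
  (forall y, y0 <= y -> cnorm (F' y) <= A * expR (- y / 2)) ->
  vanishes_at_infinity F ->
  cnorm (F y0) <= 4 * A * expR (- y0 / 2).
Proof.
move=> A0 dF bF vF; apply/ler_addgt0Pr => e e0.
have [Y YP] := vF e e0.
pose y1 := Num.max Y y0; have y1P : y0 <= y1 by rewrite le_max lexx orbT.
have Fy1 : cnorm (F y1) <= e by apply: YP; rewrite le_max lexx.
pose B (x : R) := - 2 * A * expR (- x / 2).
have dB x : is_derive x 1 B (A * expR (- x / 2)).
  by apply: (drv_eq (drvZ (- 2 * A) (drv_exp_half x))); field.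
have := @cincrement_le _ F F' B (fun x => A * expR (- x / 2)) y0 y1 y1P
  (fun x xI => dF x (proj1 (andP xI))) (fun x _ => dB x)
  (fun x xI => bF x (proj1 (andP xI))).
move=> H; have -> : F y0 = F y1 - (F y1 - F y0) by rewrite opprB addrC subrK.
apply: le_trans (cnormB _ _) _.
have By1 : B y1 <= 0 by rewrite /B !mulNr oppr_le0 !mulr_ge0// expR_ge0.
have By0 : B y0 = - (2 * A * expR (- y0 / 2)) by rewrite /B !mulNr.
move: H; rewrite By0. lra.
Qed.

Lemma vanishes_of_exp F K : 0 <= K ->
  (forall y, 1 <= y -> cnorm (F y) <= K * expR (- y / 2)) -> vanishes_at_infinity F.
Proof.
move=> K0 KP e e0; exists (Num.max 1 (2 * K / e)) => y; rewrite ge_max => /andP[y1 yP].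
apply: le_trans (KP y y1) _.
have -> : - y / 2 = - (y / 2) by rewrite mulNr.
rewrite expRN ler_pdivrMr ?expR_gt0//.
have h := expR_ge1Dx (y / 2).
have : 2 * K <= y * e by rewrite -ler_pdivrMr.
have := ler_wpM2l (ltW e0) h; lra.
Qed.

(** What the estimates use of the source: the decay of sech f, and the Hoelder
    continuity near the critical point, in the variable u = tanh y, of cosh f,
    which is the density of sech f dy with respect to du. *)
Definition admissible K f := [/\ 0 <= K,
  forall y, cnorm ((sech y)%:C * f y) <= K * expR (- `|y| / 2),
  forall y z, `|y| <= 1 -> `|z| <= 1 ->
    cnorm ((cosh y)%:C * f y - (cosh z)%:C * f z) <=
    K * Num.sqrt `|tanh y - tanh z| &
  forall y, `|y| <= 1 -> cnorm ((cosh y)%:C * f y) <= K].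

Lemma admissible_opp K f : admissible K f -> admissible K (fun y => f (- y)).
Proof.
move=> [K0 h1 h2 h3]; split => // [y|y z y1 z1|y y1].
- by rewrite -sechN; apply: le_trans (h1 _) _; rewrite normrN.
- rewrite -(coshN y) -(coshN z); apply: le_trans (h2 _ _ _ _) _; rewrite ?normrN//.
  by rewrite !tanhN -opprD normrN.
- by rewrite -coshN; apply: h3; rewrite normrN.
Qed.

(** A bound for cosh and exp on [-1, 1], kept opaque so that arithmetic treats it
    as an atom. *)
Definition e1 : R := expR 1.
Local Notation E := e1.

Lemma E_ge1 : 1 <= E. Proof. by have := expR_ge1Dx (1 : R); rewrite /e1; lra. Qed.

Lemma cosh_le_E y : `|y| <= 1 -> cosh y <= E.
Proof. by move=> y1; apply: le_trans (cosh_le_exp y) _; rewrite ler_expR. Qed.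

Lemma expR_le_E y : y <= 1 -> expR y <= E.
Proof. by move=> y1; rewrite ler_expR. Qed.

Opaque e1.

Lemma E_sech y : `|y| <= 1 -> 1 <= E * sech y.
Proof.
by move=> y1; rewrite -(cosh_sech y) ler_wpM2r ?cosh_le_E// ltW// sech_gt0.
Qed.

Lemma E2_sech2 y : `|y| <= 1 -> 1 <= E ^+ 2 * sech y ^+ 2.
Proof. by move=> y1; rewrite -exprMn exprn_ege1// E_sech. Qed.

Lemma itv_norm1 y z x : `|y| <= 1 -> `|z| <= 1 -> y <= x <= z -> `|x| <= 1.
Proof. rewrite !ler_norml; lra. Qed.

(** On [-1, 1] the variable u = tanh y is comparable with y. *)
Lemma increment_le_tanh (h h' : R -> R) (k : R) y z :
  (forall x, is_derive x 1 h (h' x)) ->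
  (forall x, `|x| <= 1 -> `|h' x| <= k * sech x ^+ 2) ->
  `|y| <= 1 -> `|z| <= 1 -> y <= z ->
  `|h z - h y| <= k * (tanh z - tanh y).
Proof.
move=> dh hk y1 z1 yz; rewrite mulrBr.
have dk x : is_derive x 1 (fun x => k * tanh x) (k * sech x ^+ 2).
  exact: drvZ (drv_tanh x).
exact: (@increment_le _ h h' _ _ y z yz (fun x _ => dh x) (fun x _ => dk x)
  (fun x xI => hk x (itv_norm1 y1 z1 xI))).
Qed.

Lemma half_holder_admissible K f : 0 <= K -> half_holder K f ->
  exists K', admissible K' f.
Proof.
move=> K0 hf; have E1 := E_ge1.
have [A A0 fA] : exists2 A : R, 0 <= A &
    forall y, cnorm (f y) <= A * expR (`|y| / 2).
  exists (2 * (cnorm (f 0) + K)); first by have := cnorm_ge0 (f 0); lra.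
  by move=> y; exact: half_holder_growth.
have fA1 y : `|y| <= 1 -> cnorm (f y) <= A * E.
  move=> y1; apply: le_trans (fA y) _; rewrite ler_wpM2l// expR_le_E//.
  by have := normr_ge0 y; lra.
have E0 : 0 <= E by lra.
exists (2 * A + E ^+ 2 * K + 2 * (E ^+ 3 * (A * E)) + E * (A * E)).
have t1 : 0 <= E ^+ 2 * K by rewrite mulr_ge0 ?exprn_ge0.
have t2 : 0 <= E ^+ 3 * (A * E) by rewrite mulr_ge0 ?exprn_ge0// mulr_ge0.
have t3 : 0 <= E * (A * E) by rewrite !mulr_ge0.
split; first by lra.
- move=> y; rewrite cnormM cnormR (gtr0_norm (sech_gt0 y)).
  have e : expR (- `|y| / 2) = expR (- `|y|) * expR (`|y| / 2).
    by rewrite -expRD; congr expR; lra.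
  have s := sech_le_expN y; have s0 := sech_gt0 y.
  apply: (@le_trans _ _ (2 * A * expR (- `|y| / 2))).
    rewrite e mulrACA; apply: ler_pM; rewrite ?cnorm_ge0 ?(ltW s0)//.
  by rewrite ler_wpM2r ?expR_ge0//; lra.
- have wlog_case y z : `|y| <= 1 -> `|z| <= 1 -> y <= z ->
    cnorm ((cosh z)%:C * f z - (cosh y)%:C * f y) <=
    (2 * A + E ^+ 2 * K + 2 * (E ^+ 3 * (A * E)) + E * (A * E)) *
      Num.sqrt (tanh z - tanh y).
    move=> y1 z1 yz.
    have u0 : 0 <= tanh z - tanh y by rewrite subr_ge0 tanh_incr.
    set d := Num.sqrt _; have d0 : 0 <= d by exact: sqrtr_ge0.
    have d2 : d ^+ 2 = tanh z - tanh y by rewrite sqr_sqrtr.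
    have dle : d <= 2.
      apply: sqrt_le_bound => //.
      by have := tanh_lt1 y; have := tanh_lt1 z; rewrite !ltr_norml; lra.
    have h1 : `|cosh z - cosh y| <= E * E ^+ 2 * (tanh z - tanh y).
      apply: (increment_le_tanh drv_cosh) => // x x1.
      rewrite -mulrA; apply: (@le_trans _ _ E); last first.
        by rewrite ler_peMr ?E2_sech2.
      apply: le_trans (cosh_le_E x1).
      have := cosh2Bsinh2 x; have := cosh_gt0 x => c0 e.
      rewrite -(@ler_pXn2r _ 2)// ?nnegrE ?(ltW c0)// real_normK ?num_real//; lra.
    have h2 : `|z - y| <= 1 * E ^+ 2 * (tanh z - tanh y).
      apply: (@increment_le_tanh (fun x => x) (fun=> 1)) => // x x1.
      by rewrite normr1 mul1r E2_sech2.
    have h3 : Num.sqrt (z - y) <= E * d.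
      apply: sqrt_le_bound; first by rewrite mulr_ge0.
      rewrite exprMn d2; apply: le_trans (ler_norm _) _; apply: le_trans h2 _.
      by rewrite mul1r.
    have -> : (cosh z)%:C * f z - (cosh y)%:C * f y =
      (cosh z)%:C * (f z - f y) + (cosh z - cosh y)%:C * f y.
      by rewrite rmorphB /=; ring.
    apply: le_trans (cnormD _ _) _; rewrite !cnormM !cnormR (gtr0_norm (cosh_gt0 z)).
    have p1 : cosh z * cnorm (f z - f y) <= E ^+ 2 * K * d.
      apply: (@le_trans _ _ (E * (K * (E * d)))); last by rewrite expr2; lra.
      apply: ler_pM; rewrite ?cnorm_ge0 ?(ltW (cosh_gt0 z)) ?cosh_le_E//.
      by apply: le_trans (hf _ _ yz) _; rewrite ler_wpM2l.
    have p2 : `|cosh z - cosh y| * cnorm (f y) <= 2 * (E ^+ 3 * (A * E)) * d.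
      apply: (@le_trans _ _ (E ^+ 3 * d ^+ 2 * (A * E))).
        by apply: ler_pM; rewrite ?cnorm_ge0 ?fA1// d2 exprS.
      rewrite mulrAC expr2; have : d * d <= 2 * d by rewrite ler_wpM2r.
      by move=> /(ler_wpM2l t2); lra.
    apply: le_trans (lerD p1 p2) _.
    rewrite -mulrDl ler_wpM2r//; lra.
  move=> y z y1 z1; have [yz|/ltW zy] := leP y z.
    by rewrite cnorm_distC distrC ger0_norm ?wlog_case// subr_ge0 tanh_incr.
  by rewrite ger0_norm ?wlog_case// subr_ge0 tanh_incr.
- move=> y y1; rewrite cnormM cnormR (gtr0_norm (cosh_gt0 y)).
  apply: (@le_trans _ _ (E * (A * E))); last lra.
  by apply: ler_pM; rewrite ?cnorm_ge0 ?(ltW (cosh_gt0 y)) ?cosh_le_E ?fA1.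
Qed.

End Estimates.

(** * The Wronskian far from and near the critical point *)

Section Bootstrap.
Context {R : realType}.
Implicit Types (f F q W : R -> R[i]) (c : R[i]) (a b x y z K M N X : R).

Lemma sech4_exp y : sech y ^+ 4 * expR (2 * `|y|) <= 16 * expR (- `|y| / 2).
Proof.
have s0 := sech_gt0 y; have e0 := expR_gt0 (- `|y|).
have h : sech y ^+ 4 <= 16 * expR (- `|y|) ^+ 4.
  apply: (@le_trans _ _ ((2 * expR (- `|y|)) ^+ 4)).
    by rewrite lerXn2r ?nnegrE ?(ltW s0) ?sech_le_expN// mulr_ge0 ?(ltW e0).
  by rewrite exprMn; apply: ler_wpM2r; rewrite ?exprn_ge0 ?(ltW e0)//; lra.
apply: le_trans (ler_wpM2r (expR_ge0 _) h) _.
rewrite -mulrA ler_wpM2l// -expRM_natl -expRD ler_expR.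
by have := normr_ge0 y; lra.
Qed.

Lemma tanh_ge1 y : 1 <= y -> 3 / 5 <= tanh y.
Proof. by move=> y1; apply: le_trans tanh1_ge _; exact: tanh_incr. Qed.

Lemma tanhBc_ge c y : `|tanh y| - cnorm c <= cnorm ((tanh y)%:C - c).
Proof.
have -> : `|tanh y| = cnorm (((tanh y)%:C - c) + c) by rewrite subrK cnormR.
by rewrite lerBlDr cnormD.
Qed.

Lemma source_decay f q K N x : admissible K f -> 0 <= N ->
  (forall y, cnorm (q y) <= N * expR (2 * `|y|)) -> 0 <= x ->
  cnorm ((sech x)%:C * f x - (2 * sech x ^+ 4)%:C * q x) <=
  32 * ((K + N) * expR (- x / 2)).
Proof.
move=> [K0 fK _ _] N0 qN x0; apply: le_trans (cnormB _ _) _.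
have := fK x; rewrite cnormM [cnorm (_%:C * q x)]cnormM cnormR.
have s20 : 0 <= 2 * sech x ^+ 4 by rewrite mulr_ge0// exprn_ge0// ltW// sech_gt0.
rewrite (gtr0_norm (sech_gt0 x)) cnormR (ger0_norm s20).
have s4 := sech4_exp x; have := ler_wpM2l N0 s4; have := qN x.
have s0 : 0 <= sech x ^+ 4 by rewrite exprn_ge0// ltW// sech_gt0.
move=> /(ler_wpM2l s0).
by rewrite (ger0_norm x0); have := mulr_ge0 K0 (expR_ge0 (- x / 2)); lra.
Qed.

(** For y >= 1 the denominator tanh y - c stays away from 0, and W is determined
    by its derivative and its vanishing at infinity. *)
Lemma far_wronskian : exists2 C, 0 <= C & forall f c q W K N y,
  admissible K f -> wronskian_system f c q W ->
  cnorm c <= 1 / 4 -> 0 <= N -> (forall y, cnorm (q y) <= N * expR (2 * `|y|)) ->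
  1 <= y -> cnorm (W y) <= C * (cnorm c * (K + N)) * expR (- y / 2).
Proof.
exists (4 * 128); first by lra.
move=> f c q W K N y fa [_ dW [k k0 kP]] c4 N0 qN y1; have [K0 _ _ _] := fa.
have c0 := cnorm_ge0 c; have cKN : 0 <= cnorm c * (K + N) by rewrite mulr_ge0 ?addr_ge0.
rewrite -(mulrA 4).
apply: (decay_bound _ (fun y _ => dW y)) => //.
- by rewrite mulr_ge0.
- move=> x yx; have x1 : 1 <= x by exact: le_trans yx.
  have x0 : 0 <= x by lra.
  have u1 := tanh_ge1 x1.
  have d4 : 1 / 4 <= cnorm ((tanh x)%:C - c).
    by apply: le_trans (tanhBc_ge c x); rewrite ger0_norm; lra.
  rewrite cnormM cnormV cnormM ler_pdivrMr; last lra.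
  have h := source_decay fa N0 qN x0.
  have := ler_wpM2l c0 h.
  have e0 := mulr_ge0 cKN (expR_ge0 (- x / 2)).
  move: (cnorm (_ - _)) d4 => d d4 H; apply: le_trans H _.
  by have := ler_wpM2l e0 d4; lra.
- apply: (vanishes_of_exp k0) => x x1.
  by have := kP x; rewrite ger0_norm// (le_trans ler01).
Qed.

(** The density with respect to du, u = tanh y, of the source of W. *)
Definition reduced_source f q y : R[i] :=
  (cosh y)%:C * f y - (2 * sech y ^+ 2)%:C * q y.

Lemma reduced_sourceE f q y :
  (sech y)%:C * f y - (2 * sech y ^+ 4)%:C * q y =
  (sech y ^+ 2)%:C * reduced_source f q y.
Proof.
rewrite /reduced_source; move: (cosh_sech y) => /(congr1 (fun x => x%:C)).
move: (sech y) (cosh y) => s' ch'.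
rewrite !(rmorphM, rmorphXn, rmorph1) /=; move: s'%:C ch'%:C => s ch e.
transitivity (s * (ch * s) * f y - 2 * (s * (s * (s * s))) * q y); last by ring.
by rewrite e mulr1; congr (_ - _); ring.
Qed.

Lemma reduced_source_holder f q K N M y z : admissible K f -> 0 <= N -> 0 <= M ->
  (forall y, `|y| <= 1 -> cnorm (q y) <= N) ->
  (forall y z, `|y| <= 1 -> `|z| <= 1 ->
     cnorm (q y - q z) <= M * Num.sqrt `|tanh y - tanh z|) ->
  `|y| <= 1 -> `|z| <= 1 ->
  cnorm (reduced_source f q y - reduced_source f q z) <=
  8 * (K + N + M) * Num.sqrt `|tanh y - tanh z|.
Proof.
move=> [K0 _ fK _] N0 M0 qN qM y1 z1; rewrite /reduced_source.
set d := Num.sqrt _; have d0 : 0 <= d by exact: sqrtr_ge0.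
have d2 : d ^+ 2 = `|tanh y - tanh z| by rewrite sqr_sqrtr.
have ty := ltW (tanh_lt1 y); have tz := ltW (tanh_lt1 z).
have dle : d <= 2.
  by apply: sqrt_le_bound => //; apply: le_trans (ler_normB _ _) _; lra.
have sd : `|sech y ^+ 2 - sech z ^+ 2| <= 4 * d.
  rewrite !sech2E (_ : _ - _ - _ = (tanh z - tanh y) * (tanh z + tanh y)); last by ring.
  rewrite normrM distrC -d2.
  have : `|tanh z + tanh y| <= 2 by apply: le_trans (ler_normD _ _) _; lra.
  have := sqr_ge0 d => dd0 H; apply: le_trans (ler_wpM2l dd0 H) _.
  by rewrite expr2; have := ler_wpM2l d0 dle; lra.
have -> : (cosh y)%:C * f y - (2 * sech y ^+ 2)%:C * q y -
    ((cosh z)%:C * f z - (2 * sech z ^+ 2)%:C * q z) =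
    ((cosh y)%:C * f y - (cosh z)%:C * f z) -
    ((2 * sech y ^+ 2)%:C * (q y - q z) +
     (2 * (sech y ^+ 2 - sech z ^+ 2))%:C * q z).
  move: (cosh y) (cosh z) (sech y ^+ 2) (sech z ^+ 2) => *.
  by rewrite !(rmorphM, rmorphB) /=; ring.
apply: le_trans (cnormB _ _) _.
have h1 := fK y z y1 z1.
have h2 : cnorm ((2 * sech y ^+ 2)%:C * (q y - q z)) <= 2 * M * d.
  have s20 : 0 <= 2 * sech y ^+ 2 by rewrite mulr_ge0 ?sqr_ge0.
  rewrite cnormM cnormR (ger0_norm s20).
  have := qM y z y1 z1; rewrite -/d => H.
  have s1 : sech y ^+ 2 <= 1 by rewrite exprn_ile1 ?sech_le1// ltW// sech_gt0.
  have := ler_pM (sqr_ge0 _) (cnorm_ge0 _) s1 H; lra.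
have h3 : cnorm ((2 * (sech y ^+ 2 - sech z ^+ 2))%:C * q z) <= 8 * N * d.
  rewrite cnormM cnormR normrM (@ger0_norm _ 2)//.
  have := ler_pM (normr_ge0 _) (cnorm_ge0 _) sd (qN z z1); lra.
have := cnormD ((2 * sech y ^+ 2)%:C * (q y - q z))
  ((2 * (sech y ^+ 2 - sech z ^+ 2))%:C * q z).
have := mulr_ge0 K0 d0; have := mulr_ge0 N0 d0; have := mulr_ge0 M0 d0.
move: h1; rewrite -/d; lra.
Qed.

Lemma reduced_source_bound f q K N y : admissible K f -> 0 <= N ->
  (forall y, `|y| <= 1 -> cnorm (q y) <= N) ->
  `|y| <= 1 -> cnorm (reduced_source f q y) <= 2 * (K + N).
Proof.
move=> [K0 _ _ fK] N0 qN y1; apply: le_trans (cnormB _ _) _.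
have s20 : 0 <= 2 * sech y ^+ 2 by rewrite mulr_ge0 ?sqr_ge0.
rewrite [cnorm (_%:C * q y)]cnormM cnormR (ger0_norm s20).
have s1 : sech y ^+ 2 <= 1 by rewrite exprn_ile1 ?sech_le1// ltW// sech_gt0.
have := ler_pM (sqr_ge0 _) (cnorm_ge0 _) s1 (qN y y1); have := fK y y1; lra.
Qed.

Lemma drv_signed_sqrt_tanh a y : tanh y != a ->
  is_derive y 1 (fun x => signed_sqrt (tanh x - a))
    (sech y ^+ 2 / (2 * Num.sqrt `|tanh y - a|)).
Proof.
move=> ya.
have d : is_derive y 1 (fun x => tanh x - a) (sech y ^+ 2).
  by have := drvB (drv_tanh y) (is_derive_cst a y (1 : R)); rewrite subr0.
have ya' : tanh y - a != 0 by rewrite subr_eq0.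
have := @drv_comp _ _ (fun x => tanh x - a) y _ _ (drv_signed_sqrt ya') d.
by rewrite mulrC.
Qed.

Lemma continuous_signed_sqrt_tanh a : continuous (fun x => signed_sqrt (tanh x - a)).
Proof.
move=> y; apply: (@continuous_comp R R R (fun x => tanh x - a) signed_sqrt).
  exact: contB (drv_cont (drv_tanh y)) (@cont_cst _ a y).
exact: continuous_signed_sqrt.
Qed.

(** The singular part of W near the critical point p is the logarithm times the
    value of the source there; what is left has an integrable derivative of
    size |u - a|^(-1/2), uniformly in the distance of c to the real line. *)
Lemma near_wronskian : exists2 C, 0 <= C & forall f c q W K N M p y z,
  admissible K f ->
  wronskian_system f c q W -> complex.Im c != 0 -> 0 <= N -> 0 <= M ->
  (forall y, `|y| <= 1 -> cnorm (q y) <= N) ->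
  (forall y z, `|y| <= 1 -> `|z| <= 1 ->
     cnorm (q y - q z) <= M * Num.sqrt `|tanh y - tanh z|) ->
  `|p| <= 1 -> tanh p = complex.Re c -> `|y| <= 1 -> `|z| <= 1 -> y <= z ->
  cnorm (W z - W y - c * reduced_source f q p *
      (clog c (tanh z) - clog c (tanh y))) <=
  C * (cnorm c * (K + N + M)) *
    (signed_sqrt (tanh z - complex.Re c) - signed_sqrt (tanh y - complex.Re c)).
Proof.
exists (2 * 16); first by lra.
move=> f c q W K N M p y z fa sys ci N0 M0 qN qM p1 pc y1 z1 yz; have [_ dW _] := sys.
pose Z x := W x - c * reduced_source f q p * clog c (tanh x).
pose k := 16 * (cnorm c * (K + N + M)).
have -> : W z - W y - c * reduced_source f q p * (clog c (tanh z) - clog c (tanh y))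
    = Z z - Z y by rewrite /Z; ring.
have [K0 _ _ _] := fa; have c0 := cnorm_ge0 c.
have k0 : 0 <= k by rewrite !mulr_ge0 ?addr_ge0.
have dZ x : has_cderiv Z x (c * ((sech x ^+ 2)%:C *
    (reduced_source f q x - reduced_source f q p)) / ((tanh x)%:C - c)).
  apply: cdrv_eq (cdrvB (dW x) (cdrvM (cdrv_cst x _) (cdrv_clog_tanh x ci))) _.
  by rewrite reduced_sourceE mul0r add0r; ring.
have := @cincrement_le_except _ Z _
  (fun x => k * signed_sqrt (tanh x - complex.Re c))
  (fun x => k * (sech x ^+ 2 / (2 * Num.sqrt `|tanh x - complex.Re c|))) y z p yz
  (fun x _ => dZ x).
rewrite -mulrBr /k => H; apply: le_trans (H _ _ _) _.
- by move=> x _; exact: contM (@cont_cst _ _ x) (@continuous_signed_sqrt_tanh _ x).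
- move=> x _ xp.
  have xc : tanh x != complex.Re c by rewrite -pc; apply: contraNneq xp => /tanh_inj ->.
  exact: drvZ (drv_signed_sqrt_tanh xc).
- move=> x xI xp; have x1 := itv_norm1 y1 z1 xI.
  have xc : tanh x != complex.Re c by rewrite -pc; apply: contraNneq xp => /tanh_inj ->.
  have := reduced_source_holder fa N0 M0 qN qM x1 p1; rewrite pc.
  set D := reduced_source f q x - _; set t := Num.sqrt _ => hD.
  have t0 : 0 < t by rewrite sqrtr_gt0 normr_gt0 subr_eq0.
  have t2 : t ^+ 2 = `|tanh x - complex.Re c| by rewrite sqr_sqrtr.
  have dge : t ^+ 2 <= cnorm ((tanh x)%:C - c).
    by rewrite t2; apply: le_trans (cnorm_ge_Re _); rewrite !ReIm.
  have tt0 : 0 < t ^+ 2 by rewrite exprn_gt0.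
  rewrite cnormM cnormV !cnormM cnormR ger0_norm ?sqr_ge0//.
  rewrite ler_pdivrMr; last exact: lt_le_trans dge.
  have := sqr_ge0 (sech x); move: (sech x ^+ 2) => s s0.
  have X0 : 0 <= K + N + M by rewrite !addr_ge0.
  move: (K + N + M) X0 hD => X X0 hD.
  move: (cnorm (_ - c)) dge => d dge.
  apply: (@le_trans _ _ (16 * (cnorm c * X) * (s / (2 * t)) * t ^+ 2)); last first.
    by rewrite ler_wpM2l// !mulr_ge0// invr_ge0 mulr_ge0// ltW.
  have -> : 16 * (cnorm c * X) * (s / (2 * t)) * t ^+ 2 = cnorm c * (s * (8 * X * t)).
    by field; rewrite gt_eqF.
  by rewrite !ler_wpM2l.
lra.
Qed.

End Bootstrap.

(** * Bounds on the Wronskian in terms of the oscillation of q *)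

Section Oscillation.
Context {R : realType}.
Implicit Types (f F q W : R -> R[i]) (c : R[i]) (a b x y z K M N X A : R).
Local Notation E := (@e1 R).

(** The weight exp (2 |y|) is the growth of a primitive of cosh^2, which is what a
    bounded W gives to q; near 0 the increments are measured in u = tanh y. *)
Definition oscillation_le M q :=
  (forall y, cnorm (q y - q 0) <= M * expR (2 * `|y|)) /\
  (forall y z, `|y| <= 1 -> `|z| <= 1 ->
    cnorm (q y - q z) <= M * Num.sqrt `|tanh y - tanh z|).

Lemma expR2_ge1 y : 1 <= expR (2 * `|y|).
Proof. by rewrite -expR0 ler_expR mulr_ge0. Qed.

Lemma expRN_half_le1 y : 0 <= y -> expR (- y / 2) <= 1.
Proof. by move=> y0; rewrite -expR0 ler_expR mulNr oppr_le0 divr_ge0. Qed.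

Lemma oscillation_bound M q y : 0 <= M -> oscillation_le M q ->
  cnorm (q y) <= (cnorm (q 0) + M) * expR (2 * `|y|).
Proof.
move=> M0 [h _]; have -> : q y = q 0 + (q y - q 0) by rewrite addrC subrK.
apply: le_trans (cnormD _ _) _; rewrite mulrDl lerD// ler_peMr ?cnorm_ge0//.
exact: expR2_ge1.
Qed.

Lemma oscillation_local_bound M q y : 0 <= M -> oscillation_le M q ->
  `|y| <= 1 -> cnorm (q y) <= cnorm (q 0) + M.
Proof.
move=> M0 [_ h] y1; have -> : q y = q 0 + (q y - q 0) by rewrite addrC subrK.
apply: le_trans (cnormD _ _) _; rewrite lerD//.
apply: le_trans (h _ _ y1 _) _; rewrite ?normr0//.
rewrite tanh0 subr0 ler_piMr//; apply: sqrt_le_bound => //.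
by rewrite expr1n ltW// tanh_lt1.
Qed.

Lemma cosh2_le_E y : `|y| <= 1 -> cosh y ^+ 2 <= E ^+ 4 * sech y ^+ 2.
Proof.
move=> y1; have E1 := @E_ge1 R; have E0 : 0 <= E by exact: le_trans E1.
apply: (@le_trans _ _ (E ^+ 2)).
  by rewrite lerXn2r ?nnegrE ?cosh_le_E// ltW// cosh_gt0.
rewrite (_ : E ^+ 4 = E ^+ 2 * E ^+ 2); last by rewrite -exprD.
by rewrite -mulrA ler_peMr ?exprn_ge0// E2_sech2.
Qed.

Lemma expR2_growth f c q W A a y : wronskian_system f c q W -> 0 <= A ->
  0 <= a -> (forall x, a <= x -> cnorm (W x) <= A) -> a <= y ->
  cnorm (q y - q a) <= A * expR (2 * y).
Proof.
move=> [dq _ _] A0 a0 WA ay.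
pose B x := A / 2 * expR (2 * x).
have dB x : is_derive x 1 B (A * expR (2 * x)).
  have h := drvZ (A / 2) (@drv_comp _ _ (fun x : R => 2 * x) x _ _
    (is_derive_expR _) (drv_linear 2 x)).
  by apply: (drv_eq h); field.
have := @cincrement_le _ q _ B (fun x => A * expR (2 * x)) a y ay
  (fun x _ => dq x) (fun x _ => dB x).
move=> H; apply: le_trans (H _) _; last first.
  have : 0 <= A * expR (2 * a) by rewrite mulr_ge0 ?expR_ge0.
  by rewrite /B; lra.
move=> x /andP[ax _]; rewrite cnormM cnormR ger0_norm ?sqr_ge0// mulrC.
apply: ler_pM; rewrite ?cnorm_ge0 ?sqr_ge0 ?WA//.
apply: (@le_trans _ _ (expR `|x| ^+ 2)).
  by rewrite lerXn2r ?nnegrE ?cosh_le_exp ?expR_ge0// ltW// cosh_gt0.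
by rewrite -expRM_natl ger0_norm// (le_trans a0).
Qed.

Lemma oscillation_opp M q : oscillation_le M q ->
  oscillation_le M (fun y => q (- y)).
Proof.
move=> [h1 h2]; split.
  by move=> y; rewrite oppr0; apply: le_trans (h1 _) _; rewrite normrN.
move=> y z y1 z1; apply: le_trans (h2 _ _ _ _) _; rewrite ?normrN//.
by rewrite !tanhN -opprD normrN.
Qed.

(** The starting point of the bootstrap. The bound comes from the decay of W alone
    and is not uniform in c. *)
Lemma oscillation_finite f c q W : wronskian_system f c q W ->
  exists2 M, 0 <= M & oscillation_le M q.
Proof.
move=> sys; have [dq _ [k k0 kP]] := sys.
have Wk y : cnorm (W y) <= k.
  by apply: le_trans (kP y) _; rewrite ler_piMr ?expRN_half_le1.
have L1 : 1 <= E ^+ 4 by rewrite exprn_ege1// E_ge1.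
have kL : 0 <= k * E ^+ 4 by rewrite mulr_ge0//; lra.
exists (4 * (k * E ^+ 4) + k); first by lra.
split.
  move=> y; apply: (@le_trans _ _ (k * expR (2 * `|y|))); last first.
    by rewrite ler_wpM2r ?expR_ge0//; lra.
  have [y0|/ltW y0] := leP 0 y.
    by rewrite ger0_norm//; apply: (expR2_growth sys).
  rewrite ler0_norm//.
  have := @expR2_growth _ _ _ _ k 0 (- y) (wronskian_system_opp sys) k0 (lexx _).
  by rewrite opprK oppr0; apply => [x _|]; rewrite ?cnormN ?oppr_ge0.
have ordered y z : `|y| <= 1 -> `|z| <= 1 -> y <= z ->
    cnorm (q z - q y) <= (4 * (k * E ^+ 4) + k) * Num.sqrt (tanh z - tanh y).
  move=> y1 z1 yz.
  have dB x : is_derive x 1 (fun x => k * E ^+ 4 * tanh x) (k * E ^+ 4 * sech x ^+ 2).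
    exact: drvZ (drv_tanh x).
  have := @cincrement_le _ q _ _ _ y z yz (fun x _ => dq x) (fun x _ => dB x).
  move=> H; apply: le_trans (H _) _.
    move=> x xI; have x1 := itv_norm1 y1 z1 xI.
    rewrite cnormM cnormR ger0_norm ?sqr_ge0// mulrC -mulrA.
    by apply: ler_pM; rewrite ?cnorm_ge0 ?sqr_ge0 ?Wk ?cosh2_le_E.
  have u0 : 0 <= tanh z - tanh y by rewrite subr_ge0 tanh_incr.
  rewrite -mulrBr.
  set d := Num.sqrt _; have d0 : 0 <= d by exact: sqrtr_ge0.
  have d2 : d ^+ 2 = tanh z - tanh y by rewrite sqr_sqrtr.
  have dle : d <= 2.
    apply: sqrt_le_bound => //.
    by have := tanh_lt1 y; have := tanh_lt1 z; rewrite !ltr_norml; lra.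
  rewrite -d2 expr2; have := ler_wpM2l (mulr_ge0 kL d0) dle.
  have := mulr_ge0 k0 d0; lra.
move=> y z y1 z1; have [yz|/ltW zy] := leP y z.
  by rewrite cnorm_distC distrC ger0_norm ?ordered// subr_ge0 tanh_incr.
by rewrite ger0_norm ?ordered// subr_ge0 tanh_incr.
Qed.

(** The constants in [wronskian_bound], collected over plain real numbers; s and s1
    stand for the square roots of |u - Re c| at y and at 1. *)
Lemma bound_arith (C1 C2 k K Q M s1 s d r w z n l1 l e : R) :
  0 <= C1 -> 0 <= C2 -> 0 <= k -> 0 <= K -> 0 <= Q -> 0 <= M ->
  1 / 2 <= s1 -> 0 < s -> s <= 6 / 5 -> d <= 2 * r -> r <= 2 ->
  0 <= n -> 0 <= l1 -> 0 <= l ->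
  w <= C1 * (k * (K + (Q + M))) * e ->
  z <= C2 * (k * (K + (Q + M) + M)) * d ->
  n <= 2 * (K + (Q + M)) -> l1 <= 8 / s1 -> l <= 8 / s -> e <= 1 ->
  w + z + k * n * (l1 + l) <=
    (2 * C1 + 16 * C2 + 80) * (k * (K + Q + M)) / s.
Proof.
move=> C10 C20 k0 K0 Q0 M0 s11 s0 sl dr r2 n0 l10 l0 wb zb nb lb1 lb e1'.
have l16 : l1 <= 16.
  by apply: le_trans lb1 _; rewrite ler_pdivrMr; lra.
rewrite addrA in wb zb nb.
have X0 : 0 <= K + Q + M by lra.
have XM : K + Q + M + M <= 2 * (K + Q + M) by lra.
move: (K + Q + M) X0 XM wb zb nb => X X0 XM wb zb nb.
have kX := mulr_ge0 k0 X0.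
have w1 : w <= C1 * (k * X).
  by apply: le_trans wb _; apply: ler_piMr => //; exact: mulr_ge0.
have z1 : z <= 8 * (C2 * (k * X)).
  have kXM : 0 <= C2 * (k * (X + M)) by rewrite mulr_ge0// mulr_ge0// addr_ge0.
  have d4 : d <= 4 by lra.
  have := ler_wpM2l k0 XM => /(ler_wpM2l C20).
  have := ler_wpM2l kXM d4; lra.
have n1 : k * n * (l1 + l) <= 2 * (k * X) * (16 + 8 / s).
  apply: ler_pM; [exact: mulr_ge0|exact: addr_ge0| |lra].
  by have := ler_wpM2l k0 nb; lra.
have si : 5 / 6 <= s^-1.
  rewrite (_ : 5 / 6 = (6 / 5)^-1); last by field.
  by rewrite lef_pV2 ?posrE.
move: (s^-1) si n1 => t si n1.
have := mulr_ge0 C10 kX; have := mulr_ge0 C20 kX.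
have := ler_wpM2l (mulr_ge0 C10 kX) si.
have := ler_wpM2l (mulr_ge0 C20 kX) si.
have := ler_wpM2l kX si.
lra.
Qed.

(** W y is reached from infinity through the point 1: decay beyond 1, and between
    y and 1 the logarithm with the remainder of [near_wronskian]. Each
    contribution is at most a multiple of |u - Re c|^(-1/2). *)
Lemma wronskian_bound : exists2 C, 0 <= C & forall f c q W K M y,
  admissible K f -> wronskian_system f c q W -> complex.Im c != 0 ->
  cnorm c <= 1 / 4 -> 0 <= M -> oscillation_le M q ->
  `|y| <= 1 -> tanh y != complex.Re c ->
  cnorm (W y) <= C * (cnorm c * (K + cnorm (q 0) + M)) /
    Num.sqrt `|tanh y - complex.Re c|.
Proof.
have [C1 C10 farP] := @far_wronskian R; have [C2 C20 nearP] := @near_wronskian R.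
exists (2 * C1 + 16 * C2 + 80); first by lra.
move=> f c q W K M y fa sys ci c4 M0 osc y1 yc; have [K0 _ _ _] := fa.
have c0 := cnorm_ge0 c; have q00 := cnorm_ge0 (q 0).
have N0 : 0 <= cnorm (q 0) + M by exact: addr_ge0.
have qN y' : `|y'| <= 1 -> cnorm (q y') <= cnorm (q 0) + M.
  exact: oscillation_local_bound.
have a4 : `|complex.Re c| <= 1 / 4 by exact: le_trans (cnorm_ge_Re _) c4.
have [p p1 pc] : exists2 p, `|p| <= 1 & tanh p = complex.Re c.
  by apply: tanh_surj; lra.
have n1 : `|1 : R| <= 1 by rewrite normr1.
have y1' : y <= 1 by exact: le_trans (ler_norm _) y1.
have near := nearP _ _ _ _ _ _ _ _ _ _ fa sys ci N0 M0 qN (proj2 osc) p1 pc y1 n1 y1'.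
have src := reduced_source_bound fa N0 qN p1.
have ty := ltW (tanh_lt1 y); have t1 := ltW (tanh_lt1 (1 : R)).
have ta := tanh1_ge (R := R); have ra := ler_norm (complex.Re c).
have tc : tanh (1 : R) != complex.Re c by case: eqP => // e; lra.
have l1 := clog_bound ci c4 t1 tc; have ly := clog_bound ci c4 ty yc.
have far := farP _ _ _ _ _ _ _ fa sys c4 N0 (fun y => oscillation_bound y M0 osc) (lexx _).
have t10 : 1 / 2 <= Num.sqrt `|tanh 1 - complex.Re c|.
  rewrite (_ : 1 / 2 = Num.sqrt ((1 / 2) ^+ 2)).
    by apply: ler_wsqrtr; rewrite ger0_norm; lra.
  by rewrite sqrtr_sqr gtr0_norm//; exact: divr_gt0.
have sst : tanh y - complex.Re c <= tanh 1 - complex.Re c.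
  by rewrite lerB// tanh_incr.
have ss := signed_sqrt_increment sst.
have ss0 := signed_sqrt_incr sst.
have ss2 : Num.sqrt (tanh 1 - complex.Re c - (tanh y - complex.Re c)) <= 2.
  by apply: sqrt_le_bound => //; move: ty t1; rewrite !ler_norml; lra.
have t0 : 0 < Num.sqrt `|tanh y - complex.Re c|.
  by rewrite sqrtr_gt0 normr_gt0 subr_eq0.
have tle : Num.sqrt `|tanh y - complex.Re c| <= 6 / 5.
  by apply: sqrt_le_bound => //; apply: le_trans (ler_normB _ _) _; lra.
have Wy : cnorm (W y) <= cnorm (W 1) + cnorm (W 1 - W y - c * reduced_source f q p *
    (clog c (tanh 1) - clog c (tanh y))) + cnorm c * cnorm (reduced_source f q p) *
    (cnorm (clog c (tanh 1)) + cnorm (clog c (tanh y))).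
  rewrite {1}(_ : W y = W 1 - (W 1 - W y - c * reduced_source f q p *
      (clog c (tanh 1) - clog c (tanh y))) - c * reduced_source f q p *
      (clog c (tanh 1) - clog c (tanh y))); last by ring.
  apply: le_trans (cnormB _ _) _; apply: lerD; first exact: cnormB.
  rewrite !cnormM; apply: ler_wpM2l (cnormB _ _).
  by apply: mulr_ge0; exact: cnorm_ge0.
have e1 : expR (- 1 / 2) <= 1 :> R by exact: (expRN_half_le1 ler01).
have e0 : 0 <= expR (- 1 / 2) :> R by exact: expR_ge0.
apply: le_trans Wy _.
move: (cnorm (W 1)) (cnorm (W 1 - _ - _)) (cnorm (reduced_source f q p))
  (cnorm (clog c (tanh 1))) (cnorm (clog c (tanh y)))
  (cnorm_ge0 (reduced_source f q p)) (cnorm_ge0 (clog c (tanh 1)))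
  (cnorm_ge0 (clog c (tanh y))) (expR (- 1 / 2)) far near src l1 ly e1 e0.
move: (signed_sqrt _ - signed_sqrt _) (Num.sqrt (_ - _)) ss ss0 ss2.
move: (Num.sqrt _) (Num.sqrt _) t10 t0 tle.
move=> s s1 ? ? ? d r ? ? ? n1' n2 n3 n4 n5 ? ? ? e ? ? ? ? ? ? ?.
have X0 : 0 <= K + cnorm (q 0) + M by rewrite addr_ge0// addr_ge0.
by apply: (@bound_arith C1 C2 (cnorm c) K (cnorm (q 0)) M s1 s d r n1' n2 n3 n4 n5 e).
Qed.

End Oscillation.

(** * The oscillation of q is small with c *)

Section OscillationSmall.
Context {R : realType}.
Implicit Types (f F q W : R -> R[i]) (c : R[i]) (a b x y z K M N X A : R).
Local Notation E := (@e1 R).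

Lemma oscillation_mono M N q : M <= N -> oscillation_le M q -> oscillation_le N q.
Proof.
move=> MN [h1 h2]; split.
  by move=> y; apply: le_trans (h1 y) _; rewrite ler_wpM2r ?expR_ge0.
by move=> y z y1 z1; apply: le_trans (h2 y z y1 z1) _; rewrite ler_wpM2r ?sqrtr_ge0.
Qed.

(** The inverse square root that bounds W is integrable in u, with the signed
    square root as primitive. *)
Lemma wronskian_holder f c q W A : wronskian_system f c q W -> 0 <= A ->
  (forall x, `|x| <= 1 -> tanh x != complex.Re c ->
    cnorm (W x) <= A / Num.sqrt `|tanh x - complex.Re c|) ->
  `|complex.Re c| <= 3 / 5 ->
  forall y z, `|y| <= 1 -> `|z| <= 1 ->
  cnorm (q y - q z) <= 8 * (E ^+ 4 * A) * Num.sqrt `|tanh y - tanh z|.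
Proof.
move=> [dq _ _] A0 WA a35.
have [p p1 pc] := tanh_surj a35.
have LA : 0 <= E ^+ 4 * A.
  by rewrite mulr_ge0// exprn_ge0// (le_trans ler01)// E_ge1.
have ordered y z : `|y| <= 1 -> `|z| <= 1 -> y <= z ->
    cnorm (q z - q y) <= 8 * (E ^+ 4 * A) * Num.sqrt (tanh z - tanh y).
  move=> y1 z1 yz.
  have := @cincrement_le_except _ q _
    (fun x => 2 * (E ^+ 4 * A) * signed_sqrt (tanh x - complex.Re c))
    (fun x => 2 * (E ^+ 4 * A) * (sech x ^+ 2 / (2 * Num.sqrt `|tanh x - complex.Re c|)))
    y z p yz (fun x _ => dq x).
  rewrite -mulrBr => H; apply: le_trans (H _ _ _) _.
  - by move=> x _; exact: contM (@cont_cst _ _ x) (@continuous_signed_sqrt_tanh _ _ x).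
  - move=> x _ xp.
    have xc : tanh x != complex.Re c by rewrite -pc; apply: contraNneq xp => /tanh_inj ->.
    exact: drvZ (drv_signed_sqrt_tanh xc).
  - move=> x xI xp; have x1 := itv_norm1 y1 z1 xI.
    have xc : tanh x != complex.Re c by rewrite -pc; apply: contraNneq xp => /tanh_inj ->.
    have t0 : 0 < Num.sqrt `|tanh x - complex.Re c|.
      by rewrite sqrtr_gt0 normr_gt0 subr_eq0.
    have := ler_pM (sqr_ge0 _) (cnorm_ge0 _) (cosh2_le_E x1) (WA x x1 xc).
    rewrite cnormM cnormR (ger0_norm (sqr_ge0 (cosh x))) => h; apply: le_trans h _.
    move: (sech x ^+ 2) (Num.sqrt _) t0 => s t t0.
    by rewrite le_eqVlt; apply/orP; left; apply/eqP; field; rewrite gt_eqF.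
  have ts : tanh y - complex.Re c <= tanh z - complex.Re c.
    by rewrite lerB// tanh_incr.
  have := ler_wpM2l LA (signed_sqrt_increment ts).
  rewrite (_ : tanh z - complex.Re c - (tanh y - complex.Re c) = tanh z - tanh y); last by ring.
  lra.
move=> y z y1 z1; have [yz|/ltW zy] := leP y z.
  by rewrite cnorm_distC distrC ger0_norm ?ordered// subr_ge0 tanh_incr.
by rewrite ger0_norm ?ordered// subr_ge0 tanh_incr.
Qed.

(** One turn of the bootstrap: the oscillation of q controls the source of W, hence
    W, hence the oscillation of q again, now with a factor |c|. *)
Lemma oscillation_step : exists2 C, 0 <= C & forall f c q W K M,
  admissible K f -> wronskian_system f c q W -> complex.Im c != 0 ->
  cnorm c <= 1 / 4 -> 0 <= M -> oscillation_le M q ->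
  oscillation_le (C * (cnorm c * (K + cnorm (q 0) + M))) q.
Proof.
have [C1 C10 nearP] := @wronskian_bound R; have [C2 C20 farP] := @far_wronskian R.
have L0 : 0 <= E ^+ 4 by rewrite exprn_ge0// (le_trans ler01)// E_ge1.
exists (8 * (E ^+ 4 * C1) + C2).
  by apply: addr_ge0 => //; rewrite mulr_ge0// mulr_ge0.
move=> f c q W K M fa sys ci c4 M0 osc.
have K0 : 0 <= K by case: fa.
have Y0 : 0 <= cnorm c * (K + cnorm (q 0) + M).
  by rewrite mulr_ge0 ?cnorm_ge0// !addr_ge0// cnorm_ge0.
have CY0 := mulr_ge0 C10 Y0; have C2Y0 := mulr_ge0 C20 Y0.
have LCY0 := mulr_ge0 L0 CY0.
have a35 : `|complex.Re c| <= 3 / 5.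
  by apply: le_trans (cnorm_ge_Re _) _; lra.
have hold := wronskian_holder sys CY0
  (fun t h1 h2 => nearP _ _ _ _ _ _ _ fa sys ci c4 M0 osc h1 h2) a35.
have W1 f' c' q' W' : admissible K f' -> wronskian_system f' c' q' W' ->
    cnorm c' = cnorm c -> q' 0 = q 0 -> oscillation_le M q' ->
    forall x, 1 <= x -> cnorm (W' x) <= C2 * (cnorm c * (K + cnorm (q 0) + M)).
  move=> fa' sys' c'c q'0 osc' x x1.
  have N0 : 0 <= cnorm (q' 0) + M by rewrite addr_ge0 ?cnorm_ge0.
  have c'4 : cnorm c' <= 1 / 4 by rewrite c'c.
  have := farP _ _ _ _ _ _ _ fa' sys' c'4 N0 (fun y => oscillation_bound y M0 osc') x1.
  rewrite c'c q'0 addrA => h; apply: le_trans h _; apply: ler_piMr => //.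
  by apply: expRN_half_le1; apply: le_trans x1.
have n1 : `|1 : R| <= 1 by rewrite normr1.
have n0 : `|0 : R| <= 1 by rewrite normr0.
have sq1 y : Num.sqrt `|tanh y - tanh 0| <= 1 :> R.
  by apply: sqrt_le_bound => //; rewrite tanh0 subr0 expr1n ltW// tanh_lt1.
have e1y y : 1 <= expR (2 * `|y|) :> R by exact: expR2_ge1.
move: (cnorm c * (K + cnorm (q 0) + M)) Y0 CY0 C2Y0 LCY0 hold W1 => Y Y0 CY0 C2Y0 LCY0 hold W1.
have le0 y : `|y| <= 1 -> cnorm (q y - q 0) <= 8 * (E ^+ 4 * (C1 * Y)).
  move=> y1; apply: le_trans (hold _ _ y1 n0) _; apply: ler_piMr => //.
  by rewrite mulr_ge0.
split; last first.
  move=> y z y1 z1; apply: le_trans (hold y z y1 z1) _; apply: ler_wpM2r.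
    exact: sqrtr_ge0.
  by lra.
have far q' (W' : R -> R[i]) f' c' y : wronskian_system f' c' q' W' -> q' 0 = q 0 ->
    (forall x, 1 <= x -> cnorm (W' x) <= C2 * Y) ->
    cnorm (q' 1 - q 0) <= 8 * (E ^+ 4 * (C1 * Y)) -> 1 <= y ->
    cnorm (q' y - q 0) <= (8 * (E ^+ 4 * C1) + C2) * Y * expR (2 * `|y|).
  move=> sys' q'0 W'b q'1 y1.
  have -> : q' y - q 0 = (q' y - q' 1) + (q' 1 - q 0) by ring.
  apply: le_trans (cnormD _ _) _.
  have g := expR2_growth sys' C2Y0 ler01 W'b y1.
  have : 8 * (E ^+ 4 * (C1 * Y)) <= 8 * (E ^+ 4 * (C1 * Y)) * expR (2 * `|y|).
    by apply: ler_peMr; [exact: mulr_ge0|exact: e1y].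
  have -> : `|y| = y by rewrite ger0_norm// (le_trans ler01).
  lra.
move=> y; have [y1|y1] := leP `|y| 1.
  have : 0 <= (8 * (E ^+ 4 * C1) + C2) * Y by lra.
  by move=> /ler_peMr /(_ (e1y y)); have := le0 y y1; lra.
have [y0|y0] := leP 0 y.
  apply: (far _ _ _ _ _ sys) => //; last by move: y1; rewrite ger0_norm//; lra.
  - exact: W1 fa sys _ _ osc.
  - exact: le0.
rewrite -normrN -[in X in cnorm X](opprK y).
apply: (far _ _ _ _ (- y) (wronskian_system_opp sys)); rewrite ?oppr0//.
- apply: W1 (admissible_opp fa) (wronskian_system_opp sys) _ _ (oscillation_opp osc).
    exact: cnormN.
  by rewrite oppr0.
- by apply: le0; rewrite normrN.
- by move: y1; rewrite ltr0_norm//; lra.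
Qed.

Lemma le_of_halving (v A B : R) : (forall n, v <= A + B / 2 ^+ n) -> v <= A.
Proof.
move=> H; apply/ler_addgt0Pr => e e0.
have cv : A + B / 2 ^+ n @[n --> \oo] --> A.
  rewrite -[X in _ --> X]addr0; apply: cvgD; first exact: cvg_cst.
  rewrite -[X in _ --> X](mulr0 B); apply: cvgM; first exact: cvg_cst.
  under eq_fun do rewrite -exprVn.
  by apply: cvg_expr; rewrite ger0_norm ?invr_ge0// invf_lt1// ltr1n.
have := cvg_lim (@Rhausdorff R) cv => lE.
have le : v <= A.
  rewrite -lE; apply: limr_ge; first by apply/cvg_ex; exists A.
  by apply: nearW.
by rewrite ler_wpDr// ltW.
Qed.

(** Once 2 C |c| <= 1, each turn of the bootstrap halves the part of the bound
    inherited from the previous one, so that M disappears in the limit. *)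
Lemma oscillation_small : exists2 C, 0 <= C & forall f c q W K,
  admissible K f -> wronskian_system f c q W -> complex.Im c != 0 ->
  cnorm c <= 1 / 4 -> 2 * (C * cnorm c) <= 1 ->
  oscillation_le (2 * (C * (cnorm c * (K + cnorm (q 0))))) q.
Proof.
have [C C0 stepP] := oscillation_step; exists C => // f c q W K fa sys ci c4 Cc.
have [M M0 osc] := oscillation_finite sys.
have K0 : 0 <= K by case: fa.
have kc := mulr_ge0 C0 (cnorm_ge0 c).
have S0 : 0 <= C * (cnorm c * (K + cnorm (q 0))).
  by rewrite mulr_ge0// mulr_ge0 ?cnorm_ge0// addr_ge0// cnorm_ge0.
have iter n : oscillation_le
    (2 * (C * (cnorm c * (K + cnorm (q 0)))) + M / 2 ^+ n) q.
  elim: n => [|n IH].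
    by apply: oscillation_mono osc; rewrite expr0 divr1; lra.
  have Mn : 0 <= M / 2 ^+ n by rewrite divr_ge0// exprn_ge0.
  have IH0 : 0 <= 2 * (C * (cnorm c * (K + cnorm (q 0)))) + M / 2 ^+ n.
    by apply: addr_ge0 => //; exact: mulr_ge0.
  have := stepP _ _ _ _ _ _ fa sys ci c4 IH0 IH; apply: oscillation_mono.
  have -> : M / 2 ^+ n.+1 = 1 / 2 * (M / 2 ^+ n).
    by rewrite exprS; field; rewrite expf_neq0.
  move: (M / 2 ^+ n) Mn => m m0.
  have e Z : C * (cnorm c * (K + cnorm (q 0) + Z)) =
      C * (cnorm c * (K + cnorm (q 0))) + C * cnorm c * Z by ring.
  rewrite e; move: (C * (cnorm c * (K + cnorm (q 0)))) S0 => S S0.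
  have kc2 : C * cnorm c <= 1 / 2 by lra.
  have := ler_wpM2r (addr_ge0 (mulr_ge0 (ler0n _ 2) S0) m0) kc2.
  lra.
split=> [y|y z y1 z1].
  apply: (@le_of_halving _ _ (M * expR (2 * `|y|))) => n.
  by have [h _] := iter n; rewrite [M * _ / _]mulrAC -mulrDl; exact: h.
apply: (@le_of_halving _ _ (M * Num.sqrt `|tanh y - tanh z|)) => n.
by have [_ h] := iter n; rewrite [M * _ / _]mulrAC -mulrDl; exact: h.
Qed.

End OscillationSmall.

(** * The solution phi_1 at c = 0 *)

Section RegularSolution.
Context {R : realType}.
Implicit Types (a b x y z k : R).

Lemma continuous_agree_right (h : R -> R) : {for 0, continuous h} ->
  (forall t, 0 < t -> t <= 1 -> h t = 0) -> h 0 = 0.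
Proof.
move=> ch h0.
have l1 : h t @[t --> 0^'+] --> h 0 by exact: cvg_at_right_filter ch.
have l2 : h t @[t --> 0^'+] --> (0 : R).
  apply: cvg_near_cst; near=> t; apply: h0.
  - by near: t; exact: nbhs_right_gt.
  - by near: t; apply: nbhs_right_le; exact: ltr01.
exact: (cvg_unique _ l1 l2).
Unshelve. all: by end_near. Qed.

Lemma constant_on (F F' : R -> R) a b : a <= b ->
  (forall x, a <= x <= b -> is_derive x 1 F (F' x)) ->
  (forall x, a <= x <= b -> F' x = 0) -> F a = F b.
Proof.
move=> ab dF F0; have h : forall x, a <= x <= b -> `|F' x| <= 0.
  by move=> x xI; rewrite F0// normr0.
have := @increment_le _ F F' (fun=> 0) (fun=> 0) a b ab dF
  (fun x _ => is_derive_cst (0 : R) x (1 : R)) h.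
by rewrite subrr normr_le0 subr_eq0 => /eqP.
Qed.

Lemma phi1_continuous (phi1 : R -> R -> R) : is_phi1 phi1 -> continuous (phi1^~ 0).
Proof.
move=> [c _] y.
have op : open [set p : R * R | -1 < p.2 < 1].
  have -> : [set p : R * R | -1 < p.2 < 1] = snd @^-1` `]-1, 1[%classic.
    by apply/seteqP; split => p /=; rewrite in_itv.
  by apply: open_comp => [p _|]; [exact: cvg_snd|exact: interval_open].
have c0 : {for (y, 0), continuous (fun p : R * R => phi1 p.1 p.2)}.
  move: c; rewrite continuous_open_subspace//; apply.
  by rewrite inE /= oppr_lt0 ltr01.
exact: (@continuous2_cvg R R R R (nbhs y) _ id (fun=> 0) phi1 y 0 c0
  (@cvg_id _ _) (@cvg_cst _ _ _ _ _)).
Qed.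

(** Let B be the outer integrand in the equation of phi_1 and A the inner integral,
    so that p' = B and A = tanh^2 B. The function G = tanh p + A - sinh satisfies
    G' = G / tanh away from 0, hence is a multiple of sinh on each half-line; the
    multiple is 0 because G' vanishes at 0. Then G' = 0 says that
    (sinh p)' = cosh^2. *)
Lemma phi1_formula (phi1 : R -> R -> R) y : is_phi1 phi1 ->
  sinh y * phi1 y 0 = (y + sinh y * cosh y) / 2.
Proof.
move=> hphi; have cp := phi1_continuous hphi; have [_ eqn] := hphi.
set p := phi1^~ 0 in cp *.
have pE x : p x = 1 + oriented_integral 0 x (fun z =>
    oriented_integral 0 z (fun w => tanh w ^+ 2 * p w) / tanh z ^+ 2).
  rewrite /p eqn ?crit0 ?oppr_lt0 ?ltr01//.
  congr (1 + oriented_integral _ _ _); apply/funext => z; rewrite subr0.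
  by congr (oriented_integral _ _ _ / _); apply/funext => w; rewrite subr0.
have ct2 : continuous (fun w : R => tanh w ^+ 2).
  by move=> w; exact: contM (drv_cont (drv_tanh w)) (drv_cont (drv_tanh w)).
have cg : continuous (fun w => tanh w ^+ 2 * p w).
  by move=> w; exact: contM (ct2 w) (cp w).
pose A z := oriented_integral 0 z (fun w => tanh w ^+ 2 * p w).
have dA z : is_derive z 1 A (tanh z ^+ 2 * p z) by exact: drv_oriented_integral.
have A0 : A 0 = 0 by exact: oriented_integral_point.
pose B z := A z / tanh z ^+ 2.
have B0 : B 0 = 0 by rewrite /B A0 mul0r.
have [P P0 pP] : exists2 P : R, 0 <= P & forall x, `|x| <= 1 -> `|p x| <= P.
  have cn : {within `[-1, 1], continuous (fun x => `|p x|)}.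
    apply: continuous_subspaceT => x.
    by apply: (@cont_norm _ p); exact: cp.
  have [|c _ cP] := EVT_max _ cn; first by lra.
  by exists `|p c| => // x; rewrite ler_norml => x1; apply: cP; rewrite in_itv.
have t2le x z : `|x| <= `|z| -> tanh x ^+ 2 <= tanh z ^+ 2 :> R.
  have th (t : R) : tanh t ^+ 2 = tanh `|t| ^+ 2.
    have [t0|t0] := leP 0 t; first by rewrite ger0_norm.
    by rewrite ltr0_norm// tanhN sqrrN.
  rewrite (th x) (th z) => xz; rewrite lerXn2r ?nnegrE ?tanh_incr//.
    by rewrite -tanh0 tanh_incr.
  by rewrite -tanh0 tanh_incr.
(* tanh^2 is increasing in |z|, so that the integrand is at most P tanh^2 z; this
   bound makes B continuous at 0, where its formula has the value 0 / 0 = 0. *)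
have Bb z : `|z| <= 1 -> `|B z| <= P * `|z|.
  move=> z1; have [->|z0] := eqVneq z 0; first by rewrite B0 !normr0 mulr0.
  have tz : 0 < tanh z ^+ 2 by rewrite lt_def sqr_ge0 expf_neq0// tanh_neq0.
  rewrite /B normrM normfV (gtr0_norm tz) ler_pdivrMr//.
  have inc a b : a <= b -> (forall x, a <= x <= b -> `|x| <= `|z|) ->
      `|A b - A a| <= P * tanh z ^+ 2 * b - P * tanh z ^+ 2 * a.
    move=> ab xz; apply: (@increment_le _ A (fun x => tanh x ^+ 2 * p x)
      (fun x => P * tanh z ^+ 2 * x) (fun=> P * tanh z ^+ 2) a b ab
      (fun x _ => dA x) (fun x _ => drv_linear _ x)) => x /xz xz'.
    rewrite normrM ger0_norm ?sqr_ge0// mulrC.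
    by apply: ler_pM => //; [exact: sqr_ge0|exact/pP/(le_trans xz')|exact: t2le].
  have [z0'|z0'] := leP 0 z.
    have := inc 0 z z0'; rewrite A0 subr0 mulr0 subr0 (ger0_norm z0').
    rewrite mulrAC; apply => x /andP[x0 xz]; by rewrite ger0_norm.
  have := inc z 0 (ltW z0'); rewrite A0 sub0r normrN mulr0 sub0r (ltr0_norm z0').
  rewrite (_ : P * - z * tanh z ^+ 2 = - (P * tanh z ^+ 2 * z)); last by ring.
  apply => x /andP[xz x0].
  by rewrite ler0_norm// lerN2.
have cB : continuous B.
  move=> z; have [->|z0] := eqVneq z 0; last first.
    apply: contM (drv_cont (dA z)) (contV _ (ct2 z)).
    by rewrite expf_neq0// tanh_neq0.
  apply/cvgrPdist_le => e e0; near=> t.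
  rewrite B0 sub0r normrN; apply: le_trans (Bb t _) _.
    near: t; exists 1 => //= t; rewrite /= sub0r normrN; exact: ltW.
  have : `|t| <= e / (P + 1).
    near: t; exists (e / (P + 1)) => /=; first by rewrite divr_gt0// ltr_wpDl.
    by move=> t /=; rewrite sub0r normrN; exact: ltW.
  rewrite ler_pdivlMr ?ltr_wpDl//; have := normr_ge0 t; nra.
have dp x : is_derive x 1 p (B x).
  apply: (@drv_ext _ (fun x => 1 + oriented_integral 0 x B)) => [z|].
    by rewrite [RHS]pE.
  have := drvD (is_derive_cst (1 : R) x (1 : R)) (drv_oriented_integral 0 x cB).
  by rewrite add0r.
have p0 : p 0 = 1 by rewrite pE oriented_integral_point addr0.
pose G x := tanh x * p x + A x - sinh x.
pose Gp x := p x + tanh x * B x - cosh x.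
have dG x : is_derive x 1 G (Gp x).
  apply: (drv_eq (drvB (drvD (drvM (drv_tanh x) (dp x)) (dA x)) (drv_sinh x))).
  by rewrite sech2E /Gp; ring.
have GpE x : x != 0 -> Gp x = G x / tanh x.
  by move=> /tanh_neq0 t0; rewrite /Gp /G /B sinhE; field.
have cGp : continuous Gp.
  move=> x; apply: contB (drv_cont (drv_cosh x)).
  exact: contD (cp x) (contM (drv_cont (drv_tanh x)) (cB x)).
have Gp0 : Gp 0 = 0 by rewrite /Gp p0 tanh0 mul0r cosh0 addr0 subrr.
have sinh_neq0 (x : R) : x != 0 -> sinh x != 0.
  by move=> x0; rewrite sinhE mulf_neq0 ?tanh_neq0 ?cosh_neq0.
have ratio a b : a <= b -> (forall x, a <= x <= b -> x != 0) ->
    G a / sinh a = G b / sinh b.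
  move=> ab n0.
  apply: (@constant_on (fun x => G x / sinh x) (fun x => Gp x * (sinh x)^-1 +
     G x * (- cosh x / sinh x ^+ 2)) a b ab).
    by move=> x /n0/sinh_neq0 s0; apply: drvM (dG x) (drvV s0 (drv_sinh x)).
  move=> x /n0 x0; rewrite GpE// sinhE; have := tanh_neq0 x0.
  by have := cosh_neq0 x => c0 t0; field; rewrite c0.
have Gz x : x != 0 -> Gp x = 0.
  move=> x0; pose k := G x / sinh x.
  (* G = k sinh between 0 and x, so that G' = k cosh there; let t tend to 0. *)
  have kt t : 0 < t -> t <= 1 -> Gp (t * x) - k * cosh (t * x) = 0.
    move=> t0 t1.
    have tx0 : t * x != 0 by rewrite mulf_neq0// gt_eqF.
    have -> : k = G (t * x) / sinh (t * x).
      rewrite /k; have [xp|xn|xe] := ltgtP 0 x; last by rewrite -xe eqxx in x0.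
        apply/esym/ratio; first by rewrite ler_piMl// ltW.
        by move=> z /andP[tz _]; rewrite gt_eqF// (lt_le_trans _ tz)// mulr_gt0.
      apply: ratio; first by rewrite ler_niMl// ltW.
      by move=> z /andP[_ zt]; rewrite lt_eqF// (le_lt_trans zt)// nmulr_llt0.
    rewrite GpE// sinhE; have := tanh_neq0 tx0; have := cosh_neq0 (t * x) => c0 t0'.
    by field; rewrite c0.
  have ctx (t : R) : {for t, continuous (fun t : R => t * x)}.
    exact: drv_cont (drvM (is_derive_id t (1 : R)) (is_derive_cst x t (1 : R))).
  have ch : {for 0, continuous (fun t : R => Gp (t * x) - k * cosh (t * x))}.
    apply: contB.
      by apply: (@continuous_comp _ _ _ (fun t : R => t * x) Gp); [exact: ctx|exact: cGp].
    apply: contM (@cont_cst _ k 0) _.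
    apply: (@continuous_comp _ _ _ (fun t : R => t * x) cosh); first exact: ctx.
    exact: drv_cont (drv_cosh _).
  have := continuous_agree_right ch kt.
  rewrite mul0r Gp0 cosh0 mulr1 sub0r => /eqP; rewrite oppr_eq0 => /eqP k0.
  by rewrite GpE// -[G x](divfK (sinh_neq0 _ x0)) -/k k0 !mul0r.
have Gpz x : Gp x = 0 by have [->|/Gz] := eqVneq x 0.
pose H x := sinh x * p x - (x + sinh x * cosh x) / 2.
have dH x : is_derive x 1 H 0.
  have d := drvB (drvM (drv_sinh x) (dp x))
    (drvM (drvD (is_derive_id x (1 : R)) (drvM (drv_sinh x) (drv_cosh x)))
      (is_derive_cst (2^-1 : R) x (1 : R))).
  apply: (drv_eq d); have := Gpz x; rewrite /Gp => e.
  rewrite /cst mulr0 addr0 -!expr2.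
  have -> : sinh x ^+ 2 = cosh x ^+ 2 - 1 by have := cosh2Bsinh2 x; lra.
  rewrite sinhE; have -> : p x = cosh x - tanh x * B x by lra.
  by field.
have := constant_of_drv0 dH y 0; rewrite /H sinh0 !mul0r addr0 mul0r subrr.
by move/eqP; rewrite subr_eq0 => /eqP.
Unshelve. all: by end_near. Qed.

End RegularSolution.

(** * Integrals over half-lines of exponentially small functions *)

Section Tails.
Context {R : realType}.
Notation mu := (@lebesgue_measure R).
Implicit Types (h : R -> R) (e x y z C : R).

Lemma continuous_exp_half C x : {for x, continuous (fun x : R => C * expR (- x / 2))}.
Proof. exact: contM (@cont_cst _ C x) (drv_cont (drv_exp_half x)). Qed.

Lemma exp_tail_integral C e : 0 <= C ->
  (\int[mu]_(x in `[e, +oo[) (C * expR (- x / 2))%:E = (2 * C * expR (- e / 2))%:E)%E.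
Proof.
move=> C0; pose F x : R := - 2 * C * expR (- x / 2).
have dF x : is_derive x 1 F (C * expR (- x / 2)).
  by apply: (drv_eq (drvZ (- 2 * C) (drv_exp_half x))); field.
rewrite (@ge0_continuous_FTC2y _ _ F e 0).
- by rewrite sub0e -EFinN /F !mulNr opprK.
- by move=> x _; rewrite mulr_ge0 ?expR_ge0.
- by apply: continuous_subspaceT => x; exact: continuous_exp_half.
- rewrite -[X in _ --> X](mulr0 (- 2 * C)); apply: cvgM; first exact: cvg_cst.
  apply/cvgrPdist_le => d d0; near=> x; rewrite sub0r normrN ger0_norm ?expR_ge0//.
  have x0 : 0 <= x by near: x; exact: nbhs_pinfty_ge.
  rewrite mulNr expRN invf_ple ?posrE ?expR_gt0//.
  apply: le_trans (expR_ge1Dx _).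
  have : 2 * d^-1 <= x by near: x; apply: nbhs_pinfty_ge; rewrite num_real.
  by lra.
- by move=> x _; case: (dF x).
- exact: cvg_at_right_filter (drv_cont (dF e)).
- by move=> x _; rewrite derive1E; case: (dF x).
Unshelve. all: by end_near. Qed.

Definition tail_dominated h e C :=
  0 <= C /\ forall x, e <= x -> {for x, continuous h} /\ `|h x| <= C * expR (- x / 2).

Lemma tail_measurable h e : (forall x, e <= x -> {for x, continuous h}) ->
  measurable_fun `[e, +oo[ h.
Proof.
move=> ch; apply: subspace_continuous_measurable_fun => //.
apply: continuous_in_subspaceT => x; rewrite inE /= in_itv /= andbT; exact: ch.
Qed.

Lemma exp_tail_integrable C e : 0 <= C ->
  mu.-integrable `[e, +oo[ (EFin \o (fun x => C * expR (- x / 2))).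
Proof.
move=> C0; apply/integrableP; split.
  apply/measurable_EFinP; apply: tail_measurable => x _; exact: continuous_exp_half.
under eq_integral do rewrite /= ger0_norm ?mulr_ge0 ?expR_ge0//.
by rewrite exp_tail_integral// ltry.
Qed.

Lemma tail_integrable h e C : tail_dominated h e C ->
  mu.-integrable `[e, +oo[ (EFin \o h).
Proof.
move=> [C0 hC]; apply: le_integrable (exp_tail_integrable e C0) => //.
  by apply/measurable_EFinP; apply: tail_measurable => x /hC[].
move=> x; rewrite /= in_itv /= andbT => /hC[_ h1]; rewrite lee_fin.
by apply: le_trans h1 _; exact: ler_norm.
Qed.

Lemma itv_oy_sub_cy e : `]e, +oo[%classic `<=` (`[e, +oo[%classic : set R).
Proof. by move=> x; rewrite /= !in_itv /= !andbT; exact: ltW. Qed.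

Lemma tail_bound h e C : tail_dominated h e C ->
  `|\int[mu]_(x in `]e, +oo[) h x| <= 2 * C * expR (- e / 2).
Proof.
move=> hC; have ih := tail_integrable hC; have [C0 hb] := hC.
rewrite Rintegral_itv_obnd_cbnd; last first.
  by apply: integrableS ih => //; exact: itv_oy_sub_cy.
apply: le_trans (le_normr_Rintegral _ ih) _ => //.
have -> : 2 * C * expR (- e / 2) = \int[mu]_(x in `[e, +oo[) (C * expR (- x / 2)).
  by rewrite /Rintegral exp_tail_integral.
apply: le_Rintegral => //.
- exact: (integrable_norm ih).
- exact: exp_tail_integrable.
- by move=> x; rewrite /= in_itv /= andbT => /hb[].
Qed.

Lemma drv_tail h y : 0 < y -> (forall e, 0 < e -> exists C, tail_dominated h e C) ->
  is_derive y 1 (fun z => \int[mu]_(x in `]z, +oo[) h x) (- h y).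
Proof.
move=> y0 hd; pose a := y / 2.
have a0 : 0 < a by rewrite divr_gt0.
have ay : a < y by rewrite /a; lra.
have [C hC] := hd a a0; have ih := tail_integrable hC.
have ia : mu.-integrable `]a, +oo[ (EFin \o h).
  by apply: integrableS ih => //; exact: itv_oy_sub_cy.
have [d e] : derivable (fun z => \int[mu]_(t in `]a, z]) h t) y 1 /\
    derive1 (fun z => \int[mu]_(t in `]a, z]) h t) y = h y.
  apply: (@continuous_FTC1 _ h (BRight a) y (y + 1)).
  - by rewrite ltrDl.
  - by apply: integrableS ia => //; exact: subset_itvl.
  - exact: ay.
  - by have [_ /(_ y (ltW ay))[]] := hC.
have hd' : is_derive y 1 (fun z => \int[mu]_(t in `]a, z]) h t) (h y).
  by apply: (DeriveDef d); rewrite -derive1E.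
have := drvB (is_derive_cst (\int[mu]_(x in `]a, +oo[) h x) y (1 : R)) hd'.
rewrite sub0r; apply: near_eq_is_derive.
apply: filterS (lt_nbhsr ay) => z az.
by rewrite /cst (Rintegral_itvB ia)// bnd_simp ltW.
Qed.

(** The change of variables x -> - x, applied to the positive and the negative
    parts of h. *)
Lemma tail_reflect h e C : 0 < e -> tail_dominated h e C ->
  tail_dominated (fun x => h (- x)) e C ->
  mu.-integrable `]-oo, (- e)] (EFin \o h) /\
  \int[mu]_(x in `]-oo, (- e)]) h x = \int[mu]_(x in `[e, +oo[) h (- x).
Proof.
move=> e0 _ [C0 hC].
have cont x : x <= - e -> {for x, continuous h}.
  move=> xe; have [] := hC (- x) ltac:(lra) => ch _.
  have : {for x, continuous (fun z => h (- - z))}.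
    apply: (@continuous_comp R R R (fun z => - z) (fun z => h (- z)) x).
      exact: opp_continuous.
    exact: ch.
  by apply: cont_ext => z; rewrite opprK.
have subst (G : R -> R) : (forall x, x <= - e -> {for x, continuous G}) ->
    (forall x, x <= - e -> 0 <= G x) ->
    (\int[mu]_(x in `]-oo, (- e)%R]) (G x)%:E =
    \int[mu]_(x in `[e, +oo[) (G (- x))%:E)%E.
  move=> cG G0; rewrite ge0_integration_by_substitutionNy//.
    by apply: continuous_in_subspaceT => x; rewrite inE /= in_itv /=; exact: cG.
  by move=> x; rewrite in_itv /= => /ltW; exact: G0.
have meas (k : R -> R) : (forall x, x <= - e -> {for x, continuous k}) ->
    measurable_fun `]-oo, (- e)] k.
  move=> ck; apply: subspace_continuous_measurable_fun => //.
  by apply: continuous_in_subspaceT => x; rewrite inE /= in_itv /=; exact: ck.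
have iC : mu.-integrable `]-oo, (- e)] (EFin \o (fun x => C * expR (x / 2))).
  have cE x : {for x, continuous (fun x : R => C * expR (x / 2))}.
    apply: contM (@cont_cst _ C x) _.
    apply: (@continuous_comp R R R (fun z => z / 2) (@expR R)); last exact: continuous_expR.
    exact: drv_cont (drvM (is_derive_id x (1 : R)) (is_derive_cst (2^-1 : R) x (1 : R))).
  apply/integrableP; split; first by apply/measurable_EFinP; exact: meas.
  under eq_integral do rewrite /= ger0_norm ?mulr_ge0 ?expR_ge0//.
  rewrite subst//; last by move=> x _; rewrite mulr_ge0 ?expR_ge0.
  by rewrite exp_tail_integral// ltry.
have bnd x : x <= - e -> `|h x| <= C * expR (x / 2).
  by move=> xe; have [_] := hC (- x) ltac:(lra); rewrite opprK.
have dom (k : R -> R) : (forall x, x <= - e -> {for x, continuous k}) ->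
    (forall x, x <= - e -> `|k x| <= `|h x|) ->
    mu.-integrable `]-oo, (- e)] (EFin \o k).
  move=> ck kh; apply: le_integrable iC => //.
    by apply/measurable_EFinP; exact: meas.
  move=> x; rewrite /= in_itv /= => xe; rewrite lee_fin.
  by apply: le_trans (kh x xe) _; apply: le_trans (bnd x xe) _; exact: ler_norm.
have ih : mu.-integrable `]-oo, (- e)] (EFin \o h) by exact: dom.
split => //.
pose hp x := (`|h x| + h x) / 2; pose hn x := (`|h x| - h x) / 2.
have cabs x : x <= - e -> {for x, continuous (fun x => `|h x|)}.
  by move=> xe; exact: cont_norm (cont x xe).
have chp x : x <= - e -> {for x, continuous hp}.
  by move=> xe; apply: contM (contD (cabs x xe) (cont x xe)) (@cont_cst _ _ x).
have chn x : x <= - e -> {for x, continuous hn}.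
  by move=> xe; apply: contM (contB (cabs x xe) (cont x xe)) (@cont_cst _ _ x).
have n1 x : h x <= `|h x| by exact: ler_norm.
have n2 x : - h x <= `|h x| by rewrite -normrN; exact: ler_norm.
have hp0 x : 0 <= hp x by have := n2 x; rewrite /hp; lra.
have hn0 x : 0 <= hn x by have := n1 x; rewrite /hn; lra.
have ihp : mu.-integrable `]-oo, (- e)] (EFin \o hp).
  apply: dom => // x xe; rewrite ger0_norm//.
  by have := n1 x; have := n2 x; rewrite /hp; lra.
have ihn : mu.-integrable `]-oo, (- e)] (EFin \o hn).
  apply: dom => // x xe; rewrite ger0_norm//.
  by have := n1 x; have := n2 x; rewrite /hn; lra.
have cop x : e <= x -> {for x, continuous (fun z => h (- z))} by move=> /hC[].
have cabso x : e <= x -> {for x, continuous (fun x => `|h (- x)|)}.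
  by move=> xe; exact: cont_norm (cop x xe).
have td1 : tail_dominated (fun x => hp (- x)) e C.
  split=> // x xe; split.
    exact: contM (contD (cabso x xe) (cop x xe)) (@cont_cst _ _ x).
  rewrite ger0_norm//; have [_] := hC x xe; have := n1 (- x); have := n2 (- x).
  by rewrite /hp; lra.
have td2 : tail_dominated (fun x => hn (- x)) e C.
  split=> // x xe; split.
    exact: contM (contB (cabso x xe) (cop x xe)) (@cont_cst _ _ x).
  rewrite ger0_norm//; have [_] := hC x xe; have := n1 (- x); have := n2 (- x).
  by rewrite /hn; lra.
have hE x : h x = hp x - hn x by rewrite /hp /hn; lra.
transitivity (\int[mu]_(x in `]-oo, (- e)]) (hp x - hn x)).
  by apply: eq_Rintegral => x _; exact: hE.
rewrite RintegralB//.
transitivity (\int[mu]_(x in `[e, +oo[) (hp (- x) - hn (- x))); last first.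
  by apply: eq_Rintegral => x _; rewrite hE.
rewrite (RintegralB _ (tail_integrable td1) (tail_integrable td2))//.
by congr (_ - _); rewrite /Rintegral subst.
Qed.

Lemma two_sided_tail h e C : 0 < e -> tail_dominated h e C ->
  tail_dominated (fun x => h (- x)) e C ->
  \int[mu]_(x in [set x | e < `|x - 0|]) h x =
  \int[mu]_(x in `]e, +oo[) h x + \int[mu]_(x in `]e, +oo[) h (- x).
Proof.
move=> e0 t1 t2; have [il eq] := tail_reflect e0 t1 t2.
have sE : [set x | e < `|x - 0|] = `]e, +oo[%classic `|` `]-oo, (- e)[%classic.
  apply/seteqP; split => x /=; rewrite !in_itv /= andbT subr0 ltr_normr.
    by case/orP => H; [left|right; rewrite ltrNr].
  by case => H; apply/orP; [left|right; rewrite ltrNr].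
have ir : mu.-integrable `]e, +oo[ (EFin \o h).
  by apply: integrableS (tail_integrable t1) => //; exact: itv_oy_sub_cy.
have il' : mu.-integrable `]-oo, (- e)[ (EFin \o h).
  apply: integrableS il => //; apply: subset_itvl; by rewrite bnd_simp.
have disj : [disjoint `]e, +oo[%classic & `]-oo, (- e)[%classic].
  apply/disj_setPS => x [/=]; rewrite !in_itv /= andbT => H1 H2.
  by have := lt_trans H1 H2; lra.
have iU : mu.-integrable (`]e, +oo[ `|` `]-oo, (- e)[) (EFin \o h).
  have mU : measurable_fun (`]e, +oo[ `|` `]-oo, (- e)[) (EFin \o h).
    apply/measurable_funU => //.
    by split; [exact: measurable_int ir|exact: measurable_int il'].
  apply/integrableP; split => //.
  rewrite ge0_integral_setU//=.
    have /integrableP[_ f1] := ir; have /integrableP[_ f2] := il'.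
    exact: lte_add_pinfty.
  apply/measurable_EFinP; apply: measurableT_comp => //; exact/measurable_EFinP.
rewrite sE Rintegral_setU//.
congr (_ + _); rewrite Rintegral_itv_bndo_bndc// eq Rintegral_itv_obnd_cbnd//.
by apply: integrableS (tail_integrable t2) => //; exact: itv_oy_sub_cy.
Qed.

End Tails.

(** * The two homogeneous solutions at c = 0 *)

Section Outer.
Context {R : realType}.
Notation mu := (@lebesgue_measure R).
Implicit Types (f F m : R -> R[i]) (e x y z A C K : R).

Lemma sinh_ge y : 0 <= y -> y <= sinh y.
Proof.
move=> y0; have := @nondecreasing_of_drv _ (fun x => sinh x - x) (fun x => cosh x - 1) 0 y y0.
rewrite sinh0 subrr subr_ge0; apply => x _.
- exact: contB (drv_cont (drv_sinh x)) (drv_cont (is_derive_id x (1 : R))).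
- exact: drvB (drv_sinh x) (is_derive_id x (1 : R)).
- by rewrite subr_ge0 cosh_ge1.
Qed.

(** The solution of phi'' - phi + 2 sech^2 phi = 0 with phi 0 = 0 and
    phi' 0 = 1; sech is the other solution and their Wronskian is 1. *)
Definition odd_mode y : R := (y + sinh y * cosh y) / 2 * sech y.

Lemma odd_modeN y : odd_mode (- y) = - odd_mode y.
Proof. by rewrite /odd_mode sinhN coshN sechN; ring. Qed.

Lemma odd_mode_ge y : 0 <= y -> sinh y / 2 <= odd_mode y.
Proof.
move=> y0; rewrite /odd_mode; have e := cosh_sech y; have s0 := sech_gt0 y.
have : 0 <= y * sech y by rewrite mulr_ge0// ltW.
have -> : (y + sinh y * cosh y) / 2 * sech y =
  y * sech y / 2 + sinh y * (cosh y * sech y) / 2 by field.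
by rewrite e; lra.
Qed.

Lemma odd_mode_gt0 y : 0 < y -> 0 < odd_mode y.
Proof.
move=> y0; apply: lt_le_trans (odd_mode_ge (ltW y0)).
by have := sinh_ge (ltW y0); lra.
Qed.

Lemma odd_mode_neq0 y : y != 0 -> odd_mode y != 0.
Proof.
have [/odd_mode_gt0/lt0r_neq0//|y0 _|//] := ltgtP 0 y.
by rewrite -[y]opprK odd_modeN oppr_eq0 lt0r_neq0// odd_mode_gt0// oppr_gt0.
Qed.

Lemma drv_odd_mode y :
  is_derive y 1 odd_mode (cosh y - tanh y * odd_mode y).
Proof.
have d := drvM (drvM (drvD (is_derive_id y (1 : R)) (drvM (drv_sinh y) (drv_cosh y)))
  (is_derive_cst (2^-1 : R) y (1 : R))) (drv_sech y).
apply: (drv_eq d); rewrite /odd_mode /cst.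
have c2 : sinh y * sinh y = cosh y * cosh y - 1 by have := cosh2Bsinh2 y; lra.
have e := cosh_sech y.
transitivity ((1 + (cosh y * cosh y + sinh y * sinh y)) / 2 * sech y -
  tanh y * ((y + sinh y * cosh y) / 2 * sech y)); first by field.
rewrite c2; congr (_ - _).
transitivity (cosh y * (cosh y * sech y)); last by rewrite e mulr1.
by field.
Qed.

(** The quotient of two solutions with Wronskian 1. Since tanh * phi_1 is the odd
    mode, this exhibits a primitive of the weight in the principal value. *)
Lemma drv_mode_ratio y : y != 0 ->
  is_derive y 1 (fun x => sech x / odd_mode x) (- (odd_mode y ^+ 2)^-1).
Proof.
move=> /odd_mode_neq0 y0; have e := cosh_sech y.
apply: (drv_eq (drvM (drv_sech y) (drvV y0 (drv_odd_mode y)))).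
transitivity (- (cosh y * sech y) / odd_mode y ^+ 2); last by rewrite e mulN1r.
by field.
Qed.

Lemma mode_ratio_bound y : 0 < y ->
  0 <= sech y / odd_mode y <= 4 * expR (- 2 * y) / (1 - expR (- 2 * y)) * 2.
Proof.
move=> y0; have o0 := odd_mode_gt0 y0; have s0 := sech_gt0 y.
apply/andP; split; first by rewrite divr_ge0// ltW.
have se := sech_le_expN y; rewrite (gtr0_norm y0) in se.
have oe := odd_mode_ge (ltW y0).
have E : expR (- y) = expR (- 2 * y) * expR y by rewrite -expRD; congr expR; ring.
have e1 : expR (- 2 * y) < 1 by rewrite expR_lt1; lra.
rewrite ler_pdivrMr//; apply: le_trans se _.
rewrite E; have : sinh y = expR y * (1 - expR (- 2 * y)) / 2.
  by rewrite /sinh E; ring.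
move=> si; rewrite si in oe.
have d0 : 0 < 1 - expR (- 2 * y) by rewrite subr_gt0.
have x0 := expR_gt0 y; have w0 := expR_gt0 (- 2 * y).
move: (expR (-2 * y)) (expR y) d0 x0 w0 oe => w v d0 x0 w0 oe.
have k0 : 0 <= 4 * w / (1 - w) * 2.
  by apply: mulr_ge0 => //; rewrite divr_ge0 ?(ltW d0)// mulr_ge0// ltW.
apply: le_trans (ler_wpM2l k0 oe).
have -> : 4 * w / (1 - w) * 2 * (v * (1 - w) / 2 / 2) = 2 * (w * v).
  by field; rewrite gt_eqF.
by [].
Qed.

Section Moments.
Context (p : R -> R) (f : R -> R[i]) (A : R) (cp : continuous p) (cf : continuous f)
  (pE : forall y, sinh y * p y = (y + sinh y * cosh y) / 2)
  (A0 : 0 <= A) (fA : forall y, cnorm (f y) <= A * expR (`|y| / 2)).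

Lemma mode_factor y : tanh y * p y = odd_mode y.
Proof.
rewrite /odd_mode -pE sinhE; have := cosh_sech y => e.
by transitivity (tanh y * (cosh y * sech y) * p y); [rewrite e mulr1|ring].
Qed.

Lemma p_even y : p (- y) = p y.
Proof.
have [->|y0] := eqVneq y 0; first by rewrite oppr0.
have t0 := tanh_neq0 y0; apply: (mulfI t0).
by rewrite mode_factor -[LHS]opprK -mulNr -tanhN mode_factor odd_modeN opprK.
Qed.

Lemma p_bound y : `|p y| <= cosh y.
Proof.
wlog y0 : y / 0 <= y.
  move=> h; have [/h//|y0] := leP 0 y.
  by rewrite -p_even -coshN h// oppr_ge0 ltW.
(* At 0 the formula for p is void, and the bound follows by continuity. *)
have cpc : {for 0, continuous (fun y => cosh y - `|p y|)}.
  apply: contB (drv_cont (drv_cosh 0)) _.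
  by apply: (@cont_norm _ p); exact: cp.
have pos (x : R) : 0 < x -> 0 <= cosh x - `|p x|.
  move=> x0; have sx := sinh_ge (ltW x0); have s0 : 0 < sinh x by lra.
  rewrite subr_ge0 -(ler_pM2l s0) -{1}(gtr0_norm s0) -normrM pE.
  have c1 := cosh_ge1 x.
  have sc : 0 <= sinh x * cosh x by rewrite mulr_ge0 ?(ltW s0) ?(ltW (cosh_gt0 x)).
  rewrite (@ger0_norm _ ((x + sinh x * cosh x) / 2)); last by lra.
  by have := ler_wpM2l (ltW s0) c1; lra.
rewrite -subr_ge0; move: y0; rewrite le_eqVlt => /predU1P[<-|]; last exact: pos.
have l1 : cosh t - `|p t| @[t --> 0^'+] --> cosh 0 - `|p 0|.
  exact: cvg_at_right_filter cpc.
rewrite -(cvg_lim (@Rhausdorff R) l1); apply: limr_ge; first by apply/cvg_ex; eexists; exact: l1.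
by near=> t; apply: pos; near: t; exact: nbhs_right_gt.
Unshelve. all: by end_near. Qed.

(** The inner integral of the principal value at c = 0, for p = phi_1. *)
Definition moment y : R[i] := oriented_Cintegral 0 y (fun z => (p z)%:C * f z).

Lemma cdrv_moment y : has_cderiv moment y ((p y)%:C * f y).
Proof.
have ccp (z : R) : has_ccont (fun z => (p z)%:C * f z) z.
  have h1 : has_ccont (fun z => (p z)%:C) z by apply: ccontR; exact: cp.
  have h2 : has_ccont f z by split; [exact: continuous_Re|exact: continuous_Im].
  exact: ccontM h1 h2.
split.
  apply: drv_ext (drv_oriented_integral 0 y (fun z => proj1 (ccp z))) => z.
  by rewrite /moment /oriented_Cintegral /oriented_integral; case: ifP => _; rewrite ?ReN.
apply: drv_ext (drv_oriented_integral 0 y (fun z => proj2 (ccp z))) => z.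
by rewrite /moment /oriented_Cintegral /oriented_integral; case: ifP => _; rewrite ?ImN.
Qed.

Lemma moment0 : moment 0 = 0.
Proof.
rewrite /moment /oriented_Cintegral lexx /Cintegral !Rintegral_point.
by [].
Qed.

Lemma moment_bound y : cnorm (moment y) <= 2 * A * expR (3 / 2 * `|y|).
Proof.
pose B (x : R) := 2 / 3 * A * expR (3 / 2 * x).
have dB x : is_derive x 1 B (A * expR (3 / 2 * x)).
  have h := drvZ (2 / 3 * A) (@drv_comp _ _ (fun x : R => 3 / 2 * x) x _ _
    (is_derive_expR _) (drv_linear _ x)).
  by apply: (drv_eq h); field.
have bnd x : cnorm ((p x)%:C * f x) <= A * expR (3 / 2 * `|x|).
  rewrite cnormM cnormR.
  have -> : 3 / 2 * `|x| = `|x| + `|x| / 2 by field.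
  rewrite expRD mulrCA; apply: ler_pM; rewrite ?cnorm_ge0 ?fA//.
  exact: le_trans (p_bound x) (cosh_le_exp x).
have gen (m m' : R -> R[i]) z : 0 <= z -> m 0 = 0 ->
    (forall x, has_cderiv m x (m' x)) ->
    (forall x, 0 <= x -> cnorm (m' x) <= A * expR (3 / 2 * x)) ->
    cnorm (m z) <= 2 * A * expR (3 / 2 * z).
  move=> z0 m0 dm mb; have := @cincrement_le _ m m' B _ 0 z z0
    (fun x _ => dm x) (fun x _ => dB x) (fun x xI => mb x (proj1 (andP xI))).
  rewrite m0 subr0 => h; apply: le_trans h _.
  have h1 : 0 <= A * expR (3 / 2 * z) by rewrite mulr_ge0 ?expR_ge0.
  have h2 : 0 <= B 0 by rewrite /B mulr_ge0 ?expR_ge0// mulr_ge0// divr_ge0.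
  have h3 : B z = 2 / 3 * (A * expR (3 / 2 * z)) by rewrite /B mulrA.
  by rewrite h3; lra.
have [y0|y0] := leP 0 y.
  rewrite ger0_norm//; apply: (gen moment _ y y0 moment0 cdrv_moment) => x x0.
  by have := bnd x; rewrite ger0_norm.
rewrite ltr0_norm// -[in moment y](opprK y).
have y0' : 0 <= - y by rewrite oppr_ge0 ltW.
apply: (gen (fun z => moment (- z)) _ (- y) y0' _ (fun x => cdrv_opp (cdrv_moment (- x)))).
  by rewrite oppr0 moment0.
by move=> x x0; rewrite cnormN; have := bnd (- x); rewrite normrN ger0_norm.
Qed.

Lemma cdrv_opp_moment y :
  has_cderiv (fun y => - moment (- y)) y ((p y)%:C * f (- y)).
Proof.
apply: cdrv_eq (cdrvN (cdrv_opp (cdrv_moment (- y)))) _.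
by rewrite opprK p_even.
Qed.

End Moments.

End Outer.

(** * The truncated principal value *)

Section OuterIntegrals.
Context {R : realType}.
Notation mu := (@lebesgue_measure R).
Implicit Types (f h F m : R -> R[i]) (e x y z A C K : R).

Definition ctail_dominated h e C := 0 <= C /\ forall x, e <= x ->
  has_ccont h x /\ cnorm (h x) <= C * expR (- x / 2).

Lemma ctail_dominated_Re h e C : ctail_dominated h e C ->
  tail_dominated (fun x => complex.Re (h x)) e C.
Proof.
move=> [C0 hC]; split=> // x /hC[[h1 _] h2]; split=> //.
exact: le_trans (cnorm_ge_Re _) h2.
Qed.

Lemma ctail_dominated_Im h e C : ctail_dominated h e C ->
  tail_dominated (fun x => complex.Im (h x)) e C.
Proof.
move=> [C0 hC]; split=> // x /hC[[_ h1] h2]; split=> //.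
exact: le_trans (cnorm_ge_Im _) h2.
Qed.

Lemma cdrv_tail h y : 0 < y ->
  (forall e, 0 < e -> exists C, ctail_dominated h e C) ->
  has_cderiv (fun z => Cintegral `]z, +oo[ h) y (- h y).
Proof.
move=> y0 hd; split; rewrite ?ReN ?ImN /=; apply: drv_tail => // e /hd[C hC].
  by exists C; exact: ctail_dominated_Re.
by exists C; exact: ctail_dominated_Im.
Qed.

Lemma ctail_bound h e C : ctail_dominated h e C ->
  cnorm (Cintegral `]e, +oo[ h) <= 4 * C * expR (- e / 2).
Proof.
move=> hC; apply: le_trans (cnorm_le_ReIm _) _ => /=.
have := tail_bound (ctail_dominated_Re hC); have := tail_bound (ctail_dominated_Im hC).
by lra.
Qed.

Lemma expR_sub1 e x : e <= x -> expR x * (1 - expR (- 2 * e)) / 2 <= sinh x.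
Proof.
move=> ex; rewrite /sinh.
have E : expR (- x) = expR (- 2 * x) * expR x by rewrite -expRD; congr expR; ring.
have : expR (- 2 * x) <= expR (- 2 * e) by rewrite ler_expR; lra.
rewrite E => /(ler_wpM2r (expR_ge0 x)); lra.
Qed.

Lemma odd_mode_quotient_bound m A e x : 0 < e -> 0 <= A -> e <= `|x| ->
  cnorm (m x) <= 2 * A * expR (3 / 2 * `|x|) ->
  cnorm (m x / (odd_mode x ^+ 2)%:C) <=
    2 * A / ((1 - expR (- 2 * e)) / 2 / 2) ^+ 2 * expR (- `|x| / 2).
Proof.
move=> e0 A0 ex mA.
have k0 : 0 < (1 - expR (- 2 * e)) / 2 / 2.
  by rewrite !divr_gt0// subr_gt0 expR_lt1; lra.
have o : expR `|x| * ((1 - expR (- 2 * e)) / 2 / 2) <= odd_mode `|x|.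
  apply: le_trans (odd_mode_ge (normr_ge0 x)); have := expR_sub1 ex; lra.
have o2 : odd_mode x ^+ 2 = odd_mode `|x| ^+ 2.
  have [x0|x0] := leP 0 x; first by rewrite ger0_norm.
  by rewrite ltr0_norm// odd_modeN sqrrN.
move: ((1 - expR (- 2 * e)) / 2 / 2) k0 o => k k0 o.
rewrite cnormM cnormV cnormR ger0_norm ?sqr_ge0// o2.
have E0 := expR_gt0 `|x|.
have sq : (expR `|x| * k) ^+ 2 <= odd_mode `|x| ^+ 2.
  by rewrite lerXn2r ?nnegrE// ?(le_trans _ o)// mulr_ge0// ltW.
have sq0 : 0 < (expR `|x| * k) ^+ 2 by rewrite exprn_gt0// mulr_gt0.
rewrite ler_pdivrMr; last exact: lt_le_trans sq.
apply: le_trans mA _.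
have F0 : 0 <= 2 * A / k ^+ 2 * expR (- `|x| / 2).
  by rewrite mulr_ge0 ?expR_ge0// divr_ge0 ?sqr_ge0// mulr_ge0.
apply: le_trans (ler_wpM2l F0 sq).
have -> : 2 * A / k ^+ 2 * expR (- `|x| / 2) * (expR `|x| * k) ^+ 2 =
   2 * A * (expR (- `|x| / 2) * expR `|x| ^+ 2) by field; rewrite gt_eqF.
rewrite -expRM_natl -expRD (_ : - `|x| / 2 + 2 * `|x| = 3 / 2 * `|x|)//.
by field.
Qed.

Lemma mode_ratio_exp y : 1 <= y -> sech y / odd_mode y <= 16 * expR (- 2 * y).
Proof.
move=> y1; have y0 : 0 < y by lra.
have /andP[_] := mode_ratio_bound y0; move=> h; apply: le_trans h _.
have w0 := expR_gt0 (- 2 * y).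
have w1 : expR (- 2 * y) <= 1 / 2.
  have -> : - 2 * y = - (2 * y) by ring.
  rewrite expRN (_ : 1 / 2 = 2^-1); last by rewrite mul1r.
  by rewrite lef_pV2 ?posrE ?expR_gt0//; have := expR_ge1Dx (2 * y); lra.
move: (expR _) w0 w1 => w w0 w1.
have d0 : 0 < 1 - w by lra.
rewrite mulrAC ler_pdivrMr//; have := ltW w0; nra.
Qed.

Lemma realC_neq0 (r : R) : r != 0 -> r%:C != 0 :> R[i].
Proof. by apply: contraNneq => /(congr1 (@complex.Re _)) /= ->. Qed.

(** The truncated principal value is integrated by parts on each half-line with the
    primitive sech / odd_mode of its weight. On the right this produces the integral
    I1 of sech f / tanh, on the left its mirror image I2, and the boundary term is
    sech / odd_mode times the integral over [0, e] of phi_1 (f z - f (- z)): the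
    first factor is of order 1 / e, the second of order e^(3/2). *)
Lemma outer_integrals (phi1 : R -> R -> R) f K : is_phi1 phi1 -> continuous f ->
  0 <= K -> half_holder K f ->
  exists I1 I2 T b : R -> R[i],
  [/\ (forall y, 0 < y -> has_cderiv I1 y (- ((sech y / tanh y)%:C * f y))) /\
        vanishes_at_infinity I1,
      (forall y, 0 < y -> has_cderiv I2 y (- ((sech y / tanh y)%:C * f (- y)))) /\
        vanishes_at_infinity I2,
      forall e, 0 < e -> T e = I1 e - I2 e + b e,
      exists2 B, 0 <= B & forall e, 0 < e -> e <= 1 ->
        cnorm (b e) <= B * Num.sqrt (2 * e) &
      forall e, 0 < e -> Cintegral [set y | e < `|y - crit 0|]
        (fun y => oriented_Cintegral (crit 0) y (fun z => (phi1 z 0)%:C * f z) /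
          ((tanh y - 0) ^+ 2 * phi1 y 0 ^+ 2)%:C) = T e].
Proof.
move=> hphi cf K0 hK.
have cp := phi1_continuous hphi; have pE y := phi1_formula y hphi.
set p := phi1^~ 0 in cp pE *.
have [A A0 fA] : exists2 A : R, 0 <= A &
    forall y, cnorm (f y) <= A * expR (`|y| / 2).
  exists (2 * (cnorm (f 0) + K)); first by have := cnorm_ge0 (f 0); lra.
  by move=> y; exact: half_holder_growth.
pose m := moment p f.
have dm y : has_cderiv m y ((p y)%:C * f y) by exact: cdrv_moment.
have dm' y : has_cderiv (fun y => - m (- y)) y ((p y)%:C * f (- y)).
  exact: cdrv_opp_moment.
have mb y : cnorm (m y) <= 2 * A * expR (3 / 2 * `|y|) by exact: moment_bound.
have cm y : has_ccont m y by have [d1 d2] := dm y; split; exact: drv_cont.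
pose h1 y := m y / (odd_mode y ^+ 2)%:C.
pose h2 y := h1 (- y).
pose k (e : R) := 2 * A / ((1 - expR (- 2 * e)) / 2 / 2) ^+ 2.
have k0 e : 0 <= k e by rewrite divr_ge0 ?sqr_ge0// mulr_ge0.
have ch1 y : y != 0 -> has_ccont h1 y.
  move=> y0; apply: ccontM (cm y) (ccontV _ (ccontR _)).
    by apply: realC_neq0; rewrite expf_neq0// odd_mode_neq0.
  exact: contM (drv_cont (drv_odd_mode y)) (drv_cont (drv_odd_mode y)).
have d1 e : 0 < e -> exists C, ctail_dominated h1 e C.
  move=> e0; exists (k e); split; first exact: k0.
  move=> x ex.
  have x0 : 0 < x by exact: lt_le_trans ex.
  split; first by apply: ch1; rewrite gt_eqF.
  have ex' : e <= `|x| by rewrite (gtr0_norm x0).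
  by have := odd_mode_quotient_bound e0 A0 ex' (mb x); rewrite (gtr0_norm x0).
have d2 e : 0 < e -> exists C, ctail_dominated h2 e C.
  move=> e0; exists (k e); split; first exact: k0.
  move=> x ex.
  have x0 : 0 < x by exact: lt_le_trans ex.
  have ex' : e <= `|- x| by rewrite normrN (gtr0_norm x0).
  split; last first.
    by have := odd_mode_quotient_bound e0 A0 ex' (mb (- x)); rewrite normrN (gtr0_norm x0).
  have [c1 c2] : has_ccont h1 (- x) by apply: ch1; rewrite oppr_eq0 gt_eqF.
  split.
    apply: (@continuous_comp R R R (fun z => - z) (fun y => complex.Re (h1 y)) x); last exact: c1.
    exact: opp_continuous.
  apply: (@continuous_comp R R R (fun z => - z) (fun y => complex.Im (h1 y)) x); last exact: c2.
  exact: opp_continuous.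
pose T1 y := Cintegral `]y, +oo[ h1; pose T2 y := Cintegral `]y, +oo[ h2.
have dT1 y : 0 < y -> has_cderiv T1 y (- h1 y) by move=> y0; exact: cdrv_tail.
have dT2 y : 0 < y -> has_cderiv T2 y (- h2 y) by move=> y0; exact: cdrv_tail.
have bT h : (exists C, ctail_dominated h 1 C) ->
    exists2 C, 0 <= C & forall y, 1 <= y -> cnorm (Cintegral `]y, +oo[ h) <= C * expR (- y / 2).
  move=> [C [C0 hC]]; exists (4 * C); first by rewrite mulr_ge0.
  move=> y y1; apply: ctail_bound; split=> // x yx; apply: hC; exact: le_trans yx.
pose I1 y := T1 y - (sech y / odd_mode y)%:C * m y.
pose I2 y := - T2 y - (sech y / odd_mode y)%:C * (- m (- y)).
pose b y := (sech y / odd_mode y)%:C * (m y + m (- y)).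
have ratio y : y != 0 -> (sech y / odd_mode y)%:C * (p y)%:C = (sech y / tanh y)%:C :> R[i].
  move=> y0; rewrite -rmorphM; congr (_ %:C).
  have o0 := odd_mode_neq0 y0; have t0 := tanh_neq0 y0.
  have oE : odd_mode y = tanh y * p y by rewrite (mode_factor pE).
  have p0 : p y != 0 by apply: contraNneq o0 => e; rewrite oE e mulr0.
  by rewrite oE; field; rewrite ?p0 ?t0.
have decayb (n : R -> R[i]) y : (forall z, cnorm (n z) <= 2 * A * expR (3 / 2 * `|z|)) ->
    1 <= y -> cnorm ((sech y / odd_mode y)%:C * n y) <= 32 * A * expR (- y / 2).
  move=> nb y1; have y0 : 0 <= y by exact: le_trans y1.
  rewrite cnormM cnormR ger0_norm; last first.
    by rewrite divr_ge0// ltW ?sech_gt0// odd_mode_gt0//; lra.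
  have := nb y; rewrite ger0_norm// => nby.
  apply: (@le_trans _ _ (16 * expR (- 2 * y) * (2 * A * expR (3 / 2 * y)))).
    apply: ler_pM; rewrite ?cnorm_ge0 ?mode_ratio_exp//.
    by rewrite divr_ge0// ltW ?sech_gt0// odd_mode_gt0//; lra.
  have -> : 16 * expR (- 2 * y) * (2 * A * expR (3 / 2 * y)) =
    32 * A * (expR (- 2 * y) * expR (3 / 2 * y)) by ring.
  rewrite -expRD (_ : - 2 * y + 3 / 2 * y = - y / 2)//; by field.
have mb' z : cnorm (- m (- z)) <= 2 * A * expR (3 / 2 * `|z|).
  by rewrite cnormN; have := mb (- z); rewrite normrN.
have vI (T' n : R -> R[i]) : (exists2 C, 0 <= C & forall y, 1 <= y ->
      cnorm (T' y) <= C * expR (- y / 2)) ->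
    (forall z, cnorm (n z) <= 2 * A * expR (3 / 2 * `|z|)) ->
    vanishes_at_infinity (fun y => T' y - (sech y / odd_mode y)%:C * n y).
  move=> [C C0 CP] nb; apply: (@vanishes_of_exp _ _ (C + 32 * A)).
    by rewrite addr_ge0// mulr_ge0.
  move=> y y1; apply: le_trans (cnormB _ _) _; rewrite mulrDl lerD ?CP//.
  exact: decayb.
exists I1, I2, (fun y => T1 y + T2 y), b; split.
- split; last by apply: vI mb; exact/bT/d1.
  move=> y y0; have yn : y != 0 by rewrite gt_eqF.
  apply: cdrv_eq (cdrvB (dT1 y y0) (cdrvM (cdrvR (drv_mode_ratio yn)) (dm y))) _.
  rewrite mulrA ratio// /h1 rmorphN /= fmorphV /= mulNr; ring.
- split; last first.
    apply: vI mb'; have [C C0 CP] := bT h2 (d2 1 ltr01).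
    by exists C => // y y1; rewrite cnormN; exact: CP.
  move=> y y0; have yn : y != 0 by rewrite gt_eqF.
  apply: cdrv_eq (cdrvB (cdrvN (dT2 y y0)) (cdrvM (cdrvR (drv_mode_ratio yn)) (dm' y))) _.
  rewrite mulrA ratio// /h2 /h1 odd_modeN sqrrN rmorphN /= fmorphV /= mulNr; ring.
- by move=> e e0; rewrite /I1 /I2 /b; ring.
- exists (4 * (@e1 R * K)).
    by rewrite !mulr_ge0// (le_trans ler01)// E_ge1.
  move=> e e0 e1'.
  pose N y := m y + m (- y).
  have dN y : has_cderiv N y ((p y)%:C * (f y - f (- y))).
    apply: (@cdrv_ext _ (fun y => m y - - m (- y))).
      by move=> x; rewrite opprK.
    by apply: cdrv_eq (cdrvB (dm y) (dm' y)) _; rewrite -mulrBr.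
  have E0 : 0 <= @e1 R by rewrite (le_trans ler01)// E_ge1.
  pose l := @e1 R * (K * Num.sqrt (2 * e)).
  have l0 : 0 <= l by rewrite mulr_ge0// mulr_ge0// sqrtr_ge0.
  have dl (x : R) : is_derive x 1 (fun x => l * x) l by exact: drv_linear.
  have := @cincrement_le _ N _ (fun x => l * x) (fun=> l) 0 e (ltW e0)
    (fun x _ => dN x) (fun x _ => dl x).
  have N0 : N 0 = 0 by rewrite /N oppr0 /m moment0 addr0.
  rewrite N0 subr0 mulr0 subr0 => H.
  have Ne : cnorm (N e) <= 2 * (l * e).
    apply: H => x /andP[x0 xe]; rewrite cnormM cnormR.
    have x1 : `|x| <= 1 by rewrite ger0_norm// (le_trans xe).
    apply: ler_pM; rewrite ?cnorm_ge0//.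
      exact: le_trans (p_bound cp pE x) (cosh_le_E x1).
    apply: le_trans (hK (- x) x _) _; first by lra.
    by rewrite ler_wpM2l// ler_wsqrtr//; lra.
  have o0 := odd_mode_gt0 e0; have s0 := sech_gt0 e; have s1 := sech_le1 e.
  have oe : e / 2 <= odd_mode e.
    by apply: le_trans (odd_mode_ge (ltW e0)); have := sinh_ge (ltW e0); lra.
  have r : sech e / odd_mode e * e <= 2.
    by rewrite mulrAC ler_pdivrMr//; have := ler_wpM2r (ltW e0) s1; lra.
  rewrite /b cnormM cnormR ger0_norm; last by rewrite divr_ge0// ltW.
  have q0 : 0 <= sech e / odd_mode e by rewrite divr_ge0// ltW.
  apply: le_trans (ler_wpM2l q0 Ne) _.
  have -> : 4 * (@e1 R * K) * Num.sqrt (2 * e) = 2 * (l * 2) by rewrite /l; ring.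
  have -> : sech e / odd_mode e * (2 * (l * e)) =
    2 * (l * (sech e / odd_mode e * e)) by ring.
  by rewrite ler_wpM2l// ler_wpM2l.
- move=> e e0; rewrite crit0.
  have -> : (fun y => oriented_Cintegral 0 y (fun z => (phi1 z 0)%:C * f z) /
      ((tanh y - 0) ^+ 2 * phi1 y 0 ^+ 2)%:C) = h1.
    by apply/funext => y; rewrite subr0 -exprMn (mode_factor pE).
  have [C1 D1] := d1 e e0; have [C2 D2] := d2 e e0.
  have widen h C C' : ctail_dominated h e C -> C <= C' -> ctail_dominated h e C'.
    move=> [c0 hC] CC'; split; first exact: le_trans CC'.
    move=> x /hC[c1 c2]; split => //; apply: le_trans c2 _.
    by rewrite ler_wpM2r ?expR_ge0.
  have m1 : C1 <= Num.max C1 C2 by rewrite le_max lexx.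
  have m2 : C2 <= Num.max C1 C2 by rewrite le_max lexx orbT.
  have D1' := widen _ _ _ D1 m1; have D2' := widen _ _ _ D2 m2.
  have eR := two_sided_tail e0 (ctail_dominated_Re D1') (ctail_dominated_Re D2').
  have eI := two_sided_tail e0 (ctail_dominated_Im D1') (ctail_dominated_Im D2').
  by apply: eq_ReIm; rewrite (ReD, ImD) /T1 /T2 /Cintegral /=; [exact: eR|exact: eI].
Qed.

End OuterIntegrals.

(** * The condition that determines q 0 *)

Section Solvability.
Context {R : realType}.
Implicit Types (f F I q W : R -> R[i]) (c : R[i]) (e x y z C K M : R).

Lemma vanishesD F I : vanishes_at_infinity F -> vanishes_at_infinity I ->
  vanishes_at_infinity (fun y => F y + I y).
Proof.
move=> vF vI e e0; have e2 : 0 < e / 2 by rewrite divr_gt0.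
have [y1 h1] := vF _ e2; have [y2 h2] := vI _ e2.
exists (Num.max y1 y2) => y; rewrite ge_max => /andP[/h1 a1 /h2 a2].
by apply: le_trans (cnormD _ _) _; lra.
Qed.

(** At c = 0 and with q frozen at q 0, the term - 2 sech^4 q of the source of W
    contributes - log_weight q 0 to W / c: this is the primitive of
    2 sech^4 / tanh on the positive half-line that vanishes at infinity. *)
Definition log_weight y : R := 2 * ln (tanh y) - tanh y ^+ 2 + 1.

Lemma drv_log_weight y : 0 < y ->
  is_derive y 1 log_weight (2 * sech y ^+ 4 / tanh y).
Proof.
move=> y0; have t0 := tanh_gt0 y0.
have d := drvD (drvB (drvM (is_derive_cst (2 : R) y (1 : R))
   (@drv_comp _ _ tanh y _ _ (is_derive1_ln t0) (drv_tanh y)))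
   (drvM (drv_tanh y) (drv_tanh y))) (is_derive_cst (1 : R) y (1 : R)).
apply: (drv_eq d).
rewrite (_ : sech y ^+ 4 = sech y ^+ 2 * (1 - tanh y ^+ 2)).
  by rewrite /cst; field; rewrite gt_eqF.
by rewrite -sech2E -exprD.
Qed.

Lemma log_weight_bound y : 1 <= y -> `|log_weight y| <= 20 * expR (- y / 2).
Proof.
move=> y1; have y0 : 0 < y by exact: lt_le_trans y1.
have t35 := tanh_ge1 y1; have t1 : tanh y < 1.
  by apply: le_lt_trans (tanh_lt1 y); exact: ler_norm.
have t0 := tanh_gt0 y0.
have l0 : ln (tanh y) <= 0 by apply: ln_le0; exact: ltW.
have l1 : - ln (tanh y) <= 5 / 3 * (1 - tanh y ^+ 2).
  rewrite -lnV ?posrE//.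
  have := @le_ln1Dx R ((tanh y)^-1 - 1); rewrite (_ : 1 + (_ - 1) = (tanh y)^-1); last by ring.
  have iv : 1 <= (tanh y)^-1 by rewrite invf_ge1 ?ltW.
  move=> h; apply: le_trans (h _) _; first by lra.
  have := mulfV (lt0r_neq0 t0); move: ((tanh y)^-1) iv => v iv tv.
  have : v <= 5 / 3 by nra.
  have : 0 <= 1 - tanh y by lra.
  move=> d0 v53; have := ler_wpM2r d0 v53; have := mulr_ge0 (ltW t0) d0; nra.
have s2 : 1 - tanh y ^+ 2 <= 4 * expR (- y / 2).
  rewrite -sech2E; have := sech_le_expN y; rewrite (gtr0_norm y0) => se.
  have s0 := sech_gt0 y.
  have : sech y ^+ 2 <= (2 * expR (- y)) ^+ 2.
    by rewrite lerXn2r ?nnegrE ?(ltW s0)// mulr_ge0 ?expR_ge0.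
  move=> h; apply: le_trans h _; rewrite exprMn -expRM_natl.
  rewrite (_ : (2 : R) ^+ 2 = 4); last by ring.
  by rewrite ler_wpM2l// ler_expR; lra.
have t20 : 0 <= 1 - tanh y ^+ 2 by rewrite -sech2E sqr_ge0.
by rewrite ler_norml /log_weight; lra.
Qed.

(** Beyond e the derivative of W / c is within O(|c|) of its value at c = 0 with q
    frozen at q 0, and the primitives of the latter that vanish at infinity are
    - I and - log_weight q 0. *)
Lemma outer_comparison : exists2 C0, 0 <= C0 & forall e, 0 < e ->
  exists2 C, 0 <= C & forall f c q W K I,
  admissible K f -> wronskian_system f c q W -> complex.Im c != 0 ->
  cnorm c <= 1 / 4 -> 2 * (C0 * cnorm c) <= 1 -> 2 * cnorm c <= tanh e ->
  (forall y, 0 < y -> has_cderiv I y (- ((sech y / tanh y)%:C * f y))) ->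
  vanishes_at_infinity I ->
  cnorm (W e / c + I e + (log_weight e)%:C * q 0) <=
    C * (cnorm c * (K + cnorm (q 0))).
Proof.
have [C0 C00 oscP] := @oscillation_small R; exists C0 => // e e0.
have t0 := tanh_gt0 e0.
pose k := 128 / tanh e ^+ 2 + 64 * C0 / tanh e.
have k0 : 0 <= k.
  apply: addr_ge0; first by rewrite divr_ge0// sqr_ge0.
  by apply: divr_ge0; [exact: mulr_ge0|exact: ltW].
exists (4 * k); first by rewrite mulr_ge0.
move=> f c q W K I fa sys ci c4 cC ce dI vI.
have [K0 _ _ _] := fa; have [_ dW [w w0 wP]] := sys.
have osc := oscP _ _ _ _ _ fa sys ci c4 cC.
have c0 := cnorm_ge0 c; have q0 := cnorm_ge0 (q 0).
have Y0 : 0 <= K + cnorm (q 0) by exact: addr_ge0.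
have cY0 : 0 <= cnorm c * (K + cnorm (q 0)) by exact: mulr_ge0.
have cn0 : c != 0 by apply: contraNneq ci => ->.
have M0 : 0 <= 2 * (C0 * (cnorm c * (K + cnorm (q 0)))).
  by apply: mulr_ge0 => //; exact: mulr_ge0.
have MY : 2 * (C0 * (cnorm c * (K + cnorm (q 0)))) <= K + cnorm (q 0).
  have := ler_wpM2r Y0 cC; lra.
have qN y := oscillation_bound y M0 osc.
have N0 := addr_ge0 q0 M0.
pose D y := W y * c^-1 + I y + (log_weight y)%:C * q 0.
pose D' y := ((sech y)%:C * f y - (2 * sech y ^+ 4)%:C * q y) * c /
  ((tanh y)%:C * ((tanh y)%:C - c)) - (2 * sech y ^+ 4 / tanh y)%:C * (q y - q 0).
have dD y : e <= y -> has_cderiv D y (D' y).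
  move=> ey; have y0 : 0 < y by exact: lt_le_trans ey.
  have tn := realC_neq0 (lt0r_neq0 (tanh_gt0 y0)); have dn := tanhBc_neq0 y ci.
  apply: cdrv_eq (cdrvD (cdrvD (cdrvM (dW y) (cdrv_cst y c^-1)) (dI y y0))
    (cdrvM (cdrvR (drv_log_weight y0)) (cdrv_cst y (q 0)))) _.
  rewrite /D'; move: tn dn; move: (sech y ^+ 4) (sech y) (tanh y) => s4 s u tn dn.
  rewrite !(rmorphM, fmorphV) /=.
  by field; rewrite tn dn.
have bD y : e <= y -> cnorm (D' y) <= k * (cnorm c * (K + cnorm (q 0))) * expR (- y / 2).
  move=> ey; have y0 : 0 <= y by exact: ltW (lt_le_trans e0 ey).
  have te : tanh e <= tanh y by exact: tanh_incr.
  have ty0 : 0 < tanh y by exact: lt_le_trans te.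
  have S := source_decay fa N0 qN y0.
  have de : tanh e / 2 <= cnorm ((tanh y)%:C - c).
    by apply: le_trans (tanhBc_ge c y); rewrite (gtr0_norm ty0); lra.
  have E0 := expR_ge0 (- y / 2) (R := R).
  have b1 : cnorm (((sech y)%:C * f y - (2 * sech y ^+ 4)%:C * q y) * c /
      ((tanh y)%:C * ((tanh y)%:C - c))) <=
      128 / tanh e ^+ 2 * (cnorm c * (K + cnorm (q 0)) * expR (- y / 2)).
    rewrite cnormM cnormV [cnorm (_ * c)]cnormM [cnorm ((tanh y)%:C * _)]cnormM.
    rewrite cnormR (gtr0_norm ty0).
    have dd : tanh e ^+ 2 / 2 <= tanh y * cnorm ((tanh y)%:C - c).
      rewrite expr2 -mulrA; apply: ler_pM => //; first exact: ltW.
      by rewrite divr_ge0// ltW.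
    have dd0 : 0 < tanh e ^+ 2 / 2 by rewrite divr_gt0// exprn_gt0.
    rewrite ler_pdivrMr; last exact: lt_le_trans dd.
    have S' : cnorm ((sech y)%:C * f y - (2 * sech y ^+ 4)%:C * q y) <=
        64 * ((K + cnorm (q 0)) * expR (- y / 2)).
      apply: le_trans S _.
      have h : K + (cnorm (q 0) + 2 * (C0 * (cnorm c * (K + cnorm (q 0))))) <=
        2 * (K + cnorm (q 0)) by lra.
      by have := ler_wpM2r E0 h; lra.
    apply: le_trans (ler_wpM2r c0 S') _.
    have Z0 : 0 <= 128 / tanh e ^+ 2 * (cnorm c * (K + cnorm (q 0)) * expR (- y / 2)).
      apply: mulr_ge0; first by rewrite divr_ge0// sqr_ge0.
      exact: mulr_ge0.
    apply: le_trans (ler_wpM2l Z0 dd).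
    by rewrite le_eqVlt; apply/orP; left; apply/eqP; field; rewrite gt_eqF.
  have b2 : cnorm ((2 * sech y ^+ 4 / tanh y)%:C * (q y - q 0)) <=
      64 * C0 / tanh e * (cnorm c * (K + cnorm (q 0)) * expR (- y / 2)).
    rewrite cnormM cnormR ger0_norm; last first.
      by rewrite divr_ge0 ?(ltW ty0)// mulr_ge0// exprn_ge0// ltW// sech_gt0.
    have [h0 _] := osc.
    have sechp : 0 <= sech y ^+ 4 by rewrite exprn_ge0// ltW// sech_gt0.
    have h1 := ler_wpM2l sechp (h0 y); have h2 := ler_wpM2l M0 (sech4_exp y).
    have h3 : sech y ^+ 4 * cnorm (q y - q 0) <=
        32 * (C0 * (cnorm c * (K + cnorm (q 0)) * expR (- y / 2))).
      apply: le_trans h1 _; rewrite (ger0_norm y0) in h2 *.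
      rewrite mulrCA; apply: le_trans h2 _; lra.
    rewrite mulrAC ler_pdivrMr//.
    apply: (@le_trans _ _ (64 * (C0 * (cnorm c * (K + cnorm (q 0)) * expR (- y / 2))))).
      by lra.
    have Z0 : 0 <= 64 * C0 / tanh e * (cnorm c * (K + cnorm (q 0)) * expR (- y / 2)).
      apply: mulr_ge0; first by rewrite divr_ge0 ?(ltW t0)// mulr_ge0.
      exact: mulr_ge0.
    apply: le_trans (ler_wpM2l Z0 te).
    by rewrite le_eqVlt; apply/orP; left; apply/eqP; field; rewrite gt_eqF.
  apply: le_trans (cnormB _ _) _; rewrite /k; lra.
have vD : vanishes_at_infinity D.
  apply: vanishesD; [apply: vanishesD => //|].
    apply: (@vanishes_of_exp _ _ (w / cnorm c)); first by rewrite divr_ge0.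
    move=> y y1; rewrite cnormM cnormV mulrAC ler_wpM2r ?invr_ge0//.
    by have := wP y; rewrite ger0_norm// (le_trans ler01).
  apply: (@vanishes_of_exp _ _ (20 * cnorm (q 0))); first by rewrite mulr_ge0.
  move=> y y1; rewrite cnormM cnormR mulrAC ler_wpM2r//; exact: log_weight_bound.
have kcY : 0 <= k * (cnorm c * (K + cnorm (q 0))) by exact: mulr_ge0.
have := decay_bound kcY dD bD vD => h; apply: le_trans h _.
rewrite -[in leRHS]mulrA; apply: ler_piMr; first exact: mulr_ge0.
exact: expRN_half_le1 (ltW e0).
Qed.

Lemma tanh_le y : 0 <= y -> tanh y <= y.
Proof.
move=> y0; have := @nondecreasing_of_drv _ (fun x => x - tanh x) (fun x => 1 - sech x ^+ 2) 0 y y0.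
rewrite tanh0 subrr subr_ge0; apply => x _.
- exact: contB (drv_cont (is_derive_id x (1 : R))) (drv_cont (drv_tanh x)).
- exact: drvB (is_derive_id x (1 : R)) (drv_tanh x).
- by rewrite subr_ge0 exprn_ile1 ?sech_le1// ltW// sech_gt0.
Qed.

(** The constants in [solvability], collected over plain real numbers. *)
Lemma solvability_arith (B Cn Ce k Q L s r w K : R) :
  0 <= B -> 0 <= Cn -> 0 <= Ce -> 0 <= k -> 0 <= Q -> 0 <= L -> 0 <= s ->
  0 <= r * w -> K <= L * (1 + Q) ->
  Ce * (k * K) + Ce * (k * K) + 6 * (Cn * K) * s + 24 * K * r * w + B * s <=
  (1 + Q) * ((B + 6 * (Cn * L) + 24 * L) * s + 2 * (Ce * L) * k +
    (B + 6 * (Cn * L) + 24 * L) * r * w).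
Proof.
move=> B0 Cn0 Ce0 k0 Q0 L0 s0 rw0 KL.
have Bs := mulr_ge0 B0 s0; have BsQ := mulr_ge0 Bs Q0.
have Q1 : 0 <= 1 + Q by lra.
have h1 := ler_wpM2l (mulr_ge0 Ce0 k0) KL.
have h2 := ler_wpM2l (mulr_ge0 Cn0 s0) KL.
have h3 := ler_wpM2l rw0 KL.
have h4 := mulr_ge0 (mulr_ge0 L0 s0) Q1.
have h5 := mulr_ge0 (mulr_ge0 B0 rw0) Q1.
have h6 := mulr_ge0 (mulr_ge0 (mulr_ge0 Cn0 L0) rw0) Q1.
lra.
Qed.

(** The increment of W across [- e, e] is computed twice: from inside, where it
    is the source at the critical point times the increment of the logarithm,
    and from outside, by integration from both infinities. The two terms in
    log_weight e are equal and cancel. *)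
Lemma solvability f K I1 I2 (T b : R -> R[i]) (B : R) : admissible K f ->
  (forall y, 0 < y -> has_cderiv I1 y (- ((sech y / tanh y)%:C * f y))) ->
  vanishes_at_infinity I1 ->
  (forall y, 0 < y -> has_cderiv I2 y (- ((sech y / tanh y)%:C * f (- y)))) ->
  vanishes_at_infinity I2 ->
  (forall e, 0 < e -> T e = I1 e - I2 e + b e) ->
  0 <= B -> (forall e, 0 < e -> e <= 1 -> cnorm (b e) <= B * Num.sqrt (2 * e)) ->
  exists C0 C1, [/\ 0 <= C0, 0 <= C1 & forall e, 0 < e -> e <= 1 ->
  exists2 C2, 0 <= C2 & forall c q W,
  wronskian_system f c q W -> complex.Im c != 0 ->
  cnorm c <= 1 / 4 -> 2 * (C0 * cnorm c) <= 1 -> 2 * cnorm c <= tanh e ->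
  cnorm ((f 0 - 2 * q 0) * (clog c (tanh e) - clog c (- tanh e)) + T e) <=
  (1 + cnorm (q 0)) * (C1 * Num.sqrt (2 * e) + C2 * cnorm c +
    C1 * Num.sqrt (cnorm c) * cnorm (clog c (tanh e) - clog c (- tanh e)))].
Proof.
move=> fa dI1 vI1 dI2 vI2 TE B0 bB; have [K0 _ _ _] := fa.
have [Ca Ca0 outP] := @outer_comparison.
have [Cb Cb0 oscP] := @oscillation_small R.
have [Cn Cn0 nearP] := @near_wronskian R.
pose L := 1 + K; have L1 : 1 <= L by rewrite /L; lra.
have L0 : 0 <= L by lra.
exists (Ca + Cb), (B + 6 * (Cn * L) + 24 * L); split; first exact: addr_ge0.
  have := mulr_ge0 Cn0 L0; lra.
move=> e e0 e1'; have [Ce Ce0 outeP] := outP e e0.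
exists (2 * (Ce * L)); first by rewrite mulr_ge0// mulr_ge0.
move=> c q W sys ci c4 cC ce.
have c0 := cnorm_ge0 c; have q0 := cnorm_ge0 (q 0).
have Cac := mulr_ge0 Ca0 c0; have Cbc := mulr_ge0 Cb0 c0.
have cCa : 2 * (Ca * cnorm c) <= 1 by lra.
have cCb : 2 * (Cb * cnorm c) <= 1 by lra.
have osc := oscP _ _ _ _ _ fa sys ci c4 cCb.
have Y0 : 0 <= K + cnorm (q 0) by exact: addr_ge0.
have M0 : 0 <= 2 * (Cb * (cnorm c * (K + cnorm (q 0)))).
  by apply: mulr_ge0 => //; apply: mulr_ge0 => //; exact: mulr_ge0.
have MY : 2 * (Cb * (cnorm c * (K + cnorm (q 0)))) <= K + cnorm (q 0).
  by have := ler_wpM2r Y0 cCb; lra.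
have o1 := outeP _ _ _ _ _ _ fa sys ci c4 cCa ce dI1 vI1.
have ciN : complex.Im (- c) != 0 by rewrite ImN oppr_eq0.
have := outeP _ _ _ _ _ I2 (admissible_opp fa) (wronskian_system_opp sys) ciN.
rewrite cnormN oppr0 => /(_ c4 cCa ce dI2 vI2) o2.
move: (2 * (Cb * (cnorm c * (K + cnorm (q 0))))) M0 MY osc => M M0 MY osc.
have N0 : 0 <= cnorm (q 0) + M by exact: addr_ge0.
have qN (y : R) : `|y| <= 1 -> cnorm (q y) <= cnorm (q 0) + M.
  exact: oscillation_local_bound.
have a4 : `|complex.Re c| <= cnorm c by exact: cnorm_ge_Re.
have [p p1 pc] : exists2 p, `|p| <= 1 & tanh p = complex.Re c.
  by apply: tanh_surj; lra.
have e1n : `|e| <= 1 by rewrite (gtr0_norm e0).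
have e1o : `|- e| <= 1 by rewrite normrN.
have ee : - e <= e by move: e0; clear; lra.
have near := nearP _ _ _ _ _ _ _ _ _ _ fa sys ci N0 M0 qN (proj2 osc) p1 pc e1o e1n ee.
rewrite tanhN in near.
have n0 : `|0 : R| <= 1 by rewrite normr0.
have src := reduced_source_holder fa N0 M0 qN (proj2 osc) p1 n0.
rewrite {2}/reduced_source cosh0 sech0 tanh0 subr0 expr1n mulr1 pc in src.
have srcE : (1 : R)%:C * f 0 - (2 : R)%:C * q 0 = f 0 - 2 * q 0.
  by rewrite rmorph1 mul1r rmorph_nat.
rewrite srcE in src.
have cn0 : c != 0 by apply: contraNneq ci => ->.
set w := clog c (tanh e) - clog c (- tanh e) in near *.
set kp := reduced_source f q p in near src.
have ts : - tanh e - complex.Re c <= tanh e - complex.Re c.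
  by have := tanh_gt0 e0; clear; lra.
have ss := signed_sqrt_increment ts.
have ts2 : Num.sqrt (tanh e - complex.Re c - (- tanh e - complex.Re c)) <= Num.sqrt (2 * e).
  by apply: ler_wsqrtr; have := tanh_le (ltW e0); clear; lra.
(* The mirror image of the outer comparison concerns - c, - W (- e) and I2. *)
have id : (f 0 - 2 * q 0) * w + T e =
  (W e / c + I1 e + (log_weight e)%:C * q 0)
  - (- W (- e) / - c + I2 e + (log_weight e)%:C * q 0)
  - (W e - W (- e) - c * kp * w) / c - (kp - (f 0 - 2 * q 0)) * w + b e.
  by rewrite TE//; field.
rewrite id.
have n3 : cnorm ((W e - W (- e) - c * kp * w) / c) <=
    6 * (Cn * (K + cnorm (q 0))) * Num.sqrt (2 * e).
  rewrite cnormM cnormV ler_pdivrMr ?cnorm_gt0//.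
  apply: le_trans near _.
  have h1 : signed_sqrt (tanh e - complex.Re c) - signed_sqrt (- tanh e - complex.Re c)
      <= 2 * Num.sqrt (2 * e) by move: ss ts2; clear; lra.
  have h2 : K + (cnorm (q 0) + M) + M <= 3 * (K + cnorm (q 0)) by move: MY; clear; lra.
  have X0 : 0 <= Cn * (cnorm c * (K + (cnorm (q 0) + M) + M)).
    by rewrite mulr_ge0// mulr_ge0// !addr_ge0.
  apply: le_trans (ler_wpM2l X0 h1) _.
  have s0 := sqrtr_ge0 (2 * e).
  have := ler_wpM2r s0 (ler_wpM2l Cn0 (ler_wpM2l c0 h2)); clear; lra.
have n4 : cnorm ((kp - (f 0 - 2 * q 0)) * w) <=
    24 * (K + cnorm (q 0)) * Num.sqrt (cnorm c) * cnorm w.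
  rewrite cnormM ler_wpM2r ?cnorm_ge0//; apply: le_trans src _.
  apply: ler_pM; rewrite ?sqrtr_ge0//; [|by move: MY; clear; lra|exact: ler_wsqrtr].
  by rewrite mulr_ge0// !addr_ge0.
have n5 := bB e e0 e1'.
have KL : K + cnorm (q 0) <= L * (1 + cnorm (q 0)).
  by rewrite /L; have := mulr_ge0 K0 q0; clear; lra.
apply: le_trans (cnormD _ _) _.
have t1 := cnormB (W e / c + I1 e + (log_weight e)%:C * q 0
  - (- W (- e) / - c + I2 e + (log_weight e)%:C * q 0)
  - (W e - W (- e) - c * kp * w) / c) ((kp - (f 0 - 2 * q 0)) * w).
have t2 := cnormB (W e / c + I1 e + (log_weight e)%:C * q 0
  - (- W (- e) / - c + I2 e + (log_weight e)%:C * q 0))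
  ((W e - W (- e) - c * kp * w) / c).
have t3 := cnormB (W e / c + I1 e + (log_weight e)%:C * q 0)
  (- W (- e) / - c + I2 e + (log_weight e)%:C * q 0).
have s0 := sqrtr_ge0 (2 * e); have sc := sqrtr_ge0 (cnorm c); have w0 := cnorm_ge0 w.
apply: (le_trans (lerD (le_trans t1 (lerD (le_trans t2 (lerD (le_trans t3
  (lerD o1 o2)) n3)) n4)) n5)).
exact: (solvability_arith B0 Cn0 Ce0 c0 q0 L0 s0 (mulr_ge0 sc w0) KL).
Qed.

End Solvability.

(** * Limits at the origin in a half-plane *)

Section Limits.
Context {R : realType}.
Implicit Types (c p : R[i]) (d e s : R).

Lemma complex_gt0 (eps : R[i]) : 0 < eps -> 0 < complex.Re eps /\ eps = (complex.Re eps)%:C.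
Proof. by case: eps => a b; rewrite ltcE /= => /andP[/eqP -> a0]. Qed.

Lemma cvg_complex (T : Type) (F : set_system T) (FF : Filter F) (h : T -> R[i]) (L : R[i]) :
  (forall d, 0 < d -> \forall t \near F, cnorm (h t - L) <= d) ->
  h t @[t --> F] --> L.
Proof.
move=> H; apply/cvgrPdist_le => eps /complex_gt0[e0 ->].
apply: filterS (H _ e0) => t ht.
by rewrite normE lecR cnorm_distC.
Qed.

Lemma near_half_plane s (P : R[i] -> Prop) :
  (\forall c \near within [set c | 0 < s * complex.Im c] (nbhs (0 : R[i])), P c) <->
  exists2 d, 0 < d & forall c, cnorm c < d -> 0 < s * complex.Im c -> P c.
Proof.
split.
  rewrite near_withinE => /nbhs_ballP[eps /= /complex_gt0[e0 ->] h].
  exists (complex.Re eps) => // c ce; apply: h => //=.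
  by rewrite /ball /= sub0r normrN normE ltcR.
case=> d d0 h; rewrite near_withinE; apply/nbhs_ballP; exists d%:C.
  by rewrite /= ltcR.
by move=> c; rewrite /ball /= sub0r normrN normE ltcR => cd /=; exact: h.
Qed.

Lemma real_cauchy (T : R -> R) :
  (forall d, 0 < d -> exists2 e0, 0 < e0 & forall e e', 0 < e -> e <= e0 ->
    0 < e' -> e' <= e0 -> `|T e - T e'| <= d) ->
  exists L, forall d, 0 < d -> exists2 e0, 0 < e0 & forall e, 0 < e -> e <= e0 ->
    `|T e - L| <= d.
Proof.
move=> H.
have cv : cvg (T e @[e --> (0 : R)^'+]).
  apply/cauchy_cvgP/cauchy_exP => d d0.
  have [e0 e00 he] := H (d / 2) ltac:(lra); exists (T e0).
  suff h : \forall e \near (0 : R)^'+, `|T e0 - T e| < d by exact: h.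
  near=> e.
  apply: (@le_lt_trans _ _ (d / 2)); last by lra.
  have e1 : 0 < e by near: e; exact: nbhs_right_gt.
  have e2 : e <= e0 by near: e; exact: nbhs_right_le.
  exact: he.
exists (lim (T e @[e --> (0 : R)^'+])) => d d0.
have [e0 e00 he] := H (d / 2) ltac:(lra); exists e0 => // e ep ee.
have /cvgrPdist_le /(_ (d / 2) ltac:(lra)) hn := cv.
near (0 : R)^'+ => e'.
have e1 : 0 < e' by near: e'; exact: nbhs_right_gt.
have e2 : e' <= e0 by near: e'; exact: nbhs_right_le.
have h1 : `|T e - T e'| <= d / 2 by exact: he.
have h2 : `|lim (T e @[e --> (0 : R)^'+]) - T e'| <= d / 2 by near: e'.
rewrite distrC in h2.
apply: le_trans (ler_distD (T e') _ _) _; lra.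
Unshelve. all: by end_near. Qed.


Lemma complex_cauchy (T : R -> R[i]) :
  (forall d, 0 < d -> exists2 e0, 0 < e0 & forall e e', 0 < e -> e <= e0 ->
    0 < e' -> e' <= e0 -> cnorm (T e - T e') <= d) ->
  exists L, forall d, 0 < d -> exists2 e0, 0 < e0 & forall e, 0 < e -> e <= e0 ->
    cnorm (T e - L) <= d.
Proof.
move=> H.
have [|a ha] := @real_cauchy (fun e => complex.Re (T e)).
  move=> d /H[e0 e00 he]; exists e0 => // e e' e1 e2 e3 e4.
  by rewrite -ReB; apply: le_trans (cnorm_ge_Re _) (he _ _ _ _ _ _).
have [|b hb] := @real_cauchy (fun e => complex.Im (T e)).
  move=> d /H[e0 e00 he]; exists e0 => // e e' e1 e2 e3 e4.
  by rewrite -ImB; apply: le_trans (cnorm_ge_Im _) (he _ _ _ _ _ _).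
exists (a +i* b) => d d0; have d2 : 0 < d / 2 by lra.
have [ea ea0 hea] := ha _ d2; have [eb eb0 heb] := hb _ d2.
exists (Num.min ea eb); first by rewrite lt_min ea0.
move=> e e0; rewrite le_min => /andP[h1 h2].
apply: le_trans (cnorm_le_ReIm _) _; rewrite ReB ImB /=.
have := hea e e0 h1; have := heb e e0 h2; lra.
Qed.

(** The term (f0 - 2 q) p does not depend on e. For a single e the estimate
    bounds q, as 2 |p q| dominates because |p| >= 1; comparing two values of e at
    the same point c then shows that T is Cauchy at 0; and once T has a limit L,
    q must approach the root of (f0 - 2 q) p + L = 0. *)
Lemma solvability_limit (F : set_system R[i]) (PF : ProperFilter F)
  (f0 p : R[i]) (C1 : R) (q : R[i] -> R[i]) (T : R -> R[i]) (J : R -> R[i] -> R[i]) :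
  1 <= cnorm p -> 0 <= C1 ->
  (forall d, 0 < d -> \forall c \near F, cnorm c <= d) ->
  (forall e d, 0 < e -> 0 < d -> \forall c \near F, cnorm (J e c - p) <= d) ->
  (forall e, 0 < e -> e <= 1 -> exists2 C2, 0 <= C2 & \forall c \near F,
    cnorm ((f0 - 2 * q c) * J e c + T e) <= (1 + cnorm (q c)) *
     (C1 * Num.sqrt (2 * e) + C2 * cnorm c + C1 * Num.sqrt (cnorm c) * cnorm (J e c))) ->
  exists L, (forall d, 0 < d -> exists2 e0, 0 < e0 & forall e, 0 < e -> e <= e0 ->
      cnorm (T e - L) <= d) /\
    (forall d, 0 < d -> \forall c \near F, cnorm (q c - (L + p * f0) / (2 * p)) <= d).
Proof.
move=> p1 C10 small Jp main.
have f00 := cnorm_ge0 f0.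
have Cp : 0 < C1 + 1 by lra.
have stepa d : 0 < d -> exists2 e0, 0 < e0 & forall e, 0 < e -> e <= e0 ->
    \forall c \near F, cnorm ((f0 - 2 * q c) * p + T e) <= d * (1 + cnorm (q c)).
  move=> d0; have dC : 0 < d / 8 / (C1 + 1) by rewrite divr_gt0// divr_gt0.
  have CdC (x : R) : 0 <= x -> x <= d / 8 / (C1 + 1) -> C1 * x <= d / 8.
    by move=> x0; rewrite ler_pdivlMr//; lra.
  exists (Num.min 1 ((d / 8 / (C1 + 1)) ^+ 2 / 2)).
    by rewrite lt_min ltr01 divr_gt0// exprn_gt0.
  move=> e e0; rewrite le_min => /andP[e1 es].
  have s1 : C1 * Num.sqrt (2 * e) <= d / 8.
    apply: CdC (sqrtr_ge0 _) _; apply: sqrt_le_bound; [exact: ltW|lra].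
  have [C2 C20 m] := main e e0 e1.
  have P1 : 0 < cnorm p + 1 by lra.
  have r0 : 0 < d / 8 / (C1 + 1) / (cnorm p + 1) by rewrite divr_gt0.
  have k0 : 0 < d / 8 / (C2 + 1) by rewrite divr_gt0 ?divr_gt0//; lra.
  have j0 : 0 < Num.min 1 (d / 8 / (cnorm f0 + 2)).
    by rewrite lt_min ltr01 divr_gt0 ?divr_gt0//; lra.
  have sk0 : 0 < Num.min (d / 8 / (C2 + 1)) ((d / 8 / (C1 + 1) / (cnorm p + 1)) ^+ 2).
    by rewrite lt_min k0 exprn_gt0.
  apply: filterS3 m (Jp e _ e0 j0) (small _ sk0) => c mc; rewrite !le_min.
  move=> /andP[J1 J2] /andP[c1 c2].
  have c0 := cnorm_ge0 c; have q0 := cnorm_ge0 (q c).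
  have Jle : cnorm (J e c) <= cnorm p + 1.
    have := cnormD (J e c - p) p; rewrite subrK; lra.
  have b2 : C2 * cnorm c <= d / 8.
    by move: c1; rewrite ler_pdivlMr//; lra.
  have b3 : C1 * Num.sqrt (cnorm c) * cnorm (J e c) <= d / 8.
    have h : Num.sqrt (cnorm c) <= d / 8 / (C1 + 1) / (cnorm p + 1).
      by apply: sqrt_le_bound => //; exact: ltW.
    move: h; rewrite ler_pdivlMr// => h.
    have h' : Num.sqrt (cnorm c) * cnorm (J e c) <= d / 8 / (C1 + 1).
      by apply: le_trans h; rewrite ler_wpM2l ?sqrtr_ge0.
    by rewrite -mulrA; apply: CdC => //; rewrite mulr_ge0 ?sqrtr_ge0 ?cnorm_ge0.
  have b4 : (cnorm f0 + 2) * cnorm (J e c - p) <= d / 8.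
    by move: J2; rewrite ler_pdivlMr//; [lra|lra].
  have -> : (f0 - 2 * q c) * p + T e =
    ((f0 - 2 * q c) * J e c + T e) - (f0 - 2 * q c) * (J e c - p) by ring.
  apply: le_trans (cnormB _ _) _.
  have b5 : cnorm ((f0 - 2 * q c) * (J e c - p)) <= d / 8 * (1 + cnorm (q c)).
    rewrite cnormM.
    have g : cnorm (f0 - 2 * q c) <= (cnorm f0 + 2) * (1 + cnorm (q c)).
      apply: le_trans (cnormB _ _) _.
      rewrite cnormM (_ : 2 = (2 : R)%:C); last by rewrite rmorph_nat.
      rewrite cnormR (ger0_norm (ler0n _ 2)).
      by have := mulr_ge0 f00 q0; lra.
    apply: le_trans (ler_wpM2r (cnorm_ge0 _) g) _.
    have Q1 : 0 <= 1 + cnorm (q c) by lra.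
    have := ler_wpM2r Q1 b4; lra.
  have Q1 : 0 <= 1 + cnorm (q c) by lra.
  have dQ : 0 <= d * (1 + cnorm (q c)) by rewrite mulr_ge0// ltW.
  have := ler_wpM2l Q1 (lerD (lerD s1 b2) b3); lra.
have two : cnorm (2 : R[i]) = 2.
  have -> : (2 : R[i]) = (2 : R)%:C by rewrite rmorph_nat.
  by rewrite cnormR (ger0_norm (ler0n _ 2)).
have [M M0 qM] : exists2 M, 0 <= M & \forall c \near F, cnorm (q c) <= M.
  have [e0 e00 he] := stepa 1 ltr01.
  exists (1 + cnorm (p * f0 + T e0)); first by rewrite addr_ge0// cnorm_ge0.
  apply: filterS (he e0 e00 (lexx _)) => c hc.
  have := cnormB (p * f0 + T e0) ((f0 - 2 * q c) * p + T e0).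
  rewrite (_ : p * f0 + T e0 - _ = 2 * (q c * p)); last by ring.
  rewrite cnormM two cnormM.
  have := ler_wpM2l (cnorm_ge0 (q c)) p1; lra.
have stepc d : 0 < d -> exists2 e0, 0 < e0 & forall e, 0 < e -> e <= e0 ->
    \forall c \near F, cnorm ((f0 - 2 * q c) * p + T e) <= d.
  move=> d0; have dM : 0 < d / (1 + M) by rewrite divr_gt0//; lra.
  have [e0 e00 he] := stepa _ dM; exists e0 => // e ep ee.
  apply: filterS2 (he e ep ee) qM => c h1 h2; apply: le_trans h1 _.
  by rewrite mulrAC ler_pdivrMr; [rewrite ler_pM2l//; lra|lra].
have [|L hL] := @complex_cauchy T.
  move=> d d0; have [e0 e00 he] := stepc (d / 2) ltac:(lra).
  exists e0 => // e e' e1 e2 e3 e4.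
  have [c [h1 h2]] := filter_ex (filterI (he e e1 e2) (he e' e3 e4)).
  have := cnormB ((f0 - 2 * q c) * p + T e) ((f0 - 2 * q c) * p + T e').
  rewrite (_ : (f0 - 2 * q c) * p + T e - _ = T e - T e'); last by ring.
  by move=> h; apply: le_trans h _; lra.
exists L; split => // d d0.
have [e1 e10 he1] := hL d d0; have [e2 e20 he2] := stepc d d0.
have m0 : 0 < Num.min e1 e2 by rewrite lt_min e10.
have m1 : Num.min e1 e2 <= e1 by rewrite ge_min lexx.
have m2 : Num.min e1 e2 <= e2 by rewrite ge_min lexx orbT.
have pn0 : p != 0 by apply: contraTneq p1 => ->; rewrite cnorm0 -ltNge ltr01.
apply: filterS (he2 _ m0 m2) => c hc.
have hT := he1 _ m0 m1.
have -> : q c - (L + p * f0) / (2 * p) =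
   ((T (Num.min e1 e2) - L) - ((f0 - 2 * q c) * p + T (Num.min e1 e2))) / (2 * p).
  by field.
rewrite cnormM cnormV cnormM two.
rewrite ler_pdivrMr; last by lra.
have h := cnormB (T (Num.min e1 e2) - L) ((f0 - 2 * q c) * p + T (Num.min e1 e2)).
have := ler_wpM2l (ltW d0) p1.
lra.
Qed.

End Limits.

(** * The jump of the logarithm *)

Section LogarithmJump.
Context {R : realType}.
Implicit Types (c : R[i]) (a b s t x y v d e : R).

Lemma atan_le x : 0 <= x -> atan x <= x.
Proof.
move=> x0; rewrite -subr_ge0.
have := @nondecreasing_of_drv _ (fun y => y - atan y) (fun y => 1 - (1 + y ^+ 2)^-1) 0 x x0.
rewrite atan0 subrr; apply => y _.
- exact: contB (drv_cont (is_derive_id y (1 : R))) (drv_cont (is_derive1_atan y)).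
- by rewrite subr_ge0 invf_le1 ?lerDl ?sqr_ge0// ltr_wpDr ?sqr_ge0.
Qed.

Lemma atanV_sum x : 0 < x -> atan x + atan x^-1 = pi / 2.
Proof.
move=> x0.
have const a b : 0 < a -> a <= b -> atan a + atan a^-1 = atan b + atan b^-1.
  move=> a0 ab; apply/esym/eqP; rewrite -subr_eq0 -normr_le0.
  have := @increment_le _ (fun y => atan y + atan y^-1) (fun=> 0) (fun=> 0) (fun=> 0) a b ab.
  rewrite subrr; apply => [y /andP[ay _]|y _].
  - have y0 : 0 < y by exact: lt_le_trans ay.
    have dV : is_derive y 1 (fun z : R => z^-1) (- y ^- 2).
      have h := drvV (lt0r_neq0 y0) (is_derive_id y (1 : R)).
      by apply: (drv_eq h); field; rewrite gt_eqF.
    have h := drvD (is_derive1_atan y)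
      (@drv_comp _ _ (fun z : R => z^-1) y _ _ (is_derive1_atan _) dV).
    apply: (drv_eq h); have y2 := sqr_ge0 y.
    by field; rewrite !gt_eqF//; lra.
  - by rewrite normr0.
have e1 : atan 1 + atan 1^-1 = pi / 2 :> R by rewrite invr1 atan1; lra.
have [x1|/ltW x1] := leP 1 x; first by rewrite -(const _ _ _ x1).
by rewrite (const _ _ x0 x1).
Qed.

(** By the complement formula for atan, the defect from pi / 2 is atan (1 / x). *)
Lemma atan_near_pihalf x : 0 < x -> pi / 2 - x^-1 <= atan x <= pi / 2.
Proof.
move=> x0; rewrite (ltW (atan_ltpi2 x)) andbT.
have := atanV_sum x0; have := @atan_le x^-1; rewrite invr_ge0 => /(_ (ltW x0)); lra.
Qed.

Lemma ln_quotient_bound x y : 0 < x -> 0 < y -> ln x - ln y <= (x - y) / y.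
Proof.
move=> x0 y0; rewrite -ln_div ?posrE//.
have := @le_ln1Dx R (x / y - 1); rewrite (_ : 1 + _ = x / y); last by ring.
rewrite mulrBl divff ?gt_eqF//; apply.
by rewrite ltrBrDr addNr divr_gt0.
Qed.

(** The points t and - t are almost equally far from c, so that the real part is
    small; the imaginary part is the angle under which c sees [- t, t], up to the
    sign s of Im c, and this angle tends to pi. *)
Lemma clog_jump s c t n : s = 1 \/ s = -1 -> 0 < s * complex.Im c -> 0 < t ->
  cnorm c <= n -> n <= t / 2 ->
  cnorm (clog c t - clog c (- t) - 'i%C * (s * pi)%:C) <= 12 * n / t.
Proof.
move=> s1 sb t0 cn nt.
have ha := le_trans (cnorm_ge_Re c) cn; have hb := le_trans (cnorm_ge_Im c) cn.
apply: le_trans (cnorm_le_ReIm _) _.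
rewrite !(ReB, ImB) ReM ImM /= !(mul0r, mul1r, oppr0, subr0, add0r).
move: (complex.Re c) (complex.Im c) sb ha hb => a b sb ha hb.
have bE : exists2 r : R, 0 < r & b = s * r /\ r <= n.
  by case: s1 sb => ->; [exists b|exists (- b)]; move: hb; rewrite ?ler_norml; lra.
have [r r0 [-> rn]] := bE.
have sV : s^-1 = s by case: s1 => ->; rewrite ?invrN invr1.
have atS x : atan (s * x) = s * atan x.
  by case: s1 => ->; rewrite ?mul1r// !mulN1r atanN.
have sn : `|s| = 1 by case: s1 => ->; rewrite ?normrN normr1.
have s2 : s ^+ 2 = 1 by case: s1 => ->; rewrite ?sqrrN expr1n.
have [a1 a2] : - (t / 2) <= a /\ a <= t / 2.
  by move: ha; rewrite ler_norml => /andP[? ?]; split; lra.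
have -> : (t - a) / (s * r) = s * ((t - a) / r) by rewrite invfM sV; ring.
have -> : (- t - a) / (s * r) = s * (- ((t + a) / r)) by rewrite invfM sV; ring.
rewrite !atS atanN exprMn s2 mul1r.
have xp : 0 < (t - a) / r by rewrite divr_gt0//; lra.
have xm : 0 < (t + a) / r by rewrite divr_gt0//; lra.
have inv x : t / 2 <= x -> (x / r)^-1 <= 2 * n / t.
  move=> tx; rewrite invf_div ler_pdivrMr; last by lra.
  rewrite mulrAC ler_pdivlMr//; have n0 : 0 <= n by lra.
  have := ler_wpM2l n0 tx; have := ler_wpM2r (ltW t0) rn; lra.
have /andP[p1 p2] := atan_near_pihalf xp; have /andP[m1 m2] := atan_near_pihalf xm.
have hI : `|s * atan ((t - a) / r) - s * - atan ((t + a) / r) - s * pi| <= 4 * n / t.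
  have -> : s * atan ((t - a) / r) - s * - atan ((t + a) / r) - s * pi =
    s * (atan ((t - a) / r) + atan ((t + a) / r) - pi) by ring.
  rewrite normrM sn mul1r.
  have := inv (t - a) ltac:(lra); have := inv (t + a) ltac:(lra).
  by rewrite ler_norml; lra.
have r2 : 0 < r ^+ 2 by rewrite exprn_gt0.
have tt : 0 < t ^+ 2 by rewrite exprn_gt0.
have Xp : t ^+ 2 / 4 <= (t - a) ^+ 2 + r ^+ 2 by nra.
have Xm : t ^+ 2 / 4 <= (- t - a) ^+ 2 + r ^+ 2 by nra.
have quo (x z : R) : t ^+ 2 / 4 <= x -> t ^+ 2 / 4 <= z -> x - z <= 4 * t * n ->
    ln x - ln z <= 16 * n / t.
  move=> hx hz xz; have z0 : 0 < z by lra.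
  apply: le_trans (ln_quotient_bound _ z0) _; first by lra.
  rewrite ler_pdivrMr//; apply: le_trans xz _.
  rewrite [leRHS]mulrAC ler_pdivlMr//.
  have n0 : 0 <= n by lra.
  have := ler_wpM2l n0 hz; lra.
have ta := ler_wpM2l (ltW t0) ha.
have [na1 na2] : t * a <= t * n /\ - (t * n) <= t * a.
  by move: ha; rewrite ler_norml => /andP[h1 h2]; split;
    [have := ler_wpM2l (ltW t0) h2|have := ler_wpM2l (ltW t0) h1]; lra.
have L1 := quo _ _ Xp Xm ltac:(lra).
have L2 := quo _ _ Xm Xp ltac:(lra).
have hR : `|ln ((t - a) ^+ 2 + r ^+ 2) / 2 - ln ((- t - a) ^+ 2 + r ^+ 2) / 2| <= 8 * n / t.
  by rewrite ler_norml; lra.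
by apply: (le_trans (lerD hR hI)); lra.
Qed.

End LogarithmJump.

(** * The limit in each half-plane *)

Section HalfPlaneLimit.
Context {R : realType}.
Implicit Types (c p : R[i]) (d e s y : R).

Lemma half_plane_proper s : s = 1 \/ s = -1 ->
  ProperFilter (within [set c : R[i] | 0 < s * complex.Im c] (nbhs (0 : R[i]))).
Proof.
move=> s1; apply: Build_ProperFilter_ex.
move=> P /near_half_plane[d d0 h]; exists (0 +i* (s * (d / 2))); apply: h.
  apply: le_lt_trans (cnorm_le_ReIm _) _ => /=.
  rewrite normr0 add0r normrM (gtr0_norm (divr_gt0 d0 (ltr0n _ 2))).
  by case: s1 => ->; rewrite ?normrN normr1; lra.
by case: s1 => -> /=; lra.
Qed.

Lemma O_domain_near (Co eps0 : R) : 1 < Co -> 0 < eps0 ->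
  exists2 d, 0 < d & forall c, cnorm c < d -> complex.Im c != 0 -> O_domain Co eps0 c.
Proof.
move=> C1 e0; have Cp : 0 < Co by lra.
have Ci : 0 < Co^-1 by rewrite invr_gt0.
exists (Num.min (1 / 2) (Num.min (Co^-1 / 2) eps0)).
  by rewrite !lt_min e0 andbT; apply/andP; split; lra.
move=> c; rewrite !lt_min => /andP[c1 /andP[c2 c3]] ci.
have ha := cnorm_ge_Re c; have hb := cnorm_ge_Im c.
have ha' : `|complex.Re c| <= 1 / 2 by lra.
have [a1 a2] : - (1 / 2) <= complex.Re c /\ complex.Re c <= 1 / 2.
  by move: ha'; rewrite ler_norml => /andP[? ?]; split; lra.
split; first by apply/andP; split; lra.
rewrite normr_gt0 ci /= lt_min; apply/andP; split; last by lra.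
have h : 1 / 2 <= 1 - complex.Re c ^+ 2 by nra.
have := ler_wpM2l (ltW Ci) h; lra.
Qed.

(** The jump of the logarithm tends to i s pi, where s is the sign of Im c, so
    [solvability_limit] gives the limit of q 0; at any other y, c Phi = sech q and q
    differs from q 0 by O(|c|). *)
Lemma half_plane_limit (Co eps0 : R) (phi1 : R -> R -> R) (f : R -> R[i])
    (Phi : R -> R[i] -> R[i]) s :
  1 < Co -> 0 < eps0 -> is_phi1 phi1 ->
  H1_weighted (fun y => (derive1 tanh y) ^- 2) f ->
  (forall c, O_domain Co eps0 c -> is_H2_solution f c (Phi^~ c)) ->
  s = 1 \/ s = -1 ->
  forall y d, 0 < d -> \forall c \near within [set c | 0 < s * complex.Im c] (nbhs (0 : R[i])),
    cnorm (c * Phi y c - (calT phi1 f 0 + 'i%C * (s * pi)%:C * f 0) /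
      (2 * ('i%C * (s * pi)%:C)) * (sech y)%:C) <= d.
Proof.
move=> C1 e00 hphi hf hPhi s1.
have cf : continuous f by case: hf.
have [K K0 hK] := H1_weighted_half_holder hf.
have [K' fa] := half_holder_admissible K0 hK; have [K'0 _ _ _] := fa.
have [I1 [I2 [T [b [[dI1 vI1] [dI2 vI2] TE [B B0 bB] TI]]]]] := outer_integrals hphi cf K0 hK.
have [C0 [C2 [C00 C20 solv]]] := solvability fa dI1 vI1 dI2 vI2 TE B0 bB.
have [Cs Cs0 oscP] := @oscillation_small R.
set F := within _ _; have PF : ProperFilter F by exact: half_plane_proper.
have small d : 0 < d -> \forall c \near F, cnorm c <= d.
  by move=> d0; apply/near_half_plane; exists d => // c /ltW.
have [r r0 rO] := O_domain_near C1 e00.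
have system : \forall c \near F, complex.Im c != 0 /\ exists W,
    wronskian_system f c (fun y => (cosh y)%:C * (c * Phi y c)) W.
  apply/near_half_plane; exists r => // c cr sc.
  have ci : complex.Im c != 0 by apply: contraTneq sc => ->; rewrite mulr0 ltxx.
  by split => //; apply: wronskian_system_of_H2_solution => //; apply: hPhi; exact: rO.
set p := 'i%C * (s * pi)%:C.
have pi1 : 1 <= (pi : R) by have := pi_ge2 R; lra.
have p1 : 1 <= cnorm p.
  apply: le_trans (cnorm_ge_Im p); rewrite /p ImM /= mul0r mul1r add0r normrM.
  rewrite (ger0_norm (ltW (pi_gt0 R))).
  by case: s1 => ->; rewrite ?normrN normr1; lra.
have pn0 : p != 0 by apply: contraTneq p1 => ->; rewrite cnorm0 -ltNge ltr01.
pose q c := c * Phi 0 c; pose J e c := clog c (tanh e) - clog c (- tanh e).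
have q0E c : (cosh 0)%:C * (c * Phi 0 c) = q c by rewrite cosh0 rmorph1 mul1r.
have Jp e d : 0 < e -> 0 < d -> \forall c \near F, cnorm (J e c - p) <= d.
  move=> ep dp; have t0 := tanh_gt0 ep.
  have m0 : 0 < Num.min (tanh e / 2) (d * tanh e / 12).
    by rewrite lt_min; apply/andP; split; apply: divr_gt0 => //; exact: mulr_gt0.
  apply/near_half_plane; exists (Num.min (tanh e / 2) (d * tanh e / 12)) => // c.
  rewrite lt_min => /andP[/ltW c1 c2] sc.
  apply: le_trans (clog_jump s1 sc t0 (lexx _) c1) _.
  by rewrite ler_pdivrMr//; lra.
have main e : 0 < e -> e <= 1 -> exists2 A, 0 <= A & \forall c \near F,
    cnorm ((f 0 - 2 * q c) * J e c + T e) <= (1 + cnorm (q c)) *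
     (C2 * Num.sqrt (2 * e) + A * cnorm c + C2 * Num.sqrt (cnorm c) * cnorm (J e c)).
  move=> ep e1'; have [A A0 hA] := solv e ep e1'; exists A => //.
  have t0 := tanh_gt0 ep.
  have m0 : 0 < Num.min (1 / 4) (Num.min ((2 * (C0 + 1))^-1) (tanh e / 2)).
    by move: C00 t0; clear => h1 h2; rewrite !lt_min invr_gt0; apply/and3P; split; lra.
  apply: filterS2 system (small _ m0) => c [ci [W sys]].
  rewrite !le_min => /and3P[c1 c2 c3]; rewrite -q0E.
  apply: hA sys ci c1 _ _; last by lra.
  move: c2; rewrite -[leRHS]mul1r ler_pdivlMr; last by lra.
  have := cnorm_ge0 c; lra.
have [L [TL qL]] := solvability_limit PF p1 C20 small Jp main.
have -> : calT phi1 f 0 = L.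
  apply: cvg_lim; first exact: norm_hausdorff.
  apply: cvg_complex => d /TL[eT eT0 hT].
  near=> e.
  have ep : 0 < e by near: e; exact: nbhs_right_gt.
  have ee : e <= eT by near: e; exact: nbhs_right_le.
  by rewrite TI//; exact: hT.
set A := (L + p * f 0) / (2 * p) in qL *.
move=> y d d0; have E0 := expR_gt0 (2 * `|y|).
have A0 := cnorm_ge0 A.
have Y0 : 0 < K' + cnorm A + 1 by lra.
pose k := 4 * (Cs + 1) * (K' + cnorm A + 1) * expR (2 * `|y|).
have k0 : 0 < k by rewrite /k !mulr_gt0//; lra.
have m0 : 0 < Num.min (1 / 4) (Num.min ((2 * (Cs + 1))^-1) (d / k)).
  rewrite !lt_min invr_gt0 (divr_gt0 d0 k0) andbT.
  by move: Cs0; clear => h; apply/andP; split; lra.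
have m1 : 0 < Num.min 1 (d / 2) by rewrite lt_min ltr01 divr_gt0.
apply: filterS3 system (small _ m0) (qL _ m1) => c [ci [W sys]].
rewrite !le_min => /and3P[c1 c2 c3] /andP[q1 q2].
have c0 := cnorm_ge0 c.
have cC : 2 * (Cs * cnorm c) <= 1.
  move: c2; rewrite -[leRHS]mul1r ler_pdivlMr; first by move: c0; clear; lra.
  by move: Cs0; clear; lra.
have [osc _] := oscP _ _ _ _ _ fa sys ci c1 cC.
have := osc y; rewrite q0E => {}osc.
have sy0 := sech_gt0 y; have sy1 := sech_le1 y.
have -> : c * Phi y c - A * (sech y)%:C =
    (sech y)%:C * (((cosh y)%:C * (c * Phi y c) - q c) + (q c - A)).
  have : (cosh y)%:C * (sech y)%:C = 1 :> R[i] by rewrite -rmorphM cosh_sech rmorph1.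
  move: (cosh y)%:C (sech y)%:C => ch sh hh.
  move: (c * Phi y c) (q c) => u v.
  have -> : sh * (ch * u - v + (v - A)) = (ch * sh) * u - A * sh by ring.
  by rewrite hh mul1r.
have qb : cnorm (q c) <= cnorm A + 1.
  by have := cnormD (q c - A) A; rewrite subrK; move: q1; clear; lra.
have hk : 2 * (Cs * (cnorm c * (K' + cnorm (q c)))) * expR (2 * `|y|) <= d / 2.
  have h1 : cnorm c * k <= d by rewrite -ler_pdivlMr.
  have h2 : Cs * (K' + cnorm (q c)) <= (Cs + 1) * (K' + cnorm A + 1).
    apply: ler_pM => //; first by apply: addr_ge0; [|exact: cnorm_ge0].
      by rewrite lerDl.
    by rewrite -addrA lerD2l.
  have := ler_wpM2l (mulr_ge0 c0 (ltW E0)) h2.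
  by move: h1; rewrite /k; clear; lra.
rewrite cnormM cnormR (gtr0_norm sy0).
apply: le_trans (ler_piMl (cnorm_ge0 _) sy1) _.
by apply: le_trans (cnormD _ _) _; move: osc hk q2; clear; lra.
Unshelve. all: by end_near. Qed.

End HalfPlaneLimit.

(** * The limits and the bound *)

Theorem proposition6p1 (R : realType) (Co eps0 : R) (phi1 : R -> R -> R)
    (f : R -> R[i]) (Phi : R -> R[i] -> R[i])
    (hCo : 1 < Co) (heps0 : 0 < eps0 < 2^-1)
    (hphi1 : is_phi1 phi1)
    (hf : H1_weighted (fun y => (derive1 tanh y) ^- 2) f)
    (hPhi : forall c, O_domain Co eps0 c -> is_H2_solution f c (Phi^~ c)) :
  (forall y : R, y != 0 ->
     c * Phi y c @[c --> within [set c | 0 < complex.Im c] (nbhs (0 : R[i]))] -->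
       (calT phi1 f 0 + 'i%C * pi%:C * f 0) / (2 * pi%:C * 'i%C) * (sech y)%:C
     /\
     c * Phi y c @[c --> within [set c | complex.Im c < 0] (nbhs (0 : R[i]))] -->
       (calT phi1 f 0 - 'i%C * pi%:C * f 0) / (- (2 * pi%:C * 'i%C)) * (sech y)%:C)
  /\
  (forall y : R, y != 0 ->
     exists2 delta1 : R, 0 < delta1 &
     forall delta : R, 0 < delta < delta1 ->
       Cball delta `\` real_segment `<=` O_domain Co eps0 /\
       exists C : R, forall c, (Cball delta `\` real_segment) c ->
         cnorm (c * Phi y c) <= C).
Proof.
have /andP[e00 _] := heps0.
pose F (s : R) := within [set c : R[i] | 0 < s * complex.Im c] (nbhs (0 : R[i])).
pose A (s : R) : R[i] := (calT phi1 f 0 + 'i%C * (s * pi)%:C * f 0) /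
      (2 * ('i%C * (s * pi)%:C)).
have lim s : s = 1 \/ s = -1 -> forall y d, 0 < d ->
    \forall c \near F s, cnorm (c * Phi y c - A s * (sech y)%:C) <= d.
  by move=> s1 y d; apply: (half_plane_limit hCo e00 hphi1 hf hPhi s1).
have one : (1 : R) = 1 \/ (1 : R) = -1 by left.
have mone : (-1 : R) = 1 \/ (-1 : R) = -1 by right.
split=> y _.
  split.
  - have -> : (calT phi1 f 0 + 'i%C * pi%:C * f 0) / (2 * pi%:C * 'i%C) = A 1.
      by rewrite /A mul1r; congr (_ / _); rewrite -mulrA [pi%:C * _]mulrC.
    have -> : [set c : R[i] | 0 < complex.Im c] = [set c | 0 < 1 * complex.Im c].
      by apply/funext => c /=; rewrite mul1r.
    apply: cvg_complex => d d0; exact: lim.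
  - have -> : (calT phi1 f 0 - 'i%C * pi%:C * f 0) / (- (2 * pi%:C * 'i%C)) = A (-1).
      rewrite /A mulN1r rmorphN /= mulrN mulrN mulNr; congr (_ / - _).
      by rewrite -mulrA [pi%:C * _]mulrC.
    have -> : [set c : R[i] | complex.Im c < 0] = [set c | 0 < -1 * complex.Im c].
      by apply/funext => c /=; rewrite mulN1r oppr_gt0.
    apply: cvg_complex => d d0; exact: lim.
have [r r0 rO] := O_domain_near hCo e00.
have /near_half_plane[dp dp0 hp] := lim 1 one y 1 ltr01.
have /near_half_plane[dm dm0 hm] := lim (-1) mone y 1 ltr01.
(* delta1 <= 1 places the real points of the ball on the segment, so that all
   other points lie in one of the two half-planes. *)
exists (Num.min (Num.min 1 r) (Num.min dp dm)).
  by rewrite !lt_min ltr01 r0 dp0 dm0.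
move=> d /andP[d0]; rewrite !lt_min => /andP[/andP[d1 dr] /andP[ddp ddm]].
have nonreal c : (Cball d `\` real_segment) c -> complex.Im c != 0.
  move=> [/= cd nc]; apply/eqP => ci; apply: nc; exists (complex.Re c).
    rewrite /= in_itv /= -ltr_norml; apply: le_lt_trans (cnorm_ge_Re c) _.
    exact: lt_trans cd d1.
  by apply: eq_ReIm.
split.
  move=> c hc; have ci := nonreal c hc; apply: rO => //.
  by case: hc => /= cd _; exact: lt_trans cd dr.
exists (1 + cnorm (A 1 * (sech y)%:C) + cnorm (A (-1) * (sech y)%:C)) => c hc.
have ci := nonreal c hc; have [/= cd _] := hc.
have a1 := cnorm_ge0 (A 1 * (sech y)%:C); have a2 := cnorm_ge0 (A (-1) * (sech y)%:C).
have [cneg|cpos|cz] := ltgtP (complex.Im c) 0; last by rewrite cz eqxx in ci.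
  have := hm c (lt_trans cd ddm); rewrite mulN1r oppr_gt0 => /(_ cneg) h.
  have := cnormD (c * Phi y c - A (-1) * (sech y)%:C) (A (-1) * (sech y)%:C).
  rewrite subrK; lra.
have := hp c (lt_trans cd ddp); rewrite mul1r => /(_ cpos) h.
have := cnormD (c * Phi y c - A 1 * (sech y)%:C) (A 1 * (sech y)%:C).
rewrite subrK; lra.
Qed.
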